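(* Assume the stabilization parameter $\sigma$ is large enough and $h$ is sufficiently small. Let $\mathbf A$ be the stiffness matrix of the enriched immersed finite element scheme, i.e. the matrix of the bilinear form $a_h$ on $\mathcal S_h^0$ with respect to the nodal basis of $\mathcal S_h^0$, and let $\kappa_2(\cdot)$ denote the spectral condition number of a matrix. Then $$\kappa_2(\mathbf A)\lesssim h^{-2},$$ with a hidden constant independent of $h$ and of the location of the interface relative to the mesh.
   Context: Setting. $\Omega\subset\mathbb R^3$ is a bounded open domain, separated into subdomains $\Omega^-,\Omega^+$ by a closed, sufficiently smooth (at least $C^2$) surface $\Gamma\subset\Omega$. $\beta=\beta^\pm$ on $\Omega^\pm$ with constants $\beta^\pm>0$; $\mathbf n$ is a unit normal to $\Gamma$. For a region $\omega$ cut by $\Gamma$, $\omega^\pm=\omega\cap\Omega^\pm$. Gradients are taken piecewise. Mesh. $\mathcal T_h$ is a tetrahedral mesh of $\Omega$ obtained by subdividing each cell of a background cubic mesh of size $h$ into regular tetrahedra; it need not fit $\Gamma$. $\mathcal T_h^i$ and $\mathcal F_h^i$ are the elements and faces cut by $\Gamma$; $\mathcal T_h^n=\mathcal T_h\setminus\mathcal T_h^i$. Assumption: $\Gamma$ cuts the edges of each $T\in\mathcal T_h^i$ in exactly 3 or 4 points, located on different edges. For $T\in\mathcal T_h^i$, $D_1,D_2,D_3$ are three of these points forming a triangle whose angles are bounded above by a fixed $\theta<\pi$; $\Gamma_h^T$ is the plane through them, $\bar{\mathbf n}$ its unit normal oriented consistently with $\mathbf n$. Homogeneous IFE space. For $T\in\mathcal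 T_h^i$, $\mathcal S_h^0(T)$ is the (4-dimensional) space of piecewise linear $\phi$ on $T$ ($\phi|_{T^\pm}=\phi^\pm\in\mathcal P_1$) with $\phi^+(D_i)=\phi^-(D_i)$, $i=1,2,3$, and $\beta^+\nabla\phi^+\cdot\bar{\mathbf n}=\beta^-\nabla\phi^-\cdot\bar{\mathbf n}$; its elements are uniquely determined by their values at the four vertices of $T$. $\mathcal S_h^0$ is the space of $v_h\in L^2(\Omega)$ with $v_h|_T\in\mathcal P_1(T)$ for $T\in\mathcal T_h^n$, $v_h|_T\in\mathcal S_h^0(T)$ for $T\in\mathcal T_h^i$, $v_h$ continuous at every mesh node, and $v_h|_{\partial\Omega}=0$. Its nodal basis consists of the functions in $\mathcal S_h^0$ equal to 1 at one interior node and 0 at all other nodes. Bilinear form. On a face $F$ shared by two elements, with fixed unit normal $\mathbf n$, $[\![\cdot]\!]$ is the jump (trace from the element that $\mathbf n$ leaves minus the trace from the other) and $\{\cdot\}$ the average of the traces. With $h_F$ the size of $F$ ($h_F\simeq h$) and a constant $\sigma>0$, $$a_h(w,v)=\sum_{T\in\mathcal T_h}\int_T\beta\nabla w\cdot\nabla v-\sum_{F\in\mathcal F_h^i}\int_F\{\beta\nabla w\cdot\mathbf n\}[\![v]\!]\,ds-\sum_{F\in\mathcal F_h^i}\int_F\{\beta\nabla v\cdot\mathbf n\}[\![w]\!]\,ds+\sum_{F\in\mathcal F_h^i}\frac{\sigma}{h_F}\int_F[\![w]\!][\![v]\!]\,ds.$$ $a\lesssim b$ means $a\le Cb$ with $C$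 independent of $h$ and of the location of $\Gamma$ relative to the mesh (it may depend on $\Omega,\Gamma,\beta^\pm,\sigma$).
   Formalization: A cube cannot be subdivided into regular tetrahedra; the elements are instead required to contain a ball of radius comparable to h and to have no obtuse dihedral angle (with obtuse angles, vertex values need not determine the immersed functions). *)

(* Defs.v *)
From HB Require Import structures.
From mathcomp Require Import all_boot all_order all_algebra.
From mathcomp Require Import all_classical all_reals all_analysis.

Set Implicit Arguments.
Unset Strict Implicit.
Unset Printing Implicit Defensive.

Import Order.TTheory GRing.Theory Num.Theory.
Import numFieldNormedType.Exports.

Local Open Scope classical_set_scope.
Local Open Scope ring_scope.

(* Euclidean geometry of R^3.  The library norm on matrices is the max norm,
   hence the separate [enorm]. *)

Section Euclid.
Variable R : realType.
Local Notation pt := 'rV[R]_3.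

Definition dot (u v : pt) : R := \sum_(i < 3) u 0 i * v 0 i.

Definition enorm (m n : nat) (A : 'M[R]_(m, n)) : R :=
  Num.sqrt (\sum_(i < m) \sum_(j < n) A i j ^+ 2).

Definition angle (u v : pt) : R := acos (dot u v / (enorm u * enorm v)).

Definition orth_part (e u : pt) : pt := u - (dot u e / dot e e) *: e.

(* Angle between the half-planes bounded by the line [k l] and containing
   [p], respectively [q]. *)
Definition dihedral_angle (k l p q : pt) : R :=
  angle (orth_part (l - k) (p - k)) (orth_part (l - k) (q - k)).

Definition diameter (A : set pt) : R :=
  sup [set d | exists p q, [/\ A p, A q & d = enorm (p - q)]].

(* Unit vector orthogonal to the affine hull of [A]; its sign is free. *)
Definition unit_normal (n : pt) (A : set pt) : Prop :=
  enorm n = 1 /\ forall p q, A p -> A q -> dot n (p - q) = 0.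

Definition is_domain (A : set pt) : Prop :=
  [/\ open A, connected A & A !=set0].

End Euclid.

Section Calculus.
Variable R : realType.
Local Notation pt := 'rV[R]_3.

Definition partial (f : pt -> R) (i : 'I_3) (x : pt) : R :=
  'D_(delta_mx 0 i) f x.

Definition grad (f : pt -> R) (x : pt) : pt := \row_i partial f i x.

Definition C1_on (U : set pt) (f : pt -> R) : Prop :=
  forall i x, U x ->
    derivable f x (delta_mx 0 i) /\ {for x, continuous (partial f i)}.

Definition C2_on (U : set pt) (f : pt -> R) : Prop :=
  C1_on U f /\ forall i, C1_on U (partial f i).

(* Compact embedded C^2 surface without boundary: locally a regular level
   set. *)
Definition closed_C2_surface (S : set pt) : Prop :=
  compact S /\
  forall p, S p -> exists (U : set pt) (g : pt -> R),
    [/\ open U, U p, C2_on U g, (forall x, U x -> grad g x != 0) &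
        S `&` U = [set x | U x /\ g x = 0]].

Definition pt_of (p : R * R * R) : pt :=
  \row_(i < 3) nth 0 [:: p.1.1; p.1.2; p.2] i.

Definition vol_int (A : set pt) (f : pt -> R) : R :=
  \int[((@lebesgue_measure R \x @lebesgue_measure R)
          \x @lebesgue_measure R)%E]_(p in pt_of @^-1` A) f (pt_of p).

(* Surface integral over the part lying in [A] of the (open) triangle with
   vertices [a], [b], [c]: the surface element of the affine parametrization
   a + s (b - a) + t (c - a) is |(b - a) x (c - a)| ds dt. *)
Definition tri_point (a b c : pt) (st : R * R) : pt :=
  a + st.1 *: (b - a) + st.2 *: (c - a).

Definition tri_int (a b c : pt) (A : set pt) (f : pt -> R) : R :=
  Num.sqrt (dot (b - a) (b - a) * dot (c - a) (c - a)
            - dot (b - a) (c - a) ^+ 2) *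
  \int[(@lebesgue_measure R \x @lebesgue_measure R)%E]_(st in
      [set st : R * R | [/\ 0 < st.1, 0 < st.2, st.1 + st.2 < 1 &
                          A (tri_point a b c st)]])
    f (tri_point a b c st).

(* Value at [x] of the trace of [f] taken from the side into which [w]
   points: the limit of f (x + t w) as t tends to 0 from the right. *)
Definition trace_from (f : pt -> R) (w x : pt) : R :=
  lim (f (x + t *: w) @[t --> 0^'+]).

(* A unit normal [n] leaves the element lying on the side of [- n]. *)
Definition jump (n : pt) (f : pt -> R) (x : pt) : R :=
  trace_from f (- n) x - trace_from f n x.

Definition average (n : pt) (f : pt -> R) (x : pt) : R :=
  (trace_from f (- n) x + trace_from f n x) / 2.

End Calculus.

Section Interface.
Variable R : realType.
Local Notation pt := 'rV[R]_3.

Record interface := Interface {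
  Omega : set pt;
  Omega_m : set pt;
  Omega_p : set pt;
  Gamma : set pt;
  beta_m : R;
  beta_p : R }.

Definition interface_problem (P : interface) : Prop :=
  [/\ [/\ is_domain (Omega P), bounded_set (Omega P),
          is_domain (Omega_m P) & is_domain (Omega_p P)],
      [/\ closed_C2_surface (Gamma P), Gamma P `<=` Omega P,
          Omega P `\` Gamma P = Omega_m P `|` Omega_p P &
          Omega_m P `&` Omega_p P = set0],
      Gamma P `<=` closure (Omega_m P) `&` closure (Omega_p P) &
      0 < beta_m P /\ 0 < beta_p P].

(* Only used off [Gamma P]. *)
Definition beta (P : interface) (x : pt) : R :=
  if x \in Omega_p P then beta_p P else beta_m P.

End Interface.

(* A tetrahedral mesh is given by its nodes and the vertex sets of its
   elements; faces and edges are the vertex subsets of size 3 and 2. *)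

Record mesh (R : realType) := Mesh {
  nnodes : nat;
  node : 'I_nnodes -> 'rV[R]_3;
  elems : {set {set 'I_nnodes}} }.

Section Mesh.
Variables (R : realType) (M : mesh R).
Local Notation pt := 'rV[R]_3.
Local Notation vset := {set 'I_(nnodes M)}.

Definition simplex (S : vset) : set pt :=
  [set p | exists l : 'I_(nnodes M) -> R,
    [/\ (forall i, i \in S -> 0 <= l i), \sum_(i in S) l i = 1 &
        p = \sum_(i in S) l i *: node i]].

Definition open_simplex (S : vset) : set pt :=
  [set p | exists l : 'I_(nnodes M) -> R,
    [/\ (forall i, i \in S -> 0 < l i), \sum_(i in S) l i = 1 &
        p = \sum_(i in S) l i *: node i]].

Definition is_face (F : vset) : Prop :=
  #|F| = 3%N /\ exists2 T : vset, T \in elems M & F \subset T.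

Definition is_edge_of (T E : vset) : Prop := #|E| = 2%N /\ E \subset T.

Definition mesh_region : set pt :=
  [set p | exists2 T : vset, T \in elems M & simplex T p].

Definition conforming_mesh (D : set pt) : Prop :=
  [/\ injective (@node R M),
      (forall i, exists2 T : vset, T \in elems M & i \in T),
      (forall T : vset, T \in elems M -> #|T| = 4%N),
      (forall T T' : vset, T \in elems M -> T' \in elems M ->
         simplex T `&` simplex T' = simplex (T :&: T')%SET) &
      D = interior mesh_region].

Definition cube_cell (a : pt) (h : R) (k : 'I_3 -> int) : set pt :=
  [set x | forall i, a 0 i + h * (k i)%:~R <= x 0 i <=
                     a 0 i + h * (k i + 1)%:~R].

Definition subdivides_cubic_mesh (h : R) : Prop :=
  exists (a : pt) (K : set ('I_3 -> int)),
    mesh_region = \bigcup_(k in K) cube_cell a h k /\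
    forall T : vset, T \in elems M ->
      exists2 k, K k & simplex T `<=` cube_cell a h k.

(* A cube cannot be cut into equilateral tetrahedra; regular means here that
   the elements are uniformly fat with respect to the mesh size and have no
   obtuse dihedral angle.  The usual subdivisions of a cube into five or six
   tetrahedra qualify.  With an obtuse dihedral angle the vertex values do
   not determine the local immersed functions for all coefficients and all
   positions of the interface. *)
Definition regular_elements (rho h : R) : Prop :=
  forall T : vset, T \in elems M ->
    (exists c : pt, [set p | enorm (p - c) <= rho * h] `<=` simplex T) /\
    (forall i j k l, [set i; j; k; l]%SET = T ->
       uniq [:: i; j; k; l] ->
       dihedral_angle (node k) (node l) (node i) (node j) <= pi / 2).

(* Cut by [G]: met by [G] in the relative interior. *)
Definition cut (G : set pt) (S : vset) : Prop :=
  open_simplex S `&` G !=set0.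

Definition edge_points (G : set pt) (T : vset) : set pt :=
  [set p | G p /\ exists2 E, is_edge_of T E & simplex E p].

Definition cuts_three_or_four_edges (G : set pt) (T : vset) : Prop :=
  exists (m : nat) (p : 'I_m -> pt) (E : 'I_m -> vset),
    [/\ m = 3%N \/ m = 4%N, injective p /\ injective E,
        (forall i, is_edge_of T (E i) /\ simplex (E i) (p i)) &
        edge_points G T = range p].

(* [D T] lists the three chosen points of the cut element [T]. *)
Definition interface_points (G : set pt) (theta : R)
    (D : vset -> 'I_3 -> pt) : Prop :=
  forall T : vset, T \in elems M -> cut G T ->
    [/\ cuts_three_or_four_edges G T, injective (D T),
        (forall i, edge_points G T (D T i)) &
        (forall i j k, uniq [:: i; j; k] ->
           angle (D T j - D T i) (D T k - D T i) <= theta)].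

End Mesh.

Section Scheme.
Variables (R : realType) (P : interface R) (M : mesh R).
Local Notation pt := 'rV[R]_3.
Local Notation vset := {set 'I_(nnodes M)}.
Variable D : vset -> 'I_3 -> pt.

Definition P1_on (A : set pt) (v : pt -> R) : Prop :=
  exists (a : R) (b : pt), forall x, A x -> v x = a + dot b x.

(* The flux condition does not depend on the sign of the normal of the
   plane through the three points. *)
Definition local_IFE (T : vset) (v : pt -> R) : Prop :=
  exists (am ap : R) (bm bp : pt),
    [/\ (forall x, open_simplex T x -> Omega_m P x -> v x = am + dot bm x),
        (forall x, open_simplex T x -> Omega_p P x -> v x = ap + dot bp x),
        (forall i, ap + dot bp (D T i) = am + dot bm (D T i)) &
        (forall nbar, unit_normal nbar (range (D T)) ->
           beta_p P * dot bp nbar = beta_m P * dot bm nbar)].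

(* Element interiors with the interface removed: the values of a piecewise
   polynomial function elsewhere are immaterial, and its traces, limits and
   gradients are taken from this set. *)
Definition smooth_region : set pt :=
  [set x | exists2 T : vset, T \in elems M & (open_simplex T `\` Gamma P) x].

Definition IFE_space (v : pt -> R) : Prop :=
  [/\ (forall T : vset, T \in elems M -> ~ cut (Gamma P) T ->
         P1_on (open_simplex T) v),
      (forall T : vset, T \in elems M -> cut (Gamma P) T -> local_IFE T v),
      (forall i : 'I_(nnodes M),
         v x @[x --> within smooth_region (nbhs (node i))] --> v (node i)) &
      (forall z, closure (Omega P) z -> ~ Omega P z ->
         v x @[x --> within smooth_region (nbhs z)] --> (0 : R))].

Definition interior_nodes : vset :=
  finset (fun i : 'I_(nnodes M) => node i \in Omega P).

Definition nodal_basis (phi : 'I_(nnodes M) -> pt -> R) : Prop :=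
  forall i, i \in interior_nodes ->
    IFE_space (phi i) /\ forall j, phi i (node j) = (j == i)%:R.

(* An integral over an element or a face cut by the interface is the sum of
   the integrals over its two parts, off [Gamma P]. *)
Definition elem_int (T : vset) (f : pt -> R) : R :=
  vol_int (open_simplex T `\` Gamma P) f.

Definition face_int (F : vset) (f : pt -> R) : R :=
  let p k := nth 0 [seq node i | i <- enum F] k in
  tri_int (p 0%N) (p 1%N) (p 2) (~` Gamma P) f.

(* [nF F] is the fixed unit normal of the face [F]. *)
Definition a_h (nF : vset -> pt) (sigma : R) (w v : pt -> R) : R :=
  let flux n u x := beta P x * dot (grad u x) n in
  \sum_(T in elems M)
     elem_int T (fun x => beta P x * dot (grad w x) (grad v x))
  - \sum_(F : vset | `[< is_face F /\ cut (Gamma P) F >])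
     face_int F (fun x => average (nF F) (flux (nF F) w) x * jump (nF F) v x)
  - \sum_(F : vset | `[< is_face F /\ cut (Gamma P) F >])
     face_int F (fun x => average (nF F) (flux (nF F) v) x * jump (nF F) w x)
  + \sum_(F : vset | `[< is_face F /\ cut (Gamma P) F >])
     sigma / diameter (simplex F) *
     face_int F (fun x => jump (nF F) w x * jump (nF F) v x).

Definition stiffness (nF : vset -> pt) (sigma : R)
    (phi : 'I_(nnodes M) -> pt -> R) : 'M[R]_#|interior_nodes| :=
  \matrix_(i, j) a_h nF sigma (phi (enum_val j)) (phi (enum_val i)).

End Scheme.

Definition opnorm2 (R : realType) (n : nat) (A : 'M[R]_n) : R :=
  sup [set enorm (A *m x) | x in [set x : 'cV[R]_n | enorm x <= 1]].

Definition kappa2 (R : realType) (n : nat) (A : 'M[R]_n) : \bar R :=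
  if A \in unitmx then (opnorm2 A * opnorm2 (invmx A))%:E else +oo%E.

(* Main.v *)
Require Import Defs.
From mathcomp Require Import all_boot all_order all_algebra.
From mathcomp Require Import all_classical all_reals all_analysis.
From mathcomp Require Import measurable_realfun ring lra.
Import Order.TTheory GRing.Theory Num.Theory.
Import numFieldNormedType.Exports.
Local Open Scope classical_set_scope.
Local Open Scope ring_scope.

Set Implicit Arguments.
Unset Strict Implicit.
Unset Printing Implicit Defensive.

(** The condition number of [A] is bounded by comparing its quadratic form with the
    Euclidean norm of the vector of nodal values: [x^T A x] is at least [c h^3 |x|^2]
    and [|y^T A x|] at most [C h (|x|^2 + |y|^2)], whence the ratio [C h^-2]
    ([kappa2_le]). All the work is to obtain [c] and [C] independent of the way the
    interface cuts the elements.

    Every function of the space is given on each element by two affine pieces, one for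
    each side of the interface, and [a_h] becomes a form on these pieces
    ([IFE_space_data], [a_h_data]). The essential point is a stability estimate on a
    single cut element ([local_estimates]). The gradients of the pieces differ by
    [c n], where [n] is the normal of the plane through the three interface points.
    Interpolating the nodal values gives [grad u^- = g - c p], where [g] is the gradient
    of the standard interpolant and [p] is the part of [n] coming from the nodes on the
    plus side, [n = p + m]. The flux condition then reads [t kappa = beta^+ g.n] for
    the normal derivative [t] of the minus piece, with
    [kappa = beta^+ (1 - S) + beta^- S] and [S = p.n]. Elements have no obtuse
    dihedral angle, so the gradients of distinct barycentric coordinates have
    nonpositive scalar products; since the nodes of the two pieces are on opposite
    sides of the plane, [p.m >= 0] and [S] lies in [[0, 1]], up to an error that
    vanishes with [h] ([distance_grads_obtuse]). Hence [kappa] stays away from zero,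
    and gradients and values of both pieces are controlled by the nodal values, and
    the two gradients by each other. The error is small because a C^1 surface is flat
    at small scales, uniformly by compactness ([flat_uniform]), and because the angles
    of the triangle of interface points are bounded away from [pi], so that its plane
    is close to the tangent plane ([triangle_plane], [cut_plane]).

    Coercivity then follows as for standard interior penalty forms: by Young's
    inequality the flux terms on the cut faces are absorbed by the penalty, at the cost
    of a multiple of the energy inversely proportional to [sigma] ([Bform_coercive]).
    The energy of an element dominates [h] times the squared differences of its nodal
    values, because a cube of volume proportional to [h^3] avoids the interface
    ([subcube]).

    Finally the differences control the values themselves by a discrete Poincare
    inequality ([poincare_rows]): starting from a node one follows the row of cubic
    cells until it leaves the domain, which takes at most of the order of [h^-1]
    steps, and there the values vanish. Consecutive cells share a corner, corners are
    nodes, and any two elements of a cell are linked by elements of the cell sharing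
    nodes; a volume argument bounds the number of elements of a cell ([packing]). *)

(** * Euclidean geometry of three-space *)

Section EuclideanSpace.
Variable R : realType.
Local Notation pt := 'rV[R]_3.
Implicit Types (u v w : pt) (c : R).

Lemma dotE u v : dot u v = u 0 0 * v 0 0 + u 0 1 * v 0 1 + u 0 2 * v 0 2.
Proof.
by rewrite /dot !big_ord_recl big_ord0 addr0 addrA; congr (_ + _ * _ + _ * _);
  congr (_ 0 _); apply/val_inj.
Qed.

Lemma ord3P (Q : 'I_3 -> Prop) : Q 0 -> Q 1 -> Q 2 -> forall j, Q j.
Proof.
move=> h0 h1 h2 -[[|[|[|//]]] i3].
- by move: h0; congr (Q _); apply/val_inj.
- by move: h1; congr (Q _); apply/val_inj.
- by move: h2; congr (Q _); apply/val_inj.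
Qed.

Lemma row3P u v : u 0 0 = v 0 0 -> u 0 1 = v 0 1 -> u 0 2 = v 0 2 -> u = v.
Proof. by move=> h0 h1 h2; apply/rowP; exact: ord3P. Qed.

Lemma dotC u v : dot u v = dot v u. Proof. by rewrite !dotE; ring. Qed.
Lemma dotDl u v w : dot (u + v) w = dot u w + dot v w.
Proof. by rewrite !dotE !mxE; ring. Qed.
Lemma dotZl c u v : dot (c *: u) v = c * dot u v.
Proof. by rewrite !dotE !mxE; ring. Qed.
Lemma dotDr u v w : dot u (v + w) = dot u v + dot u w.
Proof. by rewrite !dotE !mxE; ring. Qed.
Lemma dotZr c u v : dot u (c *: v) = c * dot u v.
Proof. by rewrite !dotE !mxE; ring. Qed.
Lemma dotNl u v : dot (- u) v = - dot u v.
Proof. by rewrite !dotE !mxE; ring. Qed.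
Lemma dotNr u v : dot u (- v) = - dot u v.
Proof. by rewrite !dotE !mxE; ring. Qed.
Lemma dotBl u v w : dot (u - v) w = dot u w - dot v w.
Proof. by rewrite dotDl dotNl. Qed.
Lemma dotBr u v w : dot u (v - w) = dot u v - dot u w.
Proof. by rewrite dotDr dotNr. Qed.
Lemma dot0l u : dot 0 u = 0. Proof. by rewrite dotE !mxE; ring. Qed.
Lemma dot0r u : dot u 0 = 0. Proof. by rewrite dotC dot0l. Qed.

Lemma dot_suml (I : Type) (r : seq I) (Q : pred I) (F : I -> pt) v :
  dot (\sum_(i <- r | Q i) F i) v = \sum_(i <- r | Q i) dot (F i) v.
Proof. by elim/big_ind2: _ => [|? ? ? ? <- <-|//]; rewrite (dot0l, dotDl). Qed.

Lemma dot_sumr (I : Type) (r : seq I) (Q : pred I) (F : I -> pt) v :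
  dot v (\sum_(i <- r | Q i) F i) = \sum_(i <- r | Q i) dot v (F i).
Proof. by rewrite dotC dot_suml; apply: eq_bigr => i _; rewrite dotC. Qed.

Lemma dot_ge0 u : 0 <= dot u u.
Proof. by rewrite dotE; nra. Qed.

Lemma dot_eq0 u : dot u u = 0 -> u = 0.
Proof. by rewrite dotE => h; apply: row3P; rewrite mxE; nra. Qed.

Lemma enorm_ge0 m n (A : 'M[R]_(m, n)) : 0 <= enorm A.
Proof. exact: sqrtr_ge0. Qed.

Lemma sqr_enorm u : enorm u ^+ 2 = dot u u.
Proof.
rewrite sqr_sqrtr; last by apply: sumr_ge0 => i _; apply: sumr_ge0 => j _; exact: sqr_ge0.
by rewrite big_ord1 /dot; apply: eq_bigr => i _; rewrite expr2.
Qed.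

Lemma sqr_dot_le u v : dot u v ^+ 2 <= dot u u * dot v v.
Proof.
rewrite -subr_ge0 !dotE.
have -> : (u 0 0 * u 0 0 + u 0 1 * u 0 1 + u 0 2 * u 0 2) *
  (v 0 0 * v 0 0 + v 0 1 * v 0 1 + v 0 2 * v 0 2) -
  (u 0 0 * v 0 0 + u 0 1 * v 0 1 + u 0 2 * v 0 2) ^+ 2 =
  (u 0 0 * v 0 1 - u 0 1 * v 0 0) ^+ 2 + (u 0 0 * v 0 2 - u 0 2 * v 0 0) ^+ 2 +
  (u 0 1 * v 0 2 - u 0 2 * v 0 1) ^+ 2 by ring.
by rewrite !addr_ge0 ?sqr_ge0.
Qed.

Lemma dot_le_enorm u v : `|dot u v| <= enorm u * enorm v.
Proof.
rewrite -(@ler_pXn2r _ 2) ?nnegrE ?normr_ge0 ?mulr_ge0 ?enorm_ge0//.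
by rewrite exprMn !sqr_enorm real_normK ?num_real// sqr_dot_le.
Qed.

Lemma enormD u v : enorm (u + v) <= enorm u + enorm v.
Proof.
rewrite -(@ler_pXn2r _ 2) ?nnegrE ?addr_ge0 ?enorm_ge0//.
rewrite sqrrD !sqr_enorm dotDl !dotDr (dotC v u).
by have := le_trans (ler_norm _) (dot_le_enorm u v); lra.
Qed.

Lemma enormZ c u : enorm (c *: u) = `|c| * enorm u.
Proof.
apply: (@pexpIrn _ 2); rewrite ?nnegrE ?mulr_ge0 ?enorm_ge0//.
by rewrite exprMn !sqr_enorm real_normK ?num_real// dotZl dotZr; ring.
Qed.

Lemma enorm0 : enorm (0 : pt) = 0.
Proof. by rewrite -(scale0r 0) enormZ normr0 mul0r. Qed.
Lemma enormN u : enorm (- u) = enorm u.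
Proof. by rewrite -scaleN1r enormZ normrN normr1 mul1r. Qed.
Lemma enormB u v : enorm (u - v) <= enorm u + enorm v.
Proof. by rewrite -[enorm v]enormN enormD. Qed.
Lemma enorm_sum (I : Type) (r : seq I) (Q : pred I) (F : I -> pt) :
  enorm (\sum_(i <- r | Q i) F i) <= \sum_(i <- r | Q i) enorm (F i).
Proof.
elim/big_ind2: _ => [|x a y b xa yb|//]; first by rewrite enorm0.
by rewrite (le_trans (enormD _ _))// lerD.
Qed.

Lemma enorm_eq0 u : enorm u = 0 -> u = 0.
Proof. by move=> u0; apply: dot_eq0; rewrite -sqr_enorm u0 expr0n. Qed.

Lemma enorm_gt0 u : u != 0 -> 0 < enorm u.
Proof.
move=> u0; rewrite lt_neqAle enorm_ge0 andbT eq_sym.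
by apply: contra_neq u0; exact: enorm_eq0.
Qed.

Lemma coord_le_enorm u i : `|u 0 i| <= enorm u.
Proof.
rewrite -(@ler_pXn2r _ 2) ?nnegrE ?normr_ge0 ?enorm_ge0//.
rewrite sqr_enorm real_normK ?num_real// /dot (bigD1 i)//= expr2 lerDl.
by apply: sumr_ge0 => j _; rewrite -expr2 sqr_ge0.
Qed.

Lemma enorm_le_coord u e : (forall i, `|u 0 i| <= e) -> enorm u <= 2 * e.
Proof.
move=> ue; have e0 : 0 <= e by rewrite (le_trans _ (ue 0)).
rewrite -(@ler_pXn2r _ 2) ?nnegrE ?mulr_ge0 ?enorm_ge0//.
rewrite sqr_enorm dotE.
have sq i : u 0 i * u 0 i <= e ^+ 2.
  by rewrite -expr2 -real_normK ?num_real// ler_pXn2r ?nnegrE//.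
by have := (sq 0, sq 1, sq 2) => -[[]]; nra.
Qed.

Definition cross u v : pt := \row_(i < 3) nth 0 [::
  u 0 1 * v 0 2 - u 0 2 * v 0 1; u 0 2 * v 0 0 - u 0 0 * v 0 2;
  u 0 0 * v 0 1 - u 0 1 * v 0 0] i.

Lemma dot_cross u v w : dot w (cross u v) =
  w 0 0 * (u 0 1 * v 0 2 - u 0 2 * v 0 1) +
  w 0 1 * (u 0 2 * v 0 0 - u 0 0 * v 0 2) +
  w 0 2 * (u 0 0 * v 0 1 - u 0 1 * v 0 0).
Proof. by rewrite dotE !mxE. Qed.

Lemma cross_orthl u v : dot u (cross u v) = 0.
Proof. by rewrite dot_cross; ring. Qed.
Lemma cross_orthr u v : dot v (cross u v) = 0.
Proof. by rewrite dot_cross; ring. Qed.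

Lemma dot_cross_cross u v w z :
  dot (cross u v) (cross w z) = dot u w * dot v z - dot u z * dot v w.
Proof. by rewrite dot_cross !mxE /= !dotE; ring. Qed.

(** Coordinates of [w] in the basis made of [u], [v] and their cross product,
    cleared of denominators. *)
Lemma cross_decomposition u v w :
  dot (cross u v) (cross u v) *: w = dot w (cross u v) *: cross u v +
  (dot w u * dot v v - dot w v * dot u v) *: u +
  (dot w v * dot u u - dot w u * dot u v) *: v.
Proof.
rewrite dot_cross_cross dot_cross !dotE.
by apply: row3P; rewrite !mxE/=; ring.
Qed.

(** The three cross products of a triple form, up to the determinant, its
    dual basis. *)
Lemma det_decomposition p q e w :
  dot p (cross q e) *: w =
  dot w p *: cross q e + dot w q *: cross e p + dot w e *: cross p q.
Proof. by rewrite dot_cross !dotE; apply: row3P; rewrite !mxE/=; ring. Qed.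

End EuclideanSpace.

(** * Measurability of open sets, integrals of bounded functions *)

(** Product sigma-algebras are generated by rectangles; a countable basis, which
    is inherited by products, makes them contain the open sets. *)
Definition measurable_basis d (X : measurableType d) (N : X -> set (set X)) :=
  exists B : nat -> set X, (forall n, measurable (B n)) /\
    forall x A, N x A -> exists n, B n x /\ B n `<=` A.

Lemma basis_measurable d (X : measurableType d) (N : X -> set (set X)) A :
  measurable_basis N -> (forall x, A x -> N x A) -> measurable A.
Proof.
move=> [B [mB HB]] oA.
have -> : A = \bigcup_(n in [set n | B n `<=` A]) B n.
  apply/seteqP; split=> [x Ax|x [n /= sB Bx]]; last exact: sB.
  by have [n [Bx sB]] := HB x A (oA x Ax); exists n.
by apply: bigcup_measurable => n _; exact: mB.
Qed.

Lemma measurable_basis_prod d d' (X : measurableType d) (Y : measurableType d')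
    (N : X -> set (set X)) (N' : Y -> set (set Y)) :
  measurable_basis N -> measurable_basis N' ->
  measurable_basis (fun (p : X * Y) A => exists U V,
    [/\ N p.1 U, N' p.2 V & U `*` V `<=` A]).
Proof.
move=> [B [mB HB]] [B' [mB' HB']].
exists (fun n => if unpickle n is Some (i, j) then B i `*` B' j else set0); split.
  move=> n; case: unpickle => [[i j]|]; last exact: measurable0.
  exact: measurableX.
move=> [x y] A [U [V [/= NU NV UVA]]].
have [i [Bi iU]] := HB _ _ NU; have [j [Bj jV]] := HB' _ _ NV.
exists (pickle (i, j)); rewrite pickleK; split=> // -[x' y'] [/= xi yj].
by apply: UVA; split; [exact: iU|exact: jV].
Qed.

Section RealSpace.
Variable R : realType.
Local Notation R1 := (measurableTypeR R).

Lemma measurable_basisR : measurable_basis (fun (x : R1) A => nbhs (x : R) A).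
Proof.
exists (fun n => if @unpickle (rat * rat)%type n is Some (p, q)
  then [set x : R | ratr p < x < ratr q] else set0); split.
  move=> n; case: unpickle => [[p q]|]; last exact: measurable0.
  have -> : [set x : R | ratr p < x < ratr q] = `]ratr p, ratr q[%classic.
    by apply/seteqP; split=> x /=; rewrite in_itv.
  exact: measurable_itv.
move=> x A /nbhs_ballP[e /= e0 eA].
have /rat_in_itvoo[p] : x - e < x by lra.
have /rat_in_itvoo[q] : x < x + e by lra.
rewrite !in_itv/= => /andP[xq qe] /andP[ep px].
exists (pickle (p, q)); rewrite pickleK/=; split; first by rewrite px xq.
move=> y /andP[py yq]; apply: eA; rewrite /ball/= ltr_distl.
by apply/andP; split; lra.
Qed.

Lemma open_measurable2 (A : set (R * R)) :
  open A -> measurable (A : set (R1 * R1)).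
Proof.
move=> oA; apply: basis_measurable.
  exact: (measurable_basis_prod measurable_basisR measurable_basisR).
move=> [x y] Ax; have [[U V] /= [NU NV] UVA] : nbhs (x, y) A by exact: open_nbhs_nbhs.
by exists U, V.
Qed.

Lemma open_measurable3 (A : set (R * R * R)) :
  open A -> measurable (A : set (R1 * R1 * R1)).
Proof.
move=> oA; apply: basis_measurable.
  apply: measurable_basis_prod measurable_basisR.
  exact: (measurable_basis_prod measurable_basisR measurable_basisR).
move=> [[x y] z] Ax.
have [[W V] /= [[[U1 U2] /= [N1 N2] U12] NV] WVA] : nbhs (x, y, z) A by exact: open_nbhs_nbhs.
exists W, V; split=> //; exists U1, U2; split=> //.
Qed.

End RealSpace.

Section Rint.
Context d (T : measurableType d) (R : realType) (mu : {measure set T -> \bar R}).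
Implicit Types (D : set T) (f g : T -> R).

(** Integrability is needed for the linearity of the integral; all integrands
    below are bounded on domains of finite measure. *)
Definition bounded_measurable D f :=
  measurable_fun D f /\ exists M : R, forall x, D x -> `|f x| <= M.

Lemma bm_integrable D f : measurable D -> (mu D < +oo)%E ->
  bounded_measurable D f -> mu.-integrable D (EFin \o f).
Proof.
move=> mD fD [mf [M fM]]; apply: measurable_bounded_integrable => //.
exists M; split; first exact: num_real.
by move=> x Mx t Dt; apply: le_trans (fM t Dt) _; exact: ltW.
Qed.

Lemma bm_cst D c : measurable D -> bounded_measurable D (fun=> c).
Proof. by move=> mD; split; [exact: measurable_cst|exists `|c|]. Qed.

Lemma bmD D f g : bounded_measurable D f -> bounded_measurable D g ->
  bounded_measurable D (fun x => f x + g x).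
Proof.
move=> [mf [M fM]] [mg [N gN]]; split; first exact: measurable_funD.
by exists (M + N) => x Dx; rewrite (le_trans (ler_normD _ _))// lerD ?fM ?gN.
Qed.

Lemma bmM D f g : bounded_measurable D f -> bounded_measurable D g ->
  bounded_measurable D (fun x => f x * g x).
Proof.
move=> [mf [M fM]] [mg [N gN]]; split; first exact: measurable_funM.
by exists (M * N) => x Dx; rewrite normrM ler_pM ?fM ?gN.
Qed.

Lemma bmZ D c f : measurable D -> bounded_measurable D f ->
  bounded_measurable D (fun x => c * f x).
Proof. by move=> mD; apply: bmM; exact: bm_cst. Qed.

Lemma Rintegral_sum D (I : Type) (r : seq I) (c : I -> R) (f : I -> T -> R) :
  measurable D -> (mu D < +oo)%E -> (forall i, bounded_measurable D (f i)) ->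
  bounded_measurable D (fun x => \sum_(i <- r) c i * f i x) /\
  \int[mu]_(x in D) (\sum_(i <- r) c i * f i x) =
    \sum_(i <- r) c i * \int[mu]_(x in D) f i x.
Proof.
move=> mD fD bf; elim: r => [|i r [br IH]].
  under eq_Rintegral do rewrite big_nil.
  rewrite big_nil Rintegral_cst// mul0r; split=> //.
  have -> : (fun x => \sum_(i <- [::]) c i * f i x) = (fun=> 0).
    by apply/funext => x; rewrite big_nil.
  exact: bm_cst.
have bi : bounded_measurable D (fun x => c i * f i x) by exact: bmZ.
have e : (fun x => \sum_(j <- i :: r) c j * f j x) =
    (fun x => c i * f i x + \sum_(j <- r) c j * f j x).
  by apply/funext => x; rewrite big_cons.
rewrite e; split; first exact: bmD.
rewrite RintegralD ?big_cons ?IH//; [|exact: bm_integrable..].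
by rewrite RintegralZl//; exact: bm_integrable.
Qed.

Lemma Rintegral_bound D f M : measurable D -> (mu D < +oo)%E ->
  bounded_measurable D f -> (forall x, D x -> `|f x| <= M) ->
  `|\int[mu]_(x in D) f x| <= M * fine (mu D).
Proof.
move=> mD fD bf fM; rewrite (le_trans (le_normr_Rintegral _ (bm_integrable mD fD bf)))//.
rewrite -Rintegral_cst//; apply: le_Rintegral => //.
- by have := bm_integrable mD fD bf; move/integrable_norm.
- by apply: bm_integrable => //; exact: bm_cst.
Qed.

End Rint.

(** * The interface is flat at small scales *)

Section Topology.
Variable R : realType.
Local Notation pt := 'rV[R]_3.

Lemma ballP (p x : pt) r : ball p r x <-> 0 < r /\ forall i, `|x 0 i - p 0 i| < r.
Proof.
rewrite /ball/= /mx_ball; split => [[r0 h]|[r0 h]]; split=> // i.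
  by have := h 0 i; rewrite /ball/= distrC.
by move=> j; rewrite ord1 /ball/= distrC.
Qed.

Lemma ball_enorm (p x : pt) r : 0 < r -> enorm (x - p) < r -> ball p r x.
Proof.
move=> r0 xp; apply/ballP; split=> // i.
by have := coord_le_enorm (x - p) i; rewrite !mxE; lra.
Qed.

Lemma enorm_ball (p x : pt) r : ball p r x -> enorm (x - p) <= 2 * r.
Proof.
move=> /ballP[_ h]; apply: enorm_le_coord => i.
by rewrite !mxE ltW.
Qed.

Lemma line_continuous (x w : pt) : continuous (fun t : R => x + t *: w).
Proof.
move=> t; apply: cvgD; first exact: cvg_cst.
exact: scalel_continuous.
Qed.

(** The parameter interval of a segment is connected. *)
Lemma segment_separation (A B : set pt) (x y : pt) :
  open A -> open B ->
  (forall t, 0 <= t <= 1 -> ~ (A `&` B) (x + t *: (y - x))) ->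
  (forall t, 0 <= t <= 1 -> (A `|` B) (x + t *: (y - x))) -> A x -> A y.
Proof.
move=> oA oB AB0 cov Ax.
pose f t := x + t *: (y - x).
have fc : continuous f by exact: line_continuous.
have f01 t : `[0 : R, 1]%classic t -> (A `|` B) (f t).
  by move=> /=; rewrite in_itv/=; exact: cov.
have E : `[0 : R, 1]%classic `&` f @^-1` A = `[0 : R, 1]%classic.
  apply: (@segment_connected R 0 1).
  - exists 0; split; first by rewrite /= in_itv/= lexx ler01.
    by rewrite /f /= scale0r addr0.
  - exists (f @^-1` A) => //; first by apply: open_comp => // t _; exact: fc.
  - exists (f @^-1` (~` B)); first by apply: closed_comp; [move=> t _; exact: fc|exact: open_closedC].
    apply/seteqP; split=> t [t01 /=] h; split=> //.
      by move=> Bt; apply: (AB0 t) => //; move: t01; rewrite /= in_itv.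
    by case: (f01 _ t01).
have : (`[0 : R, 1]%classic `&` f @^-1` A) 1 by rewrite E /= in_itv/= lexx ler01.
by case=> _; rewrite /= /f scale1r addrC subrK.
Qed.

Lemma segment_in_one_side (A B : set pt) (x y : pt) :
  open A -> open B -> A `&` B = set0 ->
  (forall t, 0 <= t <= 1 -> (A `|` B) (x + t *: (y - x))) -> A x -> A y.
Proof.
move=> oA oB AB0; apply: segment_separation => // t _.
by rewrite AB0.
Qed.

Lemma segment_closed_separation (A B : set pt) (x y : pt) :
  closed A -> closed B ->
  (forall t, 0 <= t <= 1 -> ~ (A `&` B) (x + t *: (y - x))) ->
  (forall t, 0 <= t <= 1 -> (A `|` B) (x + t *: (y - x))) -> A x -> ~ B y.
Proof.
move=> cA cB AB0 cov Ax.
apply: (@segment_separation (~` B) (~` A) x).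
- exact: closed_openC.
- exact: closed_openC.
- by move=> t t01 [nB nA]; case: (cov t t01).
- move=> t t01; have := AB0 t t01.
  have [Bt nAB|nB _] := pselect (B (x + t *: (y - x))); last by left.
  by right=> At; apply: nAB.
- have := AB0 0; rewrite lexx ler01 scale0r addr0 => /(_ isT) nAB Bx.
  by apply: nAB.
Qed.

End Topology.

Section Linearization.
Variable R : realType.
Local Notation pt := 'rV[R]_3.

Lemma partial_is_derive (g : pt -> R) (z : pt) (i : 'I_3) (s : R) :
  derivable g (z + s *: delta_mx 0 i) (delta_mx 0 i) ->
  is_derive (s : R) (1 : R) (fun s => g (z + s *: delta_mx 0 i))
    (partial g i (z + s *: delta_mx 0 i)).
Proof.
move=> dg.
have E : (fun h : R => h^-1 *: (((fun s0 => g (z + s0 *: delta_mx 0 i)) \o shift s)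
    (h *: (1 : R)) - g (z + s *: delta_mx 0 i))) =
  (fun h : R => h^-1 *: ((g \o shift (z + s *: delta_mx 0 i)) (h *: delta_mx 0 i) -
    g (z + s *: delta_mx 0 i))).
  apply/funext => h /=; congr (_ *: (g _ - _)).
  by rewrite scalerDl [h *: 1]mulr1 addrCA addrA.
by split; rewrite /partial /derivable /derive E.
Qed.

Lemma axis_increment (g : pt -> R) (z p : pt) (i : 'I_3) (t e : R) :
  (forall s, `|s| <= `|t| -> 0 <= s * t ->
    derivable g (z + s *: delta_mx 0 i) (delta_mx 0 i) /\
    `|partial g i (z + s *: delta_mx 0 i) - partial g i p| <= e) ->
  `|g (z + t *: delta_mx 0 i) - g z - partial g i p * t| <= e * `|t|.
Proof.
move=> H.
pose f s := g (z + s *: delta_mx 0 i).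
have fz : g z = f 0 by rewrite /f scale0r addr0.
have D s : `|s| <= `|t| -> 0 <= s * t ->
    is_derive (s : R) (1 : R) f (partial g i (z + s *: delta_mx 0 i)).
  by move=> st st0; apply: partial_is_derive; have [] := H s st st0.
have fin c : `|c| <= `|t| -> 0 <= c * t ->
    f t - f 0 = partial g i (z + c *: delta_mx 0 i) * t ->
    `|g (z + t *: delta_mx 0 i) - g z - partial g i p * t| <= e * `|t|.
  move=> ct ct0; rewrite fz -/(f t) => ->; rewrite -mulrBl normrM ler_wpM2r//.
  by have [] := H c ct ct0.
have [t0|t0] := leP 0 t.
  have D' s : 0 <= s <= t -> is_derive (s : R) (1 : R) f (partial g i (z + s *: delta_mx 0 i)).
    by move=> /andP[s0 st]; apply: D; [rewrite !ger0_norm|rewrite mulr_ge0].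
  have [||c] := @MVT_segment R f (fun s => partial g i (z + s *: delta_mx 0 i)) 0 t t0.
  - by move=> s; rewrite in_itv/= => /andP[s0 st]; apply: D'; rewrite !ltW.
  - apply: derivable_within_continuous => s; rewrite in_itv/= => /D' ?; exact: ex_derive.
  rewrite in_itv/= subr0 => /andP[c0 ct] E; apply: (fin c) => //.
    by rewrite !ger0_norm.
  by rewrite mulr_ge0.
have D' s : t <= s <= 0 -> is_derive (s : R) (1 : R) f (partial g i (z + s *: delta_mx 0 i)).
  move=> /andP[s0 st]; apply: D; last by rewrite mulr_le0 // ltW.
  by rewrite (ler0_norm st) (ler0_norm (ltW t0)) lerN2.
have [||c] := @MVT_segment R f (fun s => partial g i (z + s *: delta_mx 0 i)) t 0 (ltW t0).
- by move=> s; rewrite in_itv/= => /andP[s0 st]; apply: D'; rewrite !ltW.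
- apply: derivable_within_continuous => s; rewrite in_itv/= => /D' ?; exact: ex_derive.
rewrite in_itv/= sub0r => /andP[c0 ct] E; apply: (fin c) => //.
- by rewrite (ler0_norm ct) (ler0_norm (ltW t0)) lerN2.
- by rewrite mulr_le0 // ltW.
- by rewrite -opprB E mulrN opprK.
Qed.

(** The increment is taken along the three axes in turn, so that only mean
    values in one variable are needed. *)
Lemma C1_linearization (U : set pt) (g : pt -> R) (p : pt) (e : R) :
  open U -> U p -> C1_on U g -> 0 < e ->
  exists r, [/\ 0 < r, ball p r `<=` U & forall x y, ball p r x -> ball p r y ->
    `|g x - g y - dot (grad g p) (x - y)| <= e * enorm (x - y)].
Proof.
move=> oU Up C1 e0.
have /nbhs_ballP[r1 /= r10 r1U] : nbhs p U by exact: open_nbhs_nbhs.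
have e3 : 0 < e / 3 by rewrite divr_gt0.
have : \forall x \near p, forall i : 'I_3, `|partial g i x - partial g i p| <= e / 3.
  apply: (@filter_forall _ _ (fun i x => `|partial g i x - partial g i p| <= e / 3)
    _ (nbhs_filter p)) => i.
  have [_ /cvgr_dist_le/(_ _ e3)] := C1 i p Up.
  by apply: filterS => x; rewrite distrC.
move=> /nbhs_ballP[r2 /= r20 r2P].
exists (Num.min r1 r2); split.
- by rewrite lt_min r10.
- by move=> x /(@le_ball _ _ _ _ r1) h; apply/r1U/h; rewrite ge_min lexx.
move=> x y /ballP[r0 xr] /ballP[_ yr].
have box (z : pt) : (forall i, `|z 0 i - p 0 i| < Num.min r1 r2) ->
    U z /\ forall i, `|partial g i z - partial g i p| <= e / 3.
  move=> zr; have bz : ball p (Num.min r1 r2) z by exact/ballP.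
  split; first by apply: r1U; apply: le_ball bz; rewrite ge_min lexx.
  by apply: r2P; apply: le_ball bz; rewrite ge_min lexx orbT.
(* Every point whose coordinates lie between those of x and y is in the box. *)
have step i (z : pt) : (forall j, z 0 j = x 0 j \/ z 0 j = y 0 j) -> z 0 i = y 0 i ->
    `|g (z + (x 0 i - y 0 i) *: delta_mx 0 i) - g z - partial g i p * (x 0 i - y 0 i)|
      <= e / 3 * `|x 0 i - y 0 i|.
  move=> zxy ziy; apply: axis_increment => s s1 s2.
  have zr j : `|(z + s *: delta_mx 0 i) 0 j - p 0 j| < Num.min r1 r2.
    rewrite !mxE eqxx/=; have [->|ji] := eqVneq j i; last first.
      by rewrite mulr0 addr0; case: (zxy j) => ->.
    rewrite mulr1 ziy; move: (xr i) (yr i) s1 s2; set m := Num.min _ _.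
    rewrite !ltr_norml => /andP[h1 h2] /andP[h3 h4]; rewrite ler_norml => /andP[h5 h6].
    move: h5 h6; case: (ger0P (x 0 i - y 0 i)) => h7 h5 h6 h8; apply/andP; split; nra.
  by have [Uz Hz] := box _ zr; split=> //; have [] := C1 i _ Uz.
have cE (z : pt) (t : R) (i j : 'I_3) :
    (z + t *: delta_mx 0 i) 0 j = z 0 j + t * (j == i)%:R by rewrite !mxE.
pose z1 := y + (x 0 0 - y 0 0) *: delta_mx 0 0 : pt.
have s1 : `|g z1 - g y - partial g 0 p * (x 0 0 - y 0 0)| <= e / 3 * `|x 0 0 - y 0 0|.
  exact: step 0 y (fun j => or_intror erefl) erefl.
have z1E : [/\ z1 0 0 = x 0 0, z1 0 1 = y 0 1 & z1 0 2 = y 0 2].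
  by rewrite /z1 !cE/= !mulr0 mulr1; split; ring.
clearbody z1; pose z2 := z1 + (x 0 1 - y 0 1) *: delta_mx 0 1 : pt.
have z2E : [/\ z2 0 0 = x 0 0, z2 0 1 = x 0 1 & z2 0 2 = y 0 2].
  by have [a b c] := z1E; rewrite /z2 3!cE/= a b c !mulr0 mulr1; split; ring.
have z3E : z2 + (x 0 2 - y 0 2) *: delta_mx 0 2 = x.
  by have [a b c] := z2E; apply: row3P; rewrite cE/= ?a ?b ?c ?mulr0 ?mulr1; ring.
have s2 : `|g z2 - g z1 - partial g 1 p * (x 0 1 - y 0 1)| <= e / 3 * `|x 0 1 - y 0 1|.
  by have [a b c] := z1E; apply: step => //; apply: ord3P; auto.
have s3 : `|g x - g z2 - partial g 2 p * (x 0 2 - y 0 2)| <= e / 3 * `|x 0 2 - y 0 2|.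
  by rewrite -[in g x]z3E; have [a b c] := z2E; apply: step => //; apply: ord3P; auto.
have n0 i : `|x 0 i - y 0 i| <= enorm (x - y).
  by have := coord_le_enorm (x - y) i; rewrite !mxE.
have -> : g x - g y - dot (grad g p) (x - y) =
   (g z1 - g y - partial g 0 p * (x 0 0 - y 0 0)) +
   (g z2 - g z1 - partial g 1 p * (x 0 1 - y 0 1)) +
   (g x - g z2 - partial g 2 p * (x 0 2 - y 0 2)).
  by rewrite dotE !mxE; ring.
apply: (le_trans (ler_normD _ _)); apply: (le_trans (lerD (ler_normD _ _) (lexx _))).
have := (n0 0, n0 1, n0 2) => -[[m0 m1] m2].
have := (ler_wpM2l (ltW e3) m0, ler_wpM2l (ltW e3) m1, ler_wpM2l (ltW e3) m2).
by move=> -[[]]; lra.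
Qed.

End Linearization.

Section Flatness.
Variable R : realType.
Local Notation pt := 'rV[R]_3.

(** The part of a small ball where a nearly affine function is positive is
    connected: each of its points can be moved far up along the normal, and
    all the points so obtained are joined by segments. *)
Lemma positive_part_in_one_side (f : pt -> R) (n p : pt) (rho : R)
    (A B : set pt) (x x' : pt) :
  0 < rho -> dot n n = 1 -> f p = 0 ->
  (forall x y, ball p (8 * rho) x -> ball p (8 * rho) y ->
    `|f x - f y - dot n (x - y)| <= 4^-1 * enorm (x - y)) ->
  (forall x, ball p (8 * rho) x -> 0 < f x -> (A `|` B) x) ->
  open A -> open B -> A `&` B = set0 ->
  ball p rho x -> ball p rho x' -> 0 < f x -> 0 < f x' -> A x -> A x'.
Proof.
move=> r0 n1 fp flin cov oA oB AB0 px px' fx fx' Ax; have r0' := ltW r0.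
have en : enorm n = 1.
  by apply: (@pexpIrn _ 2); rewrite ?nnegrE ?enorm_ge0 ?sqr_enorm ?n1 ?expr1n.
have bp : ball p (8 * rho) p by apply: ballxx; rewrite mulr_gt0.
have nc i : `|n 0 i| <= 1 by rewrite -en coord_le_enorm.
have inb (z : pt) t : ball p rho z -> 0 <= t <= 1 -> ball p (8 * rho) (z + t *: ((4 * rho) *: n)).
  move=> /ballP[_ zp] /andP[t0 t1]; apply/ballP; split; first by rewrite mulr_gt0.
  move=> i; rewrite !mxE; move: (zp i) (nc i).
  rewrite !ltr_norml ler_norml => /andP[h1 h2] /andP[h3 h4].
  have : t * rho <= rho by nra.
  have tr : 0 <= t * rho by exact: mulr_ge0.
  by move=> h5; apply/andP; split; nra.
have up z t : ball p rho z -> 0 < f z -> 0 <= t <= 1 ->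
    0 < f (z + t *: ((4 * rho) *: n)).
  move=> zp fz t01; have := flin _ z (inb z t zp t01).
  have zp0 : ball p (8 * rho) z by apply: le_ball zp; lra.
  have zz (w : pt) : z + w - z = w by rewrite [z + w]addrC addrK.
  move=> /(_ zp0); rewrite zz !enormZ !dotZr n1 en !mulr1.
  case/andP: t01 => t0 _; rewrite (ger0_norm t0) (@ger0_norm _ (4 * rho)) ?mulr_ge0//.
  by rewrite ler_norml => /andP[+ _]; have : 0 <= t * rho; [exact: mulr_ge0|lra].
have top z t : ball p rho z -> 0 <= t <= 1 ->
    0 < f ((p + (4 * rho) *: n) + t *: (z - p)) /\
    ball p (8 * rho) ((p + (4 * rho) *: n) + t *: (z - p)).
  move=> zp /andP[t0 t1]; have ez := enorm_ball zp.
  set w := (p + _ + _); have wE : w - p = (4 * rho) *: n + t *: (z - p).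
    by apply: row3P; rewrite !mxE; ring.
  have ew : enorm (w - p) <= 6 * rho.
    rewrite wE (le_trans (enormD _ _))// !enormZ en mulr1 (ger0_norm t0) (@ger0_norm _ (4 * rho)) ?mulr_ge0//.
    by have : t * enorm (z - p) <= enorm (z - p); [rewrite ler_piMl// enorm_ge0|lra].
  have wp : ball p (8 * rho) w by apply: ball_enorm; lra.
  split=> //; have := flin _ _ wp bp; rewrite fp subr0.
  rewrite [in dot _ _]wE dotDr !dotZr n1.
  have : `|t * dot n (z - p)| <= 2 * rho.
    rewrite normrM ger0_norm//; have := dot_le_enorm n (z - p); rewrite en mul1r.
    by have := normr_ge0 (dot n (z - p)); nra.
  by rewrite !ler_norml => /andP[h1 h2] /andP[h3 h4]; lra.
have toptop z : z + (4 * rho) *: n = p + (4 * rho) *: n + 1 *: (z - p).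
  by rewrite scale1r addrAC [p + _]addrC subrK.
have A1 : A (x + (4 * rho) *: n).
  apply: (segment_in_one_side oA oB AB0 _ Ax) => t t01.
  have -> : x + (4 * rho) *: n - x = (4 * rho) *: n by rewrite [x + _]addrC addrK.
  by apply: cov; [exact: inb|exact: up].
have A2 : A (p + (4 * rho) *: n).
  apply: (segment_in_one_side oA oB AB0 _ A1) => t /andP[t0 t1].
  have [] := top x (1 - t) px; first by apply/andP; split; lra.
  have -> : p + (4 * rho) *: n + (1 - t) *: (x - p) =
      x + (4 * rho) *: n + t *: (p + (4 * rho) *: n - (x + (4 * rho) *: n)).
    by apply: row3P; rewrite !mxE; ring.
  by move=> h1 h2; exact: cov.
have A3 : A (x' + (4 * rho) *: n).
  apply: (segment_in_one_side oA oB AB0 _ A2) => t t01.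
  have [] := top x' t px' t01.
  have -> : p + (4 * rho) *: n + t *: (x' - p) =
      p + (4 * rho) *: n + t *: (x' + (4 * rho) *: n - (p + (4 * rho) *: n)).
    by apply: row3P; rewrite !mxE; ring.
  by move=> h1 h2; exact: cov.
apply: (segment_in_one_side oA oB AB0 _ A3) => t /andP[t0 t1].
have t01 : 0 <= 1 - t <= 1 by apply/andP; split; lra.
have -> : x' + (4 * rho) *: n + t *: (x' - (x' + (4 * rho) *: n)) =
    x' + (1 - t) *: ((4 * rho) *: n).
  by apply: row3P; rewrite !mxE; ring.
by apply: cov; [exact: inb|exact: up].
Qed.

Definition side (P : interface R) (s : bool) : set pt :=
  if s then Omega_p P else Omega_m P.

Definition sign_of (s : bool) : R := if s then 1 else -1.

Section Sides.
Variable P : interface R.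
Hypothesis HP : interface_problem P.

Lemma side_open s : open (side P s).
Proof. by case: HP => -[_ _ [oM _ _] [oP _ _]] _ _ _; case: s. Qed.

Lemma Omega_open : open (Omega P).
Proof. by case: HP => -[[]]. Qed.

Lemma side_disjoint s x : side P s x -> side P (~~ s) x -> False.
Proof.
case: HP => _ [_ _ _ E] _ _; move: E; rewrite -subset0 => E.
by case: s => /= h1 h2; exact: (E x).
Qed.

Lemma side_cover x : Omega P x -> ~ Gamma P x -> exists s, side P s x.
Proof.
case: HP => _ [_ _ E _] _ _ Ox nG.
have : (Omega P `\` Gamma P) x by split.
by rewrite E => -[?|?]; [exists false|exists true].
Qed.

Lemma side_Omega s x : side P s x -> Omega P x /\ ~ Gamma P x.
Proof.
case: HP => _ [_ _ E _] _ _ sx.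
have : (Omega P `\` Gamma P) x by rewrite E; case: s sx => ?; [right|left].
by case.
Qed.

Lemma Gamma_sub_Omega : Gamma P `<=` Omega P.
Proof. by case: HP => _ []. Qed.

Lemma Gamma_closure s : Gamma P `<=` closure (side P s).
Proof. by case: HP => _ _ h _ x /h[h1 h2]; case: s. Qed.

(** [n] is a normal at scale [r]: pairs of interface points are almost
    orthogonal to it, and the two subdomains lie on its two sides. *)
Definition flat_at (e r : R) (q : pt) :=
  ball q r `<=` Omega P /\ exists n, dot n n = 1 /\ forall x y,
    ball q r x -> ball q r y -> Gamma P y ->
    (Gamma P x -> `|dot n (x - y)| <= e * enorm (x - y)) /\
    (forall s, side P s x -> - (e * enorm (x - y)) <= sign_of s * dot n (x - y)).

(** The point [a] decides which side the positive part of [f] belongs to; the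
    negative part is then the other side, which also accumulates at [p]. *)
Lemma flat_oriented (f : pt -> R) (n p a : pt) (rho e : R) :
  0 < rho -> dot n n = 1 -> f p = 0 -> Gamma P p -> e <= 4^-1 ->
  (forall x y, ball p (8 * rho) x -> ball p (8 * rho) y ->
    `|f x - f y - dot n (x - y)| <= e * enorm (x - y)) ->
  ball p (8 * rho) `<=` Omega P ->
  (forall x, ball p (8 * rho) x -> Gamma P x <-> f x = 0) ->
  ball p rho a -> side P true a -> 0 < f a ->
  forall x y, ball p rho x -> ball p rho y -> Gamma P y ->
    (Gamma P x -> `|dot n (x - y)| <= e * enorm (x - y)) /\
    (forall s, side P s x -> - (e * enorm (x - y)) <= sign_of s * dot n (x - y)).
Proof.
move=> r0 n1 fp Gp e4 flin bO Gf pa sa fa.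
have big z : ball p rho z -> ball p (8 * rho) z by apply: le_ball; lra.
have flin4 x y : ball p (8 * rho) x -> ball p (8 * rho) y ->
    `|f x - f y - dot n (x - y)| <= 4^-1 * enorm (x - y).
  move=> hx hy; apply: (le_trans (flin x y hx hy)).
  by rewrite ler_wpM2r// enorm_ge0.
have cov s x : ball p (8 * rho) x -> f x != 0 -> (side P s `|` side P (~~ s)) x.
  move=> px fx; have [|s' h] := @side_cover x (bO x px).
    by move=> /(Gf x px) f0; rewrite f0 eqxx in fx.
  by case: s s' h => -[] h; [left|right|right|left].
have dis s : side P s `&` side P (~~ s) = set0.
  by rewrite -subset0 => x []; exact: side_disjoint.
have fpos x : ball p rho x -> 0 < f x -> side P true x.
  move=> px fx; apply: (@positive_part_in_one_side f n p rho _ (side P false) a) => //.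
  - by move=> z pz fz; apply: (cov true) => //; rewrite gt_eqF.
  - exact: side_open.
  - exact: side_open.
have [b [sb pb]] : (side P false `&` ball p rho) !=set0.
  by apply: (Gamma_closure false Gp); apply: nbhsx_ballx.
have fneq s z : ball p rho z -> side P s z -> f z != 0.
  move=> pz sz; apply/eqP => fz; have [_ nG] := side_Omega sz.
  by apply: nG; apply/(Gf z) => //; exact: big.
have fb : f b < 0.
  rewrite lt_neqAle (fneq false)//= leNgt; apply/negP => fb.
  exact: (@side_disjoint true b (fpos b pb fb) sb).
have fneg x : ball p rho x -> f x < 0 -> side P false x.
  move=> px fx.
  apply: (@positive_part_in_one_side (fun x => - f x) (- n) p rho _ (side P true) b) => //;
    rewrite ?oppr_gt0//.
  - by rewrite dotNl dotNr opprK.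
  - by rewrite fp oppr0.
  - move=> z y pz py; rewrite -opprD dotNl -opprD normrN; exact: flin4.
  - by move=> z pz; rewrite oppr_gt0 => fz; apply: (cov false) => //; rewrite lt_eqF.
  - exact: side_open.
  - exact: side_open.
move=> x y px py Gy; have fy : f y = 0 by apply/(Gf y) => //; exact: big.
have := flin x y (big x px) (big y py); rewrite fy subr0 => fl.
split.
  move=> Gx; have fx : f x = 0 by apply/(Gf x) => //; exact: big.
  by rewrite fx sub0r normrN in fl.
move=> s sx; have fx : 0 <= sign_of s * f x.
  have := fneq s x px sx; case: s sx => sx fx /=; rewrite ?mul1r ?mulN1r ?oppr_ge0 leNgt;
    apply/negP => h.
  - exact: (@side_disjoint true x sx (fneg x px h)).
  - exact: (@side_disjoint false x sx (fpos x px h)).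
move: fl fx; rewrite ler_norml => /andP[h1 h2].
by case: (s); rewrite /= ?mul1r ?mulN1r; lra.
Qed.

Lemma flat_local e p : 0 < e -> Gamma P p -> exists r, 0 < r /\
  ball p r `<=` Omega P /\ exists n, dot n n = 1 /\ forall x y,
    ball p r x -> ball p r y -> Gamma P y ->
    (Gamma P x -> `|dot n (x - y)| <= e * enorm (x - y)) /\
    (forall s, side P s x -> - (e * enorm (x - y)) <= sign_of s * dot n (x - y)).
Proof.
move=> e0 Gp; have [_ [[_ /(_ p Gp)[U [g [oU Up [C1 _] g0 GU]]]] _ _ _] _ _] := HP.
pose L := enorm (grad g p); have L0 : 0 < L by apply/enorm_gt0/g0.
pose e1 := Num.min e 4^-1.
have e10 : 0 < e1 by rewrite lt_min e0 invr_gt0 ltr0n.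
have e1e : e1 <= e by rewrite ge_min lexx.
have e14 : e1 <= 4^-1 by rewrite ge_min lexx orbT.
have [r1 [r10 r1U glin]] := C1_linearization oU Up C1 (mulr_gt0 e10 L0).
have /nbhs_ballP[r2 /= r20 r2O] : nbhs p (Omega P).
  by apply: open_nbhs_nbhs; split; [exact: Omega_open|exact: Gamma_sub_Omega].
pose rho := Num.min r1 r2 / 8.
have rho0 : 0 < rho by rewrite divr_gt0// lt_min r10.
have r8 : 8 * rho = Num.min r1 r2 by rewrite /rho mulrC divfK.
have b1 x : ball p (8 * rho) x -> ball p r1 x.
  by apply: le_ball; rewrite r8 ge_min lexx.
have b2 x : ball p (8 * rho) x -> ball p r2 x.
  by apply: le_ball; rewrite r8 ge_min lexx orbT.
pose f x := g x / L; pose n : pt := L^-1 *: grad g p.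
have n1 : dot n n = 1.
  by rewrite dotZl dotZr -sqr_enorm -/L; field; rewrite gt_eqF.
have gE x : U x -> Gamma P x <-> g x = 0.
  move=> Ux; split=> [Gx|gx].
    by have [] : [set x | U x /\ g x = 0] x by rewrite -GU; split.
  by have [] : (Gamma P `&` U) x by rewrite GU; split.
have fp : f p = 0 by rewrite /f (gE p Up).1// mul0r.
have flin x y : ball p (8 * rho) x -> ball p (8 * rho) y ->
    `|f x - f y - dot n (x - y)| <= e1 * enorm (x - y).
  move=> px py; rewrite -(ler_pM2r L0) mulrAC -[X in _ * X <= _](gtr0_norm L0) -normrM.
  rewrite (_ : _ * L = g x - g y - dot (grad g p) (x - y)); first exact: glin (b1 _ px) (b1 _ py).
  by rewrite /f /n dotZl; field; rewrite gt_eqF.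
have Gf x : ball p (8 * rho) x -> Gamma P x <-> f x = 0.
  move=> px; rewrite (gE x (r1U _ (b1 x px))) /f; split=> [->|/eqP]; first by rewrite mul0r.
  by rewrite mulf_eq0 invr_eq0 (gt_eqF L0) orbF => /eqP.
have bO : ball p (8 * rho) `<=` Omega P by move=> x /b2 /r2O.
have [a [sa pa]] : (side P true `&` ball p rho) !=set0.
  by apply: (Gamma_closure true Gp); apply: nbhsx_ballx.
have pa8 : ball p (8 * rho) a by apply: le_ball pa; lra.
exists rho; split=> //; split.
  by move=> x px; apply: bO; apply: le_ball px; lra.
suff [m [m1 Hm]] : exists m, dot m m = 1 /\ forall x y,
    ball p rho x -> ball p rho y -> Gamma P y ->
    (Gamma P x -> `|dot m (x - y)| <= e1 * enorm (x - y)) /\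
    (forall s, side P s x -> - (e1 * enorm (x - y)) <= sign_of s * dot m (x - y)).
  exists m; split=> // x y px py Gy; have [h1 h2] := Hm x y px py Gy.
  have he : e1 * enorm (x - y) <= e * enorm (x - y) by rewrite ler_wpM2r// enorm_ge0.
  split=> [Gx|s sx]; first by apply: (le_trans (h1 Gx)).
  by have := h2 s sx; lra.
have [fa|fa|fa] := ltrgtP (f a) 0.
- exists (- n); split; first by rewrite dotNl dotNr opprK.
  apply: (@flat_oriented (fun x => - f x) (- n) p a rho e1) => //.
  + by rewrite dotNl dotNr opprK.
  + by rewrite /= fp oppr0.
  + by move=> x y px py; rewrite -opprD dotNl -opprD normrN; exact: flin.
  + move=> x px; rewrite (Gf x px); split=> [->|/eqP]; first by rewrite oppr0.
    by rewrite oppr_eq0 => /eqP.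
  + by rewrite oppr_gt0.
- exists n; split=> //.
  exact: (@flat_oriented f n p a rho e1).
- by have [_ []] := side_Omega sa; apply/(Gf a).
Qed.

(** Compactness of the interface makes the scale of flatness uniform. *)
Lemma flat_uniform e : 0 < e ->
  exists r0, 0 < r0 /\ forall r q, 0 < r -> r < r0 -> Gamma P q -> flat_at e r q.
Proof.
move=> e0; have [_ [[cG _] _ _ _] _ _] := HP.
have /compact_near_coveringP/(_ _ (0 : R)^'+ (fun r q => flat_at e r q)) := cG.
case.
  move=> p Gp; have [r [r0 [rO [n [n1 Hn]]]]] := flat_local e0 Gp.
  exists (ball p (r / 2), [set t | 0 < t < r / 2]) => /=.
    split; first by apply: nbhsx_ballx; rewrite divr_gt0.
    near=> t; rewrite /=; apply/andP; split; first by near: t; exact: nbhs_right_gt.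
    by near: t; apply: nbhs_right_lt; rewrite divr_gt0.
  move=> [q t] /= [pq /andP[t0 tr]].
  have qp z : ball q t z -> ball p r z.
    move=> qz; have -> : r = r / 2 + r / 2 by rewrite -splitr.
    by apply: (ball_triangle pq); apply: le_ball qz; exact: ltW.
  split; first by move=> z /qp /rO.
  by exists n; split=> // x y /qp px /qp py; exact: Hn.
move=> r0 /= r00 H; exists r0; split=> // r q r0' rr Gq.
apply: (H r) => //=; rewrite sub0r normrN gtr0_norm//.
Unshelve. all: by end_near.
Qed.

End Sides.
End Flatness.

(** * Angles and the plane through three interface points *)

Section Angles.
Variable R : realType.
Local Notation pt := 'rV[R]_3.
Implicit Types u v w n z : pt.

Lemma cosine_itv u v : -1 <= dot u v / (enorm u * enorm v) <= 1.
Proof.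
rewrite -ler_norml normrM normfV (ger0_norm (mulr_ge0 (enorm_ge0 _) (enorm_ge0 _))).
have [->|uv0] := eqVneq (enorm u * enorm v) 0; first by rewrite invr0 mulr0.
rewrite ler_pdivrMr ?mul1r ?dot_le_enorm// lt_neqAle eq_sym uv0/=.
by rewrite mulr_ge0 ?enorm_ge0.
Qed.

Lemma angle_ge0 u v : 0 <= angle u v.
Proof. by apply: acos_ge0; exact: cosine_itv. Qed.

Lemma angle_le_dot theta u v : theta <= pi -> angle u v <= theta ->
  cos theta * (enorm u * enorm v) <= dot u v.
Proof.
move=> tpi uvt; have a0 := angle_ge0 u v.
have ca : cos (angle u v) = dot u v / (enorm u * enorm v).
  by rewrite /angle acosK// in_itv/= cosine_itv.
have ct : cos theta <= dot u v / (enorm u * enorm v).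
  rewrite -ca leNgt ltr_cos ?in_itv/= -?leNgt ?a0 ?(le_trans uvt tpi)//.
  by rewrite (le_trans a0 uvt).
have [uv0|uv0] := eqVneq (enorm u * enorm v) 0.
  rewrite uv0 mulr0; have := dot_le_enorm u v.
  by rewrite uv0 normr_le0 => /eqP ->.
rewrite -ler_pdivlMr// lt_neqAle eq_sym uv0/=.
by rewrite mulr_ge0 ?enorm_ge0.
Qed.

Lemma unit_enorm n : dot n n = 1 -> enorm n = 1.
Proof. by move=> n1; apply: (@pexpIrn _ 2); rewrite ?nnegrE ?enorm_ge0 ?sqr_enorm ?n1 ?expr1n. Qed.

(** The angle facing the longest side of a triangle has cosine at most 1/2, so
    its sine is bounded from below as soon as the angle stays away from [pi];
    [u], [v] are the sides at that vertex. *)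
Lemma gram_lower_bound (c0 : R) u v : -1 < c0 <= 0 ->
  c0 * (enorm u * enorm v) <= dot u v ->
  dot u u <= dot (u - v) (u - v) -> dot v v <= dot (u - v) (u - v) ->
  (1 - Num.max (c0 ^+ 2) 4^-1) * (dot u u * dot v v) <=
    dot u u * dot v v - dot u v ^+ 2.
Proof.
move=> /andP[c1 c2] cuv; rewrite !dotBl !dotBr (dotC v u) -!sqr_enorm.
move: cuv (enorm_ge0 u) (enorm_ge0 v); move: (dot u v) (enorm u) (enorm v) => m.
suff H : forall a b : R, 0 <= a -> 0 <= b -> a <= b -> c0 * (a * b) <= m -> b ^+ 2 <= a ^+ 2 - m - (m - b ^+ 2) ->
    m ^+ 2 <= Num.max (c0 ^+ 2) 4^-1 * (a ^+ 2 * b ^+ 2).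
  move=> a b cm a0 b0 h1 h2.
  suff : m ^+ 2 <= Num.max (c0 ^+ 2) 4^-1 * (a ^+ 2 * b ^+ 2) by lra.
  have [ab|ba] := leP a b; first by apply: H => //; lra.
  by rewrite [a ^+ 2 * _]mulrC; apply: H => //; [exact: ltW|rewrite [b * a]mulrC|lra].
move=> a b a0 b0 ab cm h.
have ab0 : 0 <= a * b by exact: mulr_ge0.
have m2 : 2 * m <= a * b by nra.
have [m0|m0] := leP 0 m.
  apply: (@le_trans _ _ (4^-1 * (a ^+ 2 * b ^+ 2))); first nra.
  by rewrite ler_wpM2r ?mulr_ge0 ?sqr_ge0// le_max lexx orbT.
apply: (@le_trans _ _ (c0 ^+ 2 * (a ^+ 2 * b ^+ 2))); first nra.
by rewrite ler_wpM2r ?mulr_ge0 ?sqr_ge0// le_max lexx.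
Qed.

(** By Cramer's rule in the form of [cross_decomposition], whose denominator is the
    Gram determinant of [u] and [v]: a vector nearly orthogonal to two directions
    is close to its component along their common unit normal, as long as that
    determinant does not degenerate. *)
Lemma normal_stability (k e : R) u v n m z : 0 < k -> 0 <= e ->
  0 < dot u u -> 0 < dot v v ->
  k * (dot u u * dot v v) <= dot u u * dot v v - dot u v ^+ 2 ->
  `|dot n u| <= e * enorm u -> `|dot n v| <= e * enorm v ->
  dot m m = 1 -> dot m u = 0 -> dot m v = 0 ->
  `|dot n z - dot n m * dot m z| <= 4 / k * e * enorm z.
Proof.
move=> k0 e0 u0 v0 kN nu nv m1 mu mv.
pose X := cross u v; pose N := dot X X.
have NE : N = dot u u * dot v v - dot u v ^+ 2.
  by rewrite /N dot_cross_cross (dotC v u).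
have N0 : 0 < N by rewrite NE; apply: lt_le_trans kN; rewrite !mulr_gt0.
have mE : N *: m = dot m X *: X.
  by rewrite /N cross_decomposition mu mv !mul0r !subr0 !scale0r !addr0.
have NX : N = dot m X ^+ 2.
  by have := congr1 (dot m) mE; rewrite !dotZr m1 mulr1.
have nE := congr1 (fun w => dot w z) (cross_decomposition u v n).
rewrite /= !dotDl !dotZl -/X -/N in nE.
have nm : N * dot n m = dot m X * dot n X.
  by have := congr1 (dot n) mE; rewrite !dotZr.
have mz : N * dot m z = dot m X * dot X z.
  by have := congr1 (fun w => dot w z) mE; rewrite /= !dotZl.
have E : N * (dot n m * dot m z) = dot n X * dot X z.
  apply: (mulfI (lt0r_neq0 N0)).
  have -> : N * (N * (dot n m * dot m z)) = (N * dot n m) * (N * dot m z) by ring.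
  by rewrite nm mz {1}NX; ring.
have D : N * (dot n z - dot n m * dot m z) =
    (dot n u * dot v v - dot n v * dot u v) * dot u z +
    (dot n v * dot u u - dot n u * dot u v) * dot v z.
  by rewrite mulrBr nE E; ring.
rewrite -(ler_pM2l N0) -[X in X * `|_|](gtr0_norm N0) -normrM D.
have [a0 b0] := (enorm_ge0 u, enorm_ge0 v).
have [uz vz] := (dot_le_enorm u z, dot_le_enorm v z).
have uv := dot_le_enorm u v; have z0 := enorm_ge0 z.
have term (p q p' q' : R) (w : pt) : `|p| <= e * q -> `|p'| <= e * q' ->
    0 <= q -> 0 <= q' -> `|dot w z| <= q * enorm z -> `|dot u v| <= q * q' ->
    `|(p * q' ^+ 2 - p' * dot u v) * dot w z| <= 2 * e * (q ^+ 2 * q' ^+ 2) * enorm z.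
  move=> hp hp' q0 q0' hw huv; rewrite normrM.
  have h : `|p * q' ^+ 2 - p' * dot u v| <= 2 * e * (q * q' ^+ 2).
    rewrite (le_trans (ler_normB _ _))// (normrM p) (normrM p') (ger0_norm (sqr_ge0 q')).
    have := ler_pM (normr_ge0 _) (normr_ge0 _) hp' huv.
    by have := ler_wpM2r (sqr_ge0 q') hp; nra.
  have -> : 2 * e * (q ^+ 2 * q' ^+ 2) * enorm z =
      2 * e * (q * q' ^+ 2) * (q * enorm z) by ring.
  exact: ler_pM.
apply: (le_trans (ler_normD _ _)).
have t1 := term _ _ _ _ u nu nv a0 b0 uz uv.
have t2 := term _ _ _ _ v nv nu b0 a0 vz; rewrite [enorm v * _]mulrC in t2.
move: (t2 uv) t1; rewrite !sqr_enorm => {}t2 t1.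
apply: (le_trans (lerD t1 t2)).
have kN' : k * (dot u u * dot v v) <= N by rewrite NE.
have ez : 0 <= e * enorm z by exact: mulr_ge0.
have -> : N * (4 / k * e * enorm z) = 4 * (N / k) * (e * enorm z) by ring.
have : dot u u * dot v v <= N / k by rewrite ler_pdivlMr// mulrC.
by nra.
Qed.

Lemma unit_normal_exists u v : 0 < dot u u * dot v v - dot u v ^+ 2 ->
  exists m, [/\ dot m m = 1, dot m u = 0 & dot m v = 0].
Proof.
move=> N0; pose X := cross u v.
have NE : dot X X = dot u u * dot v v - dot u v ^+ 2.
  by rewrite dot_cross_cross (dotC v u).
have X0 : enorm X != 0.
  by apply/eqP => h; move: N0; rewrite -NE -sqr_enorm h expr0n ltxx.
exists ((enorm X)^-1 *: X); split.
- by rewrite dotZl dotZr -sqr_enorm; field.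
- by rewrite dotZl dotC cross_orthl mulr0.
- by rewrite dotZl dotC cross_orthr mulr0.
Qed.

Lemma orthogonal_multiple u v m w : 0 < dot u u * dot v v - dot u v ^+ 2 ->
  dot m m = 1 -> dot m u = 0 -> dot m v = 0 -> dot w u = 0 -> dot w v = 0 ->
  w = dot w m *: m.
Proof.
move=> N0 m1 mu mv wu wv; pose X := cross u v.
have NE : dot X X = dot u u * dot v v - dot u v ^+ 2.
  by rewrite dot_cross_cross (dotC v u).
have N0' : dot X X != 0 by rewrite NE gt_eqF.
have E (y : pt) : dot y u = 0 -> dot y v = 0 -> dot X X *: y = dot y X *: X.
  by move=> yu yv; rewrite cross_decomposition yu yv !mul0r !subr0 !scale0r !addr0.
have [Em Ew] := (E m mu mv, E w wu wv).
have NX : dot X X = dot m X ^+ 2.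
  by have := congr1 (dot m) Em; rewrite !dotZr m1 mulr1.
have wm : dot X X * dot w m = dot m X * dot w X.
  by have := congr1 (dot w) Em; rewrite !dotZr.
apply: (scalerI N0'); apply: (scalerI N0').
have -> : dot X X *: (dot X X *: (dot w m *: m)) =
    (dot X X * dot w m) *: (dot X X *: m).
  by rewrite !scalerA; congr (_ *: _); ring.
by rewrite Ew wm Em !scalerA NX; congr (_ *: _); ring.
Qed.

Lemma ord3_cases (i j l x : 'I_3) : uniq [:: i; j; l] -> [\/ x = i, x = j | x = l].
Proof.
move=> u; have [|_ E] := uniq_min_size u (fun y _ => mem_enum 'I_3 y).
  by rewrite -cardE card_ord.
have : x \in [:: i; j; l] by rewrite E mem_enum.
by rewrite !inE => /or3P[] /eqP; [constructor 1|constructor 2|constructor 3].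
Qed.

(** At the vertex facing the longest side the angle is bounded on both sides, so
    that the two sides there determine the plane stably. *)
Lemma triangle_plane (theta : R) : theta < pi ->
  exists K, 0 < K /\ forall D : 'I_3 -> pt, injective D ->
  (forall i j k, uniq [:: i; j; k] -> angle (D j - D i) (D k - D i) <= theta) ->
  [/\ exists m, unit_normal m (range D),
      forall m w, unit_normal m (range D) ->
        (forall i j, dot w (D i - D j) = 0) -> w = dot w m *: m &
      forall m n e z, unit_normal m (range D) -> 0 <= e ->
        (forall i j, `|dot n (D i - D j)| <= e * enorm (D i - D j)) ->
        `|dot n z - dot n m * dot m z| <= K * e * enorm z].
Proof.
move=> tpi; pose c0 := Num.min (cos theta) 0.
have [t0|t0] := leP 0 theta; last first.
  exists 1; split=> // D _ /(_ 0 1 2 isT) h.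
  by have := le_lt_trans h t0; rewrite ltNge angle_ge0.
have c01 : -1 < c0 <= 0.
  rewrite /c0 lt_min ge_min lexx orbT andbT; apply/andP; split; last by rewrite ltrN10.
  by rewrite -cospi ltr_cos ?in_itv/= ?lexx ?pi_ge0 ?t0 ?(ltW tpi)//.
pose k := 1 - Num.max (c0 ^+ 2) 4^-1 : R.
have k0 : 0 < k.
  rewrite subr_gt0 gt_max; apply/andP; split; last by rewrite invf_lt1// ltr1n.
  by case/andP: c01 => h1 h2; nra.
exists (4 / k); split; first by rewrite divr_gt0.
move=> D injD angD.
have [i [j [l [ijl u1 u2]]]] : exists i j l, [/\ uniq [:: i; j; l],
    dot (D j - D i) (D j - D i) <= dot (D j - D i - (D l - D i)) (D j - D i - (D l - D i)) &
    dot (D l - D i) (D l - D i) <= dot (D j - D i - (D l - D i)) (D j - D i - (D l - D i))].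
  have E (x y t : 'I_3) : D x - D y - (D t - D y) = D x - D t by rewrite opprB addrA subrK.
  have dN (x y : pt) : dot (x - y) (x - y) = dot (y - x) (y - x).
    by rewrite -[x - y]opprB dotNl dotNr opprK.
  have [h01|h01] := leP (dot (D 0 - D 1) (D 0 - D 1)) (dot (D 0 - D 2) (D 0 - D 2)).
    have [h12|h12] := leP (dot (D 1 - D 2) (D 1 - D 2)) (dot (D 0 - D 2) (D 0 - D 2)).
      by exists 1, 0, 2; split=> //; rewrite E// dN.
    by exists 0, 1, 2; split=> //; rewrite E dN ?(le_trans h01)// ltW.
  have [h12|h12] := leP (dot (D 1 - D 2) (D 1 - D 2)) (dot (D 0 - D 1) (D 0 - D 1)).
    by exists 2, 0, 1; split=> //; rewrite E// ltW.
  exists 0, 1, 2; split=> //; rewrite E dN ltW//.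
  exact: lt_trans h12.
pose u := D j - D i; pose v := D l - D i.
have Dneq x y : x != y -> 0 < dot (D x - D y) (D x - D y).
  move=> xy; rewrite lt_neqAle dot_ge0 andbT eq_sym; apply: contra_neq xy => /dot_eq0 h.
  by apply: injD; apply/eqP; rewrite -subr_eq0 h.
have [uu vv] : 0 < dot u u /\ 0 < dot v v.
  by move: ijl; rewrite /= !inE negb_or => /andP[/andP[ij il] _]; split; apply: Dneq; rewrite eq_sym.
have uv : c0 * (enorm u * enorm v) <= dot u v.
  have := angle_le_dot (ltW tpi) (angD i j l ijl).
  apply: le_trans; rewrite ler_wpM2r ?mulr_ge0 ?enorm_ge0// ge_min lexx//.
have kN := gram_lower_bound c01 uv u1 u2.
have N0 : 0 < dot u u * dot v v - dot u v ^+ 2.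
  by apply: lt_le_trans kN; rewrite !mulr_gt0.
have mD m : unit_normal m (range D) -> [/\ dot m m = 1, dot m u = 0 & dot m v = 0].
  move=> [m1 mo]; have mo' x y : dot m (D x - D y) = 0.
    by apply: mo; [exists x|exists y].
  by split; [rewrite -sqr_enorm m1 expr1n|exact: mo'|exact: mo'].
have all_ijl x := ord3_cases x ijl.
split.
- have [m [m1 mu mv]] := unit_normal_exists N0.
  exists m; split; first exact: unit_enorm.
  have mi x : dot m (D x) = dot m (D i).
    apply/eqP; rewrite -subr_eq0 -dotBr; apply/eqP.
    by case: (all_ijl x) => ->; rewrite ?subrr ?dot0r.
  by move=> _ _ [x _ <-] [y _ <-]; rewrite dotBr !mi subrr.
- move=> m w /mD[m1 mu mv] wD.
  by apply: (orthogonal_multiple N0) => //; exact: wD.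
- move=> m n e z /mD[m1 mu mv] e0 nD.
  by apply: (@normal_stability k e u v n m z) => //; exact: nD.
Qed.

End Angles.

(** * Barycentric coordinates on the elements *)

Section Barycentric.
Variable R : realType.
Local Notation pt := 'rV[R]_3.

(** An affine function vanishing at the four points vanishes on a ball, hence is
    zero: the matrix of the points in homogeneous coordinates is invertible. *)
Lemma barycentric_exists (A : 'I_4 -> pt) (c : pt) (r : R) : 0 < r ->
  (forall p, enorm (p - c) <= r -> exists l : 'I_4 -> R,
    \sum_a l a = 1 /\ p = \sum_a l a *: A a) ->
  exists (k : 'I_4 -> R) (G : 'I_4 -> pt),
    [/\ forall a b, k a + dot (G a) (A b) = (a == b)%:R,
        forall x, \sum_a (k a + dot (G a) x) = 1 &
        forall x, \sum_a (k a + dot (G a) x) *: A a = x].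
Proof.
move=> r0 cov.
pose B : 'M[R]_4 := \matrix_(b, j) nth 0 [:: 1; A b 0 0; A b 0 1; A b 0 2] j.
have B0 b : B b 0 = 1 by rewrite mxE.
have B1 b : B b 1 = A b 0 0 by rewrite mxE.
have B2 b : B b 2 = A b 0 1 by rewrite mxE.
have B3 b : B b 3 = A b 0 2 by rewrite mxE.
have sum4 (F : 'I_4 -> R) : \sum_j F j = F 0 + F 1 + F 2 + F 3.
  rewrite !big_ord_recl big_ord0 addr0 !addrA.
  by congr (F _ + F _ + F _ + F _); exact/val_inj.
have uB : B \in unitmx.
  rewrite unitmxE unitfE -det_tr; apply/negP => /det0P[v v0 vB].
  pose w : pt := \row_(i < 3) nth 0 [:: v 0 1; v 0 2; v 0 3] i.
  have vA b : v 0 0 + dot w (A b) = 0.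
    have := congr1 (fun m : 'rV[R]_4 => m 0 b) vB; rewrite !mxE sum4 !mxE/= dotE !mxE/=.
    by move=> <-; ring.
  have vx p : enorm (p - c) <= r -> v 0 0 + dot w p = 0.
    move=> /cov[l [l1 ->]]; rewrite dot_sumr -[v 0 0]mulr1 -l1 mulr_sumr -big_split/=.
    by rewrite big1// => a _; rewrite dotZr mulrC -mulrDr vA mulr0.
  have vc := vx c; rewrite subrr enorm0 (ltW r0) in vc.
  have w0 : w = 0.
    apply/eqP; apply: contraT => w0; have ew := enorm_gt0 w0.
    have := vx (c + (r / enorm w) *: w); rewrite addrAC subrr add0r enormZ.
    rewrite ger0_norm ?divr_ge0 ?(ltW r0) ?(ltW ew)// divfK ?gt_eqF// lexx => /(_ isT).
    rewrite dotDr addrA vc// add0r dotZr => /eqP; rewrite mulf_eq0 mulf_eq0 invr_eq0.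
    rewrite (gt_eqF r0) (gt_eqF ew)/= => /eqP/dot_eq0 h.
    by rewrite h eqxx in w0.
  have v00 : v 0 0 = 0 by have := vc isT; rewrite w0 dot0l addr0.
  have wE (i : 'I_3) : w 0 i = 0 by rewrite w0 mxE.
  case/negP: v0; apply/eqP/rowP => -[[|[|[|[|//]]]] i4]; rewrite [RHS]mxE.
  - by rewrite -v00; congr (v 0 _); exact/val_inj.
  - by have := wE 0; rewrite mxE/= => <-; congr (v 0 _); exact/val_inj.
  - by have := wE 1; rewrite mxE/= => <-; congr (v 0 _); exact/val_inj.
  - by have := wE 2; rewrite mxE/= => <-; congr (v 0 _); exact/val_inj.
clearbody B; pose V := invmx B.
have BV b a : \sum_j B b j * V j a = (b == a)%:R.
  by have := congr1 (fun m : 'M[R]_4 => m b a) (mulmxV uB); rewrite !mxE.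
have VB j j' : \sum_a V j a * B a j' = (j == j')%:R.
  by have := congr1 (fun m : 'M[R]_4 => m j j') (mulVmx uB); rewrite !mxE.
have V0 j : \sum_a V j a = (j == 0)%:R.
  by rewrite -VB; apply: eq_bigr => a _; rewrite B0 mulr1.
exists (fun a => V 0 a), (fun a => \row_(i < 3) nth 0 [:: V 1 a; V 2 a; V 3 a] i).
split.
- move=> a b; rewrite eq_sym -BV sum4 B0 B1 B2 B3 dotE !mxE/=; ring.
- move=> x; under eq_bigr do rewrite dotE !mxE/=.
  rewrite !big_split/= -!mulr_suml !V0/=; ring.
- move=> x; under eq_bigr do rewrite dotE !mxE/=.
  have coord i j : (forall b, B b j = A b 0 i) ->
      (\sum_a (V 0 a + (V 1 a * x 0 0 + V 2 a * x 0 1 + V 3 a * x 0 2)) *: A a) 0 i =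
      ((0 : 'I_4) == j)%:R + (((1 : 'I_4) == j)%:R * x 0 0 + ((2 : 'I_4) == j)%:R * x 0 1 +
      ((3 : 'I_4) == j)%:R * x 0 2).
    move=> Bj; rewrite -!VB summxE !mulr_suml -!big_split/=.
    by apply: eq_bigr => a _; rewrite !mxE Bj; ring.
  by apply: row3P; [rewrite (coord _ 1)|rewrite (coord _ 2)|rewrite (coord _ 3)] => //=; ring.
Qed.

Lemma affine_continuous (a : R) (w : pt) : continuous (fun x : pt => a + dot w x).
Proof.
have cc j : continuous (fun y : pt => w 0 j * y 0 j).
  by move=> x; apply: continuousM; [exact: cst_continuous|exact: coord_continuous].
move=> x.
apply: (@continuousD _ _ _ (fun=> a) (fun x : pt => dot w x)); first exact: cst_continuous.
have -> : (fun x : pt => dot w x) = (fun x : pt => w 0 0 * x 0 0)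
    \+ (fun x : pt => w 0 1 * x 0 1) \+ (fun x : pt => w 0 2 * x 0 2).
  by apply/funext => z; rewrite dotE.
by apply: continuousD; [apply: continuousD|]; exact: cc.
Qed.

End Barycentric.

Section Elements.
Variables (R : realType) (M : mesh R).
Local Notation pt := 'rV[R]_3.
Local Notation vset := {set 'I_(nnodes M)}.
Local Notation nodes := 'I_(nnodes M).

(** [k i + dot (G i) x] is the [i]-th barycentric coordinate of [x] in [T]. *)
Record bary (T : vset) (k : nodes -> R) (G : nodes -> pt) : Prop := Bary {
  bary_delta : forall i j, i \in T -> j \in T ->
    k i + dot (G i) (node j) = (i == j)%:R;
  bary_sum1 : forall x, \sum_(i in T) (k i + dot (G i) x) = 1;
  bary_point : forall x, \sum_(i in T) (k i + dot (G i) x) *: node i = x }.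

Section Facts.
Variables (T : vset) (k : nodes -> R) (G : nodes -> pt).
Hypothesis bT : bary T k G.
Let L i x := k i + dot (G i) x.

Lemma bary_combination (S : vset) (l : nodes -> R) i : S \subset T -> i \in T ->
  \sum_(j in S) l j = 1 -> L i (\sum_(j in S) l j *: node j) = if i \in S then l i else 0.
Proof.
move=> ST iT l1; rewrite /L dot_sumr -[k i]mulr1 -l1 mulr_sumr -big_split/=.
have E j : j \in S -> k i * l j + dot (G i) (l j *: node j) = l j * (i == j)%:R.
  by move=> jS; rewrite dotZr mulrC -mulrDr (bary_delta bT)// (fintype.subsetP ST).
rewrite (eq_bigr _ E); case: ifPn => iS.
  rewrite (bigD1 i)//= eqxx mulr1 big1 ?addr0// => j /andP[_ ji].
  by rewrite eq_sym (negbTE ji) mulr0.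
rewrite big1// => j jS; have [ij|] := eqVneq i j; last by rewrite mulr0.
by rewrite ij jS in iS.
Qed.

Lemma simplex_bary x : simplex T x <-> forall i, i \in T -> 0 <= L i x.
Proof.
split=> [[l [l0 l1 ->]] i iT|h].
  by rewrite bary_combination// iT l0.
exists (fun i => L i x); split=> //; first by rewrite (bary_sum1 bT).
by rewrite (bary_point bT).
Qed.

Lemma open_simplex_bary x : open_simplex T x <-> forall i, i \in T -> 0 < L i x.
Proof.
split=> [[l [l0 l1 ->]] i iT|h].
  by rewrite bary_combination// iT l0.
exists (fun i => L i x); split=> //; first by rewrite (bary_sum1 bT).
by rewrite (bary_point bT).
Qed.

Lemma subsimplex_bary (S : vset) x i : S \subset T -> simplex S x -> i \in T ->
  0 <= L i x /\ (i \notin S -> L i x = 0).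
Proof.
move=> ST [l [l0 l1 ->]] iT; rewrite bary_combination//.
by case: ifPn => // iS; split=> //; exact: l0.
Qed.

Lemma open_subsimplex_bary (S : vset) x : S \subset T ->
  open_simplex S x <-> forall i, i \in T -> (i \in S -> 0 < L i x) /\ (i \notin S -> L i x = 0).
Proof.
move=> ST; split=> [[l [l0 l1 ->]] i iT|h].
  by rewrite bary_combination//; case: ifPn => // iS; split=> // _; exact: l0.
have split_sum (V : zmodType) (F : nodes -> V) : (forall i, i \in T -> i \notin S -> F i = 0) ->
    \sum_(i in T) F i = \sum_(i in S) F i.
  move=> F0; rewrite (big_setID S)/= [X in _ + X]big1 ?addr0; last first.
    by move=> i; rewrite inE => /andP[iS iT]; exact: F0.
  by apply: eq_bigl => i; rewrite inE andbC; case: (boolP (i \in S)) => // /(fintype.subsetP ST) ->.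
exists (fun i => L i x); split.
- by move=> i iS; apply: (h i (fintype.subsetP ST i iS)).1.
- rewrite -split_sum ?(bary_sum1 bT)// => i iT iS.
  exact: (h i iT).2.
- rewrite -split_sum ?(bary_point bT)// => i iT iS.
  by rewrite /L; have := (h i iT).2 iS; rewrite /L => ->; rewrite scale0r.
Qed.

Lemma open_simplex_sub x : open_simplex T x -> simplex T x.
Proof. by move/open_simplex_bary => h; apply/simplex_bary => i /h /ltW. Qed.

Lemma sum_bary_grad : \sum_(i in T) G i = 0.
Proof.
have E w : dot (\sum_(i in T) G i) w = 0.
  have := bary_sum1 bT w; rewrite big_split/= -dot_suml => h.
  have := bary_sum1 bT 0; rewrite big_split/= -dot_suml dot0r => h'.
  lra.
by apply: dot_eq0; exact: E.
Qed.

Lemma bary_grad_expansion w : \sum_(i in T) dot w (node i) *: G i = w.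
Proof.
have E y : dot (\sum_(i in T) dot w (node i) *: G i) y = dot w y.
  have E x : \sum_(i in T) L i x * dot w (node i) = dot w x.
    rewrite -[in RHS](bary_point bT x) dot_sumr.
    by apply: eq_bigr => i _; rewrite dotZr.
  rewrite dot_suml; transitivity (\sum_(i in T) (L i y * dot w (node i) - L i 0 * dot w (node i))).
    by apply: eq_bigr => i _; rewrite /L dotZl dot0r; ring.
  by rewrite sumrB !E dot0r subr0.
apply/eqP; rewrite -subr_eq0; apply/eqP/dot_eq0.
by rewrite dotBl E subrr.
Qed.

Lemma open_simplex_open : open (open_simplex T).
Proof.
have -> : open_simplex T = \bigcap_(i in [set` T]) [set x | 0 < L i x].
  apply/seteqP; split=> x; first by move/open_simplex_bary => h i /= /h.
  by move=> h; apply/open_simplex_bary => i iT; exact: h.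
suff H i : open [set x : pt | 0 < L i x].
  rewrite openE => x Hx.
  have : \forall y \near x, forall i, i \in T -> 0 < L i y.
    apply: (@filter_forall _ _ (fun i y => i \in T -> 0 < L i y) _ (nbhs_filter x)) => i.
    have [iT|iT] := boolP (i \in T); last by near=> y.
    have : \forall y \near x, 0 < L i y by apply: open_nbhs_nbhs; split; [exact: H|exact: Hx].
    by apply: filterS.
  by apply: filterS => y hy i /= /hy.
apply: (@open_comp _ _ (fun x => L i x) [set y | 0 < y]); last exact: open_gt.
by move=> y _; exact: affine_continuous.
Unshelve. all: by end_near. Qed.

Lemma simplex_ray (x c : pt) t : simplex T x -> open_simplex T c -> 0 < t -> t <= 1 ->
  open_simplex T (x + t *: (c - x)).
Proof.
move=> /simplex_bary Tx /open_simplex_bary Tc t0 t1; apply/open_simplex_bary => i iT.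
have := (Tx i iT, Tc i iT) => -[]; rewrite /L dotDr dotZr dotBr; nra.
Qed.

End Facts.
End Elements.

(** * Geometry of a fat mesh *)

Section FatMesh.
Variables (R : realType) (M : mesh R) (Om : set 'rV[R]_3) (rho h : R).
Local Notation pt := 'rV[R]_3.
Local Notation vset := {set 'I_(nnodes M)}.
Local Notation nodes := 'I_(nnodes M).
Hypothesis conf : conforming_mesh M Om.
Hypothesis cubic : subdivides_cubic_mesh M h.
Hypothesis fat : regular_elements M rho h.
Hypothesis rho0 : 0 < rho.
Hypothesis h0 : 0 < h.

Lemma rhoh0 : 0 < rho * h. Proof. exact: mulr_gt0. Qed.

Lemma card_elem T : T \in elems M -> #|T| = 4%N.
Proof. by case: conf => _ _ h4 _ _; exact: h4. Qed.

Lemma elem_bary T : T \in elems M -> exists k G, bary T k G.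
Proof.
move=> TM; have c4 := card_elem TM.
have [c cT] := (fat TM).1.
pose t (a : 'I_4) : nodes := enum_val (cast_ord (esym c4) a).
have t_inj : injective t by move=> a b /enum_val_inj/cast_ord_inj.
have tT a : t a \in T by exact: enum_valP.
have Tt : T = [set t a | a in 'I_4]%SET.
  apply/eqP; rewrite eq_sym eqEcard; apply/andP; split.
    by apply/fintype.subsetP => _ /imsetP[a _ ->].
  by rewrite card_imset// card_ord c4.
have bigT (V : nmodType) (F : nodes -> V) : \sum_(i in T) F i = \sum_a F (t a).
  by rewrite [in LHS]Tt big_imset/=; [apply: eq_bigl|move=> ? ? _ _; exact: t_inj].
pose f i : 'I_4 := odflt ord0 [pick a | t a == i].
have fK a : f (t a) = a.
  rewrite /f; case: pickP => [b /eqP/t_inj//|/(_ a)].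
  by rewrite eqxx.
have [|k [G [dG sG pG]]] := @barycentric_exists R (fun a => node (t a)) c _ rhoh0.
  move=> p pc; have [l [_ l1 ->]] := cT p pc.
  by exists (fun a => l (t a)); rewrite -l1 !bigT.
exists (fun i => k (f i)), (fun i => G (f i)); split.
- move=> i j; rewrite {1 2}Tt => /imsetP[a _ ->] /imsetP[b _ ->].
  by rewrite fK dG (inj_eq t_inj).
- by move=> x; rewrite bigT; under eq_bigr do rewrite fK; exact: sG.
- by move=> x; rewrite bigT; under eq_bigr do rewrite fK; exact: pG.
Qed.

Section OneElement.
Variables (T : vset) (k : nodes -> R) (G : nodes -> pt).
Hypotheses (TM : T \in elems M) (bT : bary T k G).

Lemma bary_le1 x i : simplex T x -> i \in T -> k i + dot (G i) x <= 1.
Proof.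
move=> /(simplex_bary bT) Tx iT; rewrite -(bary_sum1 bT x) (bigD1 i)//= lerDl.
by apply: sumr_ge0 => j /andP[jT _]; exact: Tx.
Qed.

Lemma bary_grad_neq0 i : i \in T -> G i != 0.
Proof.
move=> iT; apply/eqP => Gi.
have [j jT ji] : exists2 j, j \in T & j != i.
  have : (0 < #|T :\ i|)%N by have := cardsD1 i T; rewrite iT (card_elem TM) add1n => -[<-].
  by case/card_gt0P => j; rewrite !inE => /andP[ji jT]; exists j.
have := bary_delta bT iT iT; have := bary_delta bT iT jT.
by rewrite Gi !dot0l eqxx eq_sym (negbTE ji) => -> /eqP; rewrite eq_sym oner_eq0.
Qed.

(** A barycentric coordinate varies by at most 1 across the inscribed ball. *)
Lemma bary_grad_le i : i \in T -> enorm (G i) <= (2 * rho * h)^-1.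
Proof.
move=> iT; have [c cT] := (fat TM).1.
have g0 : 0 < enorm (G i) by apply/enorm_gt0/bary_grad_neq0.
have r0 := rhoh0.
pose w := (rho * h / enorm (G i)) *: G i.
have ew : enorm w = rho * h.
  by rewrite enormZ ger0_norm ?divr_ge0 ?(ltW r0) ?(ltW g0)// divfK ?gt_eqF.
have Tp : simplex T (c + w) by apply: cT; rewrite /= addrAC subrr add0r ew.
have Tm : simplex T (c - w) by apply: cT; rewrite /= addrAC subrr add0r enormN ew.
have gw : dot (G i) w = rho * h * enorm (G i).
  by rewrite dotZr -sqr_enorm; field; rewrite gt_eqF.
have := bary_le1 Tp iT; have := (simplex_bary bT (c - w)).1 Tm i iT.
rewrite !dotDr dotNr gw => h1 h2.
by rewrite -[_^-1]mul1r ler_pdivlMr ?mulr_gt0//; lra.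
Qed.

Lemma bary_interior_ball c i p :
  [set p | enorm (p - c) <= rho * h] `<=` simplex T ->
  i \in T -> enorm (p - c) < rho * h -> 0 < k i + dot (G i) p.
Proof.
move=> cT iT pc; have g0 : 0 < enorm (G i) by apply/enorm_gt0/bary_grad_neq0.
pose e := (rho * h - enorm (p - c)) / enorm (G i).
have e0 : 0 < e by rewrite divr_gt0// subr_gt0.
have : simplex T (p - e *: G i).
  apply: cT => /=; rewrite addrAC (le_trans (enormB _ _))// enormZ gtr0_norm//.
  by rewrite /e divfK ?gt_eqF//; lra.
move=> /(simplex_bary bT)/(_ i iT); rewrite dotBr dotZr -sqr_enorm => h1.
have : 0 < e * enorm (G i) ^+ 2 by rewrite mulr_gt0 ?exprn_gt0.
by lra.
Qed.

(** Gradients of barycentric coordinates are the inward normals of the faces,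
    so the cosine of the dihedral angle along the edge opposite to [i], [j] is,
    up to a positive factor, minus their scalar product. *)
Lemma bary_grad_obtuse i j : i \in T -> j \in T -> i != j -> dot (G i) (G j) <= 0.
Proof.
move=> iT jT ij.
have [a [l [al aT lT Tijal]]] : exists a l, [/\ uniq [:: i; j; a; l], a \in T, l \in T &
    [set i; j; a; l]%SET = T].
  have : #|T :\: [set i; j]%SET| = 2%N.
    rewrite cardsD (_ : T :&: _ = [set i; j]%SET) ?cards2 ?ij ?(card_elem TM)//.
    apply/setP => x; rewrite !inE; case: eqVneq => [->|_]; first by rewrite iT.
    by case: eqVneq => [->|_]; rewrite ?jT// andbF.
  move=> /eqP/cards2P[a [l [al E]]].
  have inE' x : (x \in T :\: [set i; j]%SET) = (x \in [set a; l]%SET) by rewrite E.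
  have /[!inE]/= := inE' a; rewrite eqxx/= => /andP[].
  rewrite negb_or => /andP[ai aj] aT.
  have /[!inE]/= := inE' l; rewrite eqxx orbT/= => /andP[].
  rewrite negb_or => /andP[li lj] lT.
  exists a, l; split=> //.
    by rewrite /= !inE !negb_or ij al (eq_sym i a) ai (eq_sym i l) li (eq_sym j a) aj (eq_sym j l) lj.
  apply/setP => x; have := inE' x; rewrite !inE.
  case: (eqVneq x i) => [->|_]; first by rewrite iT.
  case: (eqVneq x j) => [->|_]; first by rewrite jT.
  by move=> /= <-.
have := (fat TM).2 i j a l Tijal al.
pose p := node i - node a; pose q := node j - node a; pose e := node l - node a.
rewrite /dihedral_angle -/p -/q -/e => /(angle_le_dot _).
have pi2 : (pi / 2 : R) <= pi by have := pi_ge0 R; lra.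
move=> /(_ pi2); rewrite cos_pihalf mul0r => D.
move: al; rewrite /= !inE !negb_or => /andP[/and3P[_ ia il] /andP[/andP[ja jl] /andP[al _]]].
have dG x y : x \in T -> y \in T -> dot (G x) (node y - node a) = (x == y)%:R - (x == a)%:R.
  move=> xT yT; have := bary_delta bT xT yT; have := bary_delta bT xT aT.
  by rewrite dotBr => <- <-; ring.
have [ip iq ie] : [/\ dot (G i) p = 1, dot (G i) q = 0 & dot (G i) e = 0].
  by rewrite !dG// eqxx (negbTE ij) (negbTE ia) (negbTE il) !subr0.
have [jp jq je] : [/\ dot (G j) p = 0, dot (G j) q = 1 & dot (G j) e = 0].
  by rewrite !dG// eqxx eq_sym (negbTE ij) (negbTE ja) (negbTE jl) !subr0.
have le : dot (G l) e = 1.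
  by rewrite !dG// eqxx (eq_sym l a) (negbTE al) subr0.
clearbody p q e.
have e0 : e != 0 by apply/eqP => E; move: le; rewrite E dot0r => /eqP; rewrite eq_sym oner_eq0.
have ee : 0 < dot e e by rewrite -sqr_enorm exprn_gt0// enorm_gt0.
pose d := dot p (cross q e).
have Ei : d *: G i = cross q e.
  by rewrite /d det_decomposition ip iq ie !scale0r !addr0 scale1r.
have Ej : d *: G j = cross e p.
  by rewrite /d det_decomposition jp jq je !scale0r scale1r add0r addr0.
have dd : d != 0.
  apply/eqP => d0; move: Ei; rewrite d0 scale0r => /esym X.
  have := dot_cross_cross q e q e; rewrite X dot0l => Y.
  pose w := q - (dot q e / dot e e) *: e.
  have w0 : w = 0.
    apply: dot_eq0; rewrite /w !(dotBl, dotBr, dotZl, dotZr) (dotC e q).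
    have -> : 0 = (dot q q * dot e e - dot q e * dot e q) / dot e e.
      by rewrite -Y mul0r.
    by rewrite (dotC e q); field; rewrite gt_eqF.
  have := dot0r (G j); rewrite -w0 /w dotBr dotZr jq je mulr0 subr0 => /eqP.
  by rewrite oner_eq0.
have : d ^+ 2 * dot (G i) (G j) = - dot e e * dot (orth_part e p) (orth_part e q).
  have -> : d ^+ 2 * dot (G i) (G j) = dot (d *: G i) (d *: G j).
    by rewrite dotZl dotZr; ring.
  rewrite Ei Ej dot_cross_cross /orth_part !(dotBl, dotBr, dotZl, dotZr).
  rewrite (dotC e p) (dotC e q) (dotC q p).
  by field; rewrite gt_eqF.
move=> E; have d2 : 0 < d ^+ 2 by rewrite exprn_even_gt0.
rewrite -(pmulr_rle0 _ d2) E mulNr oppr_le0 mulr_ge0// ltW//.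
Qed.

End OneElement.
End FatMesh.

Section MeshIncidence.
Variables (R : realType) (M : mesh R) (Om : set 'rV[R]_3) (rho h : R).
Local Notation pt := 'rV[R]_3.
Local Notation vset := {set 'I_(nnodes M)}.
Local Notation nodes := 'I_(nnodes M).
Hypothesis conf : conforming_mesh M Om.
Hypothesis cubic : subdivides_cubic_mesh M h.
Hypothesis fat : regular_elements M rho h.
Hypothesis rho0 : 0 < rho.
Hypothesis h0 : 0 < h.

Lemma node_simplex (S : vset) i : i \in S -> simplex S (node i).
Proof.
move=> iS; exists (fun j => (j == i)%:R); split=> [j _||]; first exact: ler0n.
  by rewrite (bigD1 i)//= eqxx big1 ?addr0// => j /andP[_ /negbTE ->].
rewrite (bigD1 i)//= eqxx scale1r big1 ?addr0// => j /andP[_ /negbTE ->].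
by rewrite scale0r.
Qed.

Lemma simplex_subset (S T : vset) : S \subset T -> simplex S `<=` simplex T.
Proof.
move=> ST x [l [l0 l1 ->]].
have E (V : nmodType) (F : nodes -> V) : \sum_(i in S) F i =
    \sum_(i in T) if i \in S then F i else 0.
  by rewrite -big_mkcondr/=; apply: eq_bigl => i; case: (boolP (i \in S)) => [/(fintype.subsetP ST) ->|]; rewrite ?andbF.
exists (fun i => if i \in S then l i else 0); split.
- by move=> i _; case: ifP => // /l0.
- by rewrite -E.
- by rewrite E; apply: eq_bigr => i _; case: ifP => //; rewrite scale0r.
Qed.

Lemma elem_coord_diam T x y i : T \in elems M -> simplex T x -> simplex T y ->
  `|x 0 i - y 0 i| <= h.
Proof.
move=> TM Tx Ty; case: cubic => a [K [_ /(_ T TM)[k _ sk]]].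
have := sk x Tx i; have := sk y Ty i.
rewrite intrD => /andP[h1 h2] /andP[h3 h4]; rewrite ler_norml; apply/andP; split; nra.
Qed.

Lemma elem_diam T x y : T \in elems M -> simplex T x -> simplex T y ->
  enorm (x - y) <= 2 * h.
Proof.
move=> TM Tx Ty; apply: enorm_le_coord => i; rewrite !mxE.
exact: elem_coord_diam Tx Ty.
Qed.

Lemma edge_length T i j : T \in elems M -> i \in T -> j \in T -> i != j ->
  2 * rho * h <= enorm (node i - node j).
Proof.
move=> TM iT jT ij; have [k [G bT]] := elem_bary conf fat rho0 h0 TM.
have E : dot (G i) (node i - node j) = 1.
  have := bary_delta bT iT iT; have := bary_delta bT iT jT.
  by rewrite dotBr eqxx (negbTE ij) /= => h1 h2; lra.
have := dot_le_enorm (G i) (node i - node j); rewrite E normr1.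
have := bary_grad_le conf fat rho0 h0 TM bT iT.
set e := enorm (node i - _); have e0 : 0 <= e by exact: enorm_ge0.
have r0 : 0 < 2 * rho * h by rewrite !mulr_gt0.
move=> h1 h2; rewrite -(ler_pM2l (_ : 0 < (2 * rho * h)^-1)) ?invr_gt0//.
rewrite mulVf ?gt_eqF// (le_trans h2)// ler_wpM2r//.
Qed.

Lemma open_simplex_unique T T' p : T \in elems M -> T' \in elems M ->
  open_simplex T p -> simplex T' p -> T = T'.
Proof.
move=> TM TM' Tp Tp'; have [_ _ c4 inter _] := conf.
have [k [G bT]] := elem_bary conf fat rho0 h0 TM.
apply/eqP; apply: contraT => TT'.
have [i iT iT'] : exists2 i, i \in T & i \notin T'.
  apply/subsetPn; apply: contra TT' => sTT'.
  by rewrite eqEcard sTT' !c4.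
have : simplex (T :&: T')%SET p.
  by rewrite -inter//; split=> //; exact: (open_simplex_sub bT).
move=> /(subsimplex_bary bT (subsetIl _ _) )/(_ iT)[_].
rewrite inE iT (negbTE iT') /= => /(_ isT).
by have := (open_simplex_bary bT p).1 Tp i iT => + E; rewrite E ltxx.
Qed.

(** Finitely many closed simplices cover the beginning of the ray, so one of them
    contains points arbitrarily near the origin, hence the origin. *)
Lemma finite_cover_ray (S : {set vset}) (p w : pt) : S \subset elems M ->
  (\forall t \near (0 : R)^'+, exists2 T, T \in S & simplex T (p + t *: w)) ->
  exists T, [/\ T \in S, simplex T p &
    forall e, 0 < e -> exists t, [/\ 0 < t, t < e & simplex T (p + t *: w)]].
Proof.
move=> SM cov.
have [T TS Tt] : exists2 T, T \in S &
    forall e, 0 < e -> exists t, [/\ 0 < t, t < e & simplex T (p + t *: w)].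
  apply: contrapT => nT.
  have : \forall t \near (0 : R)^'+, forall T, T \in S -> ~ simplex T (p + t *: w).
    apply: (@filter_forall _ _ (fun T t => T \in S -> ~ simplex T (p + t *: w))) => T.
    have [TS|TS] := boolP (T \in S); last by near=> t.
    have [e e0 ne] : exists2 e, 0 < e & forall t, 0 < t -> t < e -> ~ simplex T (p + t *: w).
      apply: contrapT => ne; apply: nT; exists T => // e e0.
      apply: contrapT => nt; apply: ne; exists e => // t t0 te Tt.
      by apply: nt; exists t.
    near=> t => _; apply: ne; first by near: t; exact: nbhs_right_gt.
    by near: t; exact: nbhs_right_lt.
  move=> nT'; have [t [[T TS Tt] nTt]] : exists t : R,
      (exists2 T, T \in S & simplex T (p + t *: w)) /\
      forall T, T \in S -> ~ simplex T (p + t *: w).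
    by apply: (@filter_ex _ (0 : R)^'+); near=> t; split; near: t.
  exact: (nTt T TS Tt).
exists T; split=> //; have TM := fintype.subsetP SM T TS.
have [k [G bT]] := elem_bary conf fat rho0 h0 TM.
apply/(simplex_bary bT) => i iT; rewrite leNgt; apply/negP => Lp.
pose d := `|dot (G i) w| + 1; have d0 : 0 < d by rewrite ltr_pwDr.
have [|t [t0 te /(simplex_bary bT)/(_ i iT)]] := Tt (- (k i + dot (G i) p) / d).
  by rewrite divr_gt0// oppr_gt0.
rewrite dotDr dotZr addrA => h1; move: te; rewrite ltr_pdivlMr// => te.
have : t * dot (G i) w <= t * d.
  by rewrite ler_pM2l// /d (le_trans (ler_norm _))// lerDl.
by lra.
Unshelve. all: by end_near. Qed.

(** The ray leaving [F] along the normal enters some element; this element meets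
    the face in one of its interior points, hence contains it. *)
Lemma face_element (F : vset) (n p : pt) : is_face F -> unit_normal n (simplex F) ->
  open_simplex F p -> Om p ->
  exists T, [/\ T \in elems M, F \subset T &
    forall x, open_simplex F x -> \forall t \near (0 : R)^'+, open_simplex T (x + t *: n)].
Proof.
move=> [cF [T0 T0M FT0]] [n1 nF] Fp; have [_ _ c4 inter OmE] := conf.
rewrite OmE => /nbhs_ballP[e /= e0 eM].
have : \forall t \near (0 : R)^'+, exists2 T, T \in elems M & simplex T (p + t *: n).
  near=> t; apply: eM; apply: ball_enorm => //.
  rewrite addrAC subrr add0r enormZ n1 mulr1 gtr0_norm; first by near: t; exact: nbhs_right_lt.
  by near: t; exact: nbhs_right_gt.
move=> /(finite_cover_ray (subxx _))[T [TM Tp Tt]].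
have [k0 [G0 b0]] := elem_bary conf fat rho0 h0 T0M.
have [k [G bT]] := elem_bary conf fat rho0 h0 TM.
have FT : F \subset T.
  have Ip : simplex (T :&: T0)%SET p.
    rewrite -inter//; split=> //; apply: (simplex_subset FT0).
    by have [l [l0 l1 ->]] := Fp; exists l; split=> // i /l0/ltW.
  apply/fintype.subsetP => i iF; apply: contraT => iT.
  have iT0 := fintype.subsetP FT0 i iF.
  have [_] := subsimplex_bary b0 (subsetIr _ _) Ip iT0.
  rewrite inE (negbTE iT) => /(_ isT) E.
  by have := ((open_subsimplex_bary b0 p FT0).1 Fp i iT0).1 iF; rewrite E ltxx.
exists T; split=> // x Fx.
have [v vTF] : exists v, T :\: F = [set v]%SET.
  by apply/cards1P; rewrite cardsD (finset.setIidPr FT) c4// cF.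
have [vT vF] : v \in T /\ v \notin F.
  by have : v \in T :\: F; [rewrite vTF set11|rewrite inE => /andP[]].
have [f fF] : exists f, f \in F by apply/card_gt0P; rewrite cF.
have fT := fintype.subsetP FT f fF.
have TFE i : i \in T -> i \notin F -> i = v.
  by move=> iT iF; have : i \in T :\: F by [rewrite inE iF]; rewrite vTF => /set1P.
have nE : n = dot n (node v - node f) *: G v.
  rewrite -[LHS](bary_grad_expansion bT) dotBr scalerBl.
  have -> : dot n (node f) *: G v = - \sum_(i in T | i != v) dot n (node f) *: G i.
    have := sum_bary_grad bT; rewrite (bigD1 v)//= -scaler_sumr => /eqP.
    by rewrite addr_eq0 => /eqP ->; rewrite scalerN.
  rewrite opprK [LHS](bigD1 v)//=; congr (_ + _); apply: eq_bigr => i /andP[iT io].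
  congr (_ *: _); apply/eqP; rewrite -subr_eq0 -dotBr; apply/eqP/nF; apply: node_simplex => //.
  by apply: contraT => iF; move: io; rewrite (TFE i iT iF) eqxx.
have nn : dot n n = 1 by rewrite -sqr_enorm n1 expr1n.
have Gn0 : dot (G v) n != 0.
  by apply/eqP => h1; move: nn; rewrite {1}nE dotZl h1 mulr0 => /eqP; rewrite eq_sym oner_eq0.
have Gn : 0 < dot (G v) n.
  rewrite lt_neqAle eq_sym Gn0/=.
  have [t [t0 _ /(simplex_bary bT)/(_ v vT)]] := Tt 1 ltr01.
  have := ((open_subsimplex_bary bT p FT).1 Fp v vT).2 vF.
  by rewrite dotDr dotZr addrA => ->; rewrite add0r pmulr_rge0.
have : \forall t \near (0 : R)^'+, forall i, i \in T -> 0 < k i + dot (G i) (x + t *: n).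
  apply: (@filter_forall _ _ (fun i t => i \in T -> 0 < k i + dot (G i) (x + t *: n))) => i.
  have [iT|iT] := boolP (i \in T); last by near=> t.
  have [Lp Lz] := (open_subsimplex_bary bT x FT).1 Fx i iT.
  have [iF|iF] := boolP (i \in F); last first.
    near=> t => _; rewrite dotDr dotZr addrA Lz// add0r (TFE i iT iF).
    by apply: mulr_gt0 => //; near: t; exact: nbhs_right_gt.
  pose d := `|dot (G i) n| + 1; have d0 : 0 < d by rewrite ltr_pwDr.
  have {}Lp := Lp iF.
  near=> t => _; rewrite dotDr dotZr addrA.
  have t0 : 0 < t by near: t; exact: nbhs_right_gt.
  have : t < (k i + dot (G i) x) / d by near: t; apply: nbhs_right_lt; rewrite divr_gt0.
  rewrite ltr_pdivlMr// => td.
  have : - (t * d) <= t * dot (G i) n.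
    by rewrite -mulrN ler_pM2l// /d; have := ler_norm (- dot (G i) n); rewrite normrN; lra.
  by lra.
by apply: filterS => t Ht; apply/(open_simplex_bary bT).
Unshelve. all: by end_near. Qed.

Definition packing_number : nat := (Num.truncn (16 / rho)).+2 ^ 3.

(** On the grid of spacing [rho * h / 4] each element contains a point in its
    interior, and no point is interior to two elements; the coordinates of the
    centers vary by at most [4 * h], which is [16 / rho] steps. *)
Lemma packing (S : {set vset}) (y : pt) : S \subset elems M ->
  (forall T, T \in S -> forall x, simplex T x -> forall i, `|x 0 i - y 0 i| <= 2 * h) ->
  (#|S| <= packing_number)%N.
Proof.
move=> SM Sy; pose s := rho * h / 4; have s0 : 0 < s by rewrite divr_gt0 ?mulr_gt0.
have [cc Hcc] : exists cc : vset -> pt, forall T, T \in elems M ->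
    [set p | enorm (p - cc T) <= rho * h] `<=` simplex T.
  have /choice[cc Hcc] : forall T : vset, exists c : pt, T \in elems M ->
      [set p | enorm (p - c) <= rho * h] `<=` simplex T.
    move=> T; have [TM|TM] := boolP (T \in elems M); last by exists 0.
    by have [c cT] := (fat TM).1; exists c.
  by exists cc.
pose z T i := Num.floor (cc T 0 i / s).
pose gp T : pt := \row_i (s * (z T i)%:~R).
have gpc T : enorm (gp T - cc T) <= 2 * s.
  apply: enorm_le_coord => i; rewrite !mxE /z.
  have /andP[h1 h2] := floor_itv (cc T 0 i / s).
  rewrite intrD in h2; move: h1 h2; rewrite ler_pdivlMr// ltr_pdivrMr// => h1 h2.
  by rewrite ler_norml; apply/andP; split; lra.
have gpin T : T \in elems M -> open_simplex T (gp T).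
  move=> TM; have [k [G bT]] := elem_bary conf fat rho0 h0 TM.
  apply/(open_simplex_bary bT) => i iT.
  apply: (bary_interior_ball conf TM bT (Hcc T TM)) => //.
  rewrite (le_lt_trans (gpc T))// /s.
  by have : 0 < rho * h by [exact: mulr_gt0]; lra.
pose m i := Num.floor ((y 0 i - 2 * h) / s).
pose N := (Num.truncn (16 / rho)).+1.
pose zm_dist T (i : 'I_3) : nat := absz (z T i - m i).
pose f T : 'I_N.+1 * 'I_N.+1 * 'I_N.+1 :=
  (inord (zm_dist T 0%R), inord (zm_dist T 1%R), inord (zm_dist T 2%R)).
have zm T i : T \in S -> (m i <= z T i)%R /\ (absz (z T i - m i)%R <= N)%N.
  move=> TS; have TM := fintype.subsetP SM T TS.
  have /(Sy T TS)/(_ i) : simplex T (cc T).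
    by apply: Hcc => //=; rewrite subrr enorm0 mulr_ge0// ltW.
  rewrite ler_norml => /andP[h1 h2].
  have mz : (m i <= z T i)%R by apply: le_floor; rewrite ler_pM2r ?invr_gt0//; lra.
  split=> //.
  have /andP[h3 h4] := floor_itv (cc T 0 i / s).
  have /andP[h5 h6] := floor_itv ((y 0 i - 2 * h) / s).
  have w : cc T 0 i / s - (y 0 i - 2 * h) / s <= 16 / rho.
    rewrite -mulrBl ler_pdivrMr// /s.
    have -> : 16 / rho * (rho * h / 4) = 4 * h by field; rewrite gt_eqF.
    by lra.
  have e : ((absz (z T i - m i))%:R : R) = (z T i)%:~R - (m i)%:~R.
    by rewrite natr_absz ger0_norm ?subr_ge0// intrB.
  have : ((absz (z T i - m i))%:R : R) < (16 / rho) + 1.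
    rewrite e; move: h6; rewrite intrD -/(m i) => h6.
    by move: h3; rewrite -/(z T i) => h3; lra.
  have h8 := truncnS_gt (16 / rho).
  have h9 : (N.+1%:R : R) = (Num.truncn (16 / rho)).+1%:R + 1 by rewrite /N natr1.
  by rewrite -ltnS -(ltr_nat R) h9 => h7; lra.
have f_inj : {in S &, injective f}.
  move=> T T' TS TS' [].
  have eq i : T \in S -> (inord (absz (z T i - m i)) : 'I_N.+1) = inord (absz (z T' i - m i)) -> z T i = z T' i.
    move=> _ /(congr1 val); rewrite /= !inordK ?ltnS; [|exact: (zm _ _ _).2..].
    move=> /(congr1 Posz); rewrite !gez0_abs ?subr_ge0; [|exact: (zm _ _ _).1..].
    by move/addIr.
  move=> /(eq 0 TS) e0 /(eq 1 TS) e1 /(eq 2 TS) e2.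
  have E : gp T = gp T' by apply: row3P; rewrite !mxE ?e0 ?e1 ?e2.
  have [TM TM'] := (fintype.subsetP SM T TS, fintype.subsetP SM T' TS').
  apply: (open_simplex_unique TM TM' (gpin T TM)); rewrite E.
  have [k [G bT]] := elem_bary conf fat rho0 h0 TM'.
  exact/(open_simplex_sub bT)/gpin.
rewrite -(card_in_imset f_inj) (leq_trans (max_card _))//.
by rewrite !card_prod !card_ord /packing_number /N !expnS expn0 muln1 mulnA.
Qed.

End MeshIncidence.

(** * A discrete Poincare inequality *)

Lemma sqr_sum_le (R : realType) (n : nat) (s : 'I_n -> R) :
  (\sum_l s l) ^+ 2 <= n%:R * \sum_l s l ^+ 2.
Proof.
have -> : (\sum_l s l) ^+ 2 = \sum_l \sum_m s l * s m.
  by rewrite expr2 big_distrlr.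
apply: (@le_trans _ _ (\sum_l \sum_m (s l ^+ 2 + s m ^+ 2) / 2)).
  by apply: ler_sum => l _; apply: ler_sum => m _; have := sqr_ge0 (s l - s m); nra.
under eq_bigr => l _ do rewrite -mulr_suml big_split/= sumr_const card_ord.
rewrite -mulr_suml big_split/= sumr_const card_ord sumrMnl -[_ *+ n]mulr_natl.
lra.
Qed.

Lemma convex_comb_gt (R : realType) (c u v t : R) :
  0 <= t -> t <= 1 -> c < u -> c < v -> c < u + t * (v - u).
Proof. by move=> t0 t1 cu cv; have [uv|vu] := leP u v; nra. Qed.

Lemma convex_comb_lt (R : realType) (c u v t : R) :
  0 <= t -> t <= 1 -> u < c -> v < c -> u + t * (v - u) < c.
Proof. by move=> t0 t1 uc vc; have [uv|vu] := leP u v; nra. Qed.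

Section Poincare.
Variables (R : realType) (M : mesh R) (Om : set 'rV[R]_3) (rho h Bd : R).
Local Notation pt := 'rV[R]_3.
Local Notation vset := {set 'I_(nnodes M)}.
Local Notation nodes := 'I_(nnodes M).
Local Notation cell := ('I_3 -> int).
Hypothesis conf : conforming_mesh M Om.
Hypothesis cubic : subdivides_cubic_mesh M h.
Hypothesis fat : regular_elements M rho h.
Hypothesis rho0 : 0 < rho.
Hypothesis h0 : 0 < h.
Hypothesis Om_bounded : forall x, Om x -> forall i, `|x 0 i| <= Bd.

Variables (a : pt) (K : set cell).
Hypothesis region : mesh_region M = \bigcup_(k in K) cube_cell a h k.
Hypothesis in_cell : forall T : vset, T \in elems M ->
  exists2 k, K k & simplex T `<=` cube_cell a h k.

Implicit Types (T U V : vset) (k : cell) (p q : pt).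

Variable x : nodes -> R.
Hypothesis x0 : forall i, ~ Om (node i) -> x i = 0.

Let N := packing_number rho.

Definition osc (T : vset) : R := \sum_(i in T) \sum_(j in T) (x i - x j) ^+ 2.

Lemma step_right (m : int) : h * (m + 1)%:~R = h * m%:~R + h.
Proof. by rewrite intrD mulrDr mulr1. Qed.

Lemma osc_ge0 T : 0 <= osc T.
Proof. by apply: sumr_ge0 => i _; apply: sumr_ge0 => j _; exact: sqr_ge0. Qed.

Lemma osc_ge T (i j : nodes) : i \in T -> j \in T -> (x i - x j) ^+ 2 <= osc T.
Proof.
move=> iT jT; rewrite /osc (bigD1 i)//= (bigD1 j)//= -addrA lerDl.
by rewrite addr_ge0// sumr_ge0// => u _; rewrite ?sqr_ge0// sumr_ge0// => v _; exact: sqr_ge0.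
Qed.

Definition cell_interior (k : cell) : set pt :=
  [set p | forall i, a 0 i + h * (k i)%:~R < p 0 i < a 0 i + h * (k i + 1)%:~R].

Lemma cell_interior_sub k p : cell_interior k p -> cube_cell a h k p.
Proof. by move=> kp i; have /andP[/ltW -> /ltW ->] := kp i. Qed.

Lemma cell_interior_unique k k' p : cell_interior k p -> cube_cell a h k' p -> k = k'.
Proof.
move=> kp k'p; apply/funext => i; have /andP[h1 h2] := kp i; have /andP[h3 h4] := k'p i.
have e1 : ((k i)%:~R < (k' i + 1)%:~R :> R).
  by rewrite -(ltr_pM2l h0) -(ltrD2l (a 0 i)); exact: lt_le_trans h4.
have e2 : ((k' i)%:~R < (k i + 1)%:~R :> R).
  by rewrite -(ltr_pM2l h0) -(ltrD2l (a 0 i)); exact: le_lt_trans h2.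
move: e1 e2; rewrite !ltr_int !ltzD1 => e1 e2.
by apply/eqP; rewrite eq_le e1.
Qed.

Definition elems_in (k : cell) : {set vset} :=
  [set T in elems M | `[< simplex T `<=` cube_cell a h k >]]%SET.

Lemma elems_inP k T :
  T \in elems_in k <-> T \in elems M /\ simplex T `<=` cube_cell a h k.
Proof. by rewrite inE; split=> [/andP[-> /asboolP]|[-> /asboolP]]. Qed.

Lemma elems_in_elems k : elems_in k \subset elems M.
Proof. by apply/fintype.subsetP => T /elems_inP[]. Qed.

Lemma card_elems_in k : (#|elems_in k| <= N)%N.
Proof.
have hp := h0.
apply: (packing conf fat rho0 h0 (y := \row_i (a 0 i + h * (k i)%:~R))) => //.
  exact: elems_in_elems.
move=> T /elems_inP[_ sT] p Tp i; have := sT p Tp i; rewrite !mxE step_right => /andP[h1 h2].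
by rewrite ler_norml; apply/andP; split; lra.
Qed.

Lemma cell_interior_cover k p : K k -> cell_interior k p ->
  exists2 T, T \in elems_in k & simplex T p.
Proof.
move=> Kk kp; have : mesh_region M p.
  by rewrite region; exists k => //; exact: cell_interior_sub.
move=> [T TM Tp]; exists T => //; apply/elems_inP; split=> //.
have [k' Kk' sT] := in_cell TM.
by rewrite (cell_interior_unique kp (sT p Tp)).
Qed.

Definition center (k : cell) : pt := \row_i (a 0 i + h * (k i)%:~R + h / 2).

Lemma center_Om k : K k -> Om (center k).
Proof.
have hp := h0.
move=> Kk; case: conf => _ _ _ _ ->; apply/nbhs_ballP; exists (h / 2) => /=; first by rewrite divr_gt0.
move=> p /ballP[_ pr]; rewrite region; exists k => // i.
have := pr i; rewrite mxE step_right ltr_norml => /andP[h1 h2].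
by apply/andP; split; lra.
Qed.

(** The corners of a cell are extreme points of it, hence nodes of the elements
    that contain them. *)
Lemma corner_node k q : K k -> cube_cell a h k q ->
  (forall i, (forall y, cube_cell a h k y -> q 0 i <= y 0 i) \/
             (forall y, cube_cell a h k y -> y 0 i <= q 0 i)) ->
  exists T j, [/\ T \in elems_in k, j \in T & node j = q].
Proof.
have hp := h0.
move=> Kk kq ext.
have : \forall t \near (0 : R)^'+, exists2 T, T \in elems_in k & simplex T (q + t *: (center k - q)).
  near=> t; apply: (cell_interior_cover Kk) => i; rewrite !mxE.
  have t0 : 0 < t by near: t; exact: nbhs_right_gt.
  have t1 : t < 1 by near: t; exact: nbhs_right_lt.
  have := kq i; rewrite step_right => /andP[h1 h2]; apply/andP; split; nra.
move=> /(finite_cover_ray conf fat rho0 h0 (elems_in_elems k))[T [TS [l [l0 l1 qE]] _]].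
have /elems_inP[TM sT] := TS.
have [j jT lj] : exists2 j, j \in T & 0 < l j.
  apply: contrapT => nl; have : \sum_(i in T) l i = 0.
    apply: big1 => i iT; apply/eqP; rewrite eq_le l0// andbT leNgt; apply/negP => li.
    by apply: nl; exists i.
  by rewrite l1 => /eqP; rewrite oner_eq0.
exists T, j; split=> //.
apply/rowP => i; have nodeT v : v \in T -> cube_cell a h k (node v).
  by move=> vT; apply: sT; exact: node_simplex.
have S0 : \sum_(v in T) l v * (node v 0 i - q 0 i) = 0.
  under eq_bigr do rewrite mulrBr; rewrite sumrB -mulr_suml l1 mul1r {1}qE summxE.
  by apply/eqP; rewrite subr_eq0; apply/eqP/eq_bigr => v _; rewrite mxE.
have finish (c : R) : c != 0 -> (forall v, v \in T -> 0 <= c * (node v 0 i - q 0 i)) ->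
    node j 0 i = q 0 i.
  move=> c0 pos; have : \sum_(v in T) l v * (c * (node v 0 i - q 0 i)) = 0.
    by under eq_bigr do rewrite mulrCA; rewrite -mulr_sumr S0 mulr0.
  move/psumr_eq0P => H.
  have /eqP := H (fun v vT => mulr_ge0 (l0 v vT) (pos v vT)) j jT.
  by rewrite !mulf_eq0 (gt_eqF lj) (negbTE c0)/= subr_eq0 => /eqP.
case: (ext i) => e.
  apply: (finish 1); rewrite ?oner_eq0// => v vT; rewrite mul1r subr_ge0.
  exact/e/nodeT.
apply: (finish (- 1)); rewrite ?oppr_eq0 ?oner_eq0// => v vT; rewrite mulN1r opprB subr_ge0.
exact/e/nodeT.
Unshelve. all: by end_near. Qed.

Lemma simplex_closed T : T \in elems M -> closed (simplex T).
Proof.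
move=> TM; have [k [G bT]] := elem_bary conf fat rho0 h0 TM.
have -> : simplex T = \bigcap_(i in [set` T]) [set y | 0 <= k i + dot (G i) y].
  apply/seteqP; split=> y; first by move/(simplex_bary bT) => H i /= /H.
  by move=> H; apply/(simplex_bary bT) => i iT; exact: H.
apply: closed_bigI => i _.
apply: (@closed_comp _ _ (fun y : pt => k i + dot (G i) y) [set y | 0 <= y]).
  by move=> y _; exact: affine_continuous.
exact: closed_ge.
Qed.

Lemma elems_union_closed (S : {set vset}) : S \subset elems M ->
  closed (\bigcup_(T in [set` S]) simplex T).
Proof.
move=> SM; apply: closed_bigcup; first exact: finite_finpred.
by move=> T /= TS; apply: simplex_closed; exact: (fintype.subsetP SM).
Qed.

Lemma simplex_meet (T T' : vset) p : T \in elems M -> T' \in elems M ->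
  simplex T p -> simplex T' p -> exists2 i, i \in T & i \in T'.
Proof.
move=> TM TM' Tp Tp'; have [_ _ _ inter _] := conf.
have [l [_ l1 _]] : simplex (T :&: T')%SET p by rewrite -inter.
have [/eqP I0|/set0Pn[i]] := boolP (T :&: T' == finset.set0)%SET; last by rewrite inE => /andP[]; exists i.
by move: l1; rewrite I0 big_set0 => /eqP; rewrite eq_sym oner_eq0.
Qed.

Definition share (k : cell) : rel vset := fun U V =>
  [&& U \in elems_in k, V \in elems_in k & (U :&: V != finset.set0)%SET].

Lemma share_simplex k U V p : U \in elems_in k -> V \in elems_in k ->
  simplex U p -> simplex V p -> share k U V.
Proof.
move=> UE VE Up Vp; rewrite /share UE VE /=.
have [/elems_inP[UM _] /elems_inP[VM _]] := (UE, VE).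
have [i iU iV] := simplex_meet UM VM Up Vp.
by apply/set0Pn; exists i; rewrite inE iU.
Qed.

(** A segment inside the cell cannot leave the union of the elements reached
    from the first one. *)
Lemma cell_connected k T T' : K k -> T \in elems_in k -> T' \in elems_in k ->
  connect (share k) T T'.
Proof.
move=> Kk TE TE'.
have mid U : U \in elems_in k -> exists c, simplex U c /\ cell_interior k c.
  move=> /elems_inP[UM sU]; have [c cU] := (fat UM).1.
  have r0 : 0 < rho * h by exact: mulr_gt0.
  exists c; split; first by apply: cU; rewrite /= subrr enorm0 ltW.
  have pm (e : R) i : `|e| = rho * h -> cube_cell a h k (c + e *: delta_mx 0 i).
    move=> er; apply/sU/cU; rewrite /= addrAC subrr add0r enormZ er.
    rewrite (_ : enorm _ = 1) ?mulr1// unit_enorm// /dot (bigD1 i)//= mxE !eqxx mulr1.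
    by rewrite big1 ?addr0// => j /negbTE ji; rewrite mxE ji andbF mul0r.
  move=> i; have /(_ i) := pm (rho * h) i (gtr0_norm r0).
  have := pm (- (rho * h)) i; rewrite normrN gtr0_norm// => /(_ erefl)/(_ i).
  rewrite !mxE !eqxx /= !mulr1 => /andP[h1 h2] /andP[h3 h4].
  by apply/andP; split; lra.
have [c [Tc kc]] := mid T TE; have [c' [Tc' kc']] := mid T' TE'.
pose S := [set U in elems_in k | connect (share k) T U]%SET.
have SE U : U \in S -> U \in elems_in k by rewrite inE => /andP[].
have SM : S \subset elems M.
  by apply/fintype.subsetP => U /SE /elems_inP[].
have SM' : elems_in k :\: S \subset elems M.
  by apply/fintype.subsetP => U; rewrite inE => /andP[_ /elems_inP[]].
have seg t : 0 <= t <= 1 -> cell_interior k (c + t *: (c' - c)).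
  move=> /andP[t0 t1] i; have /andP[h1 h2] := kc i; have /andP[h3 h4] := kc' i.
  by rewrite !mxE convex_comb_gt ?convex_comb_lt.
have nB : ~ (\bigcup_(U in [set` elems_in k :\: S]) simplex U) c'.
  apply: (@segment_closed_separation _ (\bigcup_(U in [set` S]) simplex U) _ c c').
  - exact: elems_union_closed.
  - exact: elems_union_closed.
  - move=> t t01 [[U /= US Ut] [V /=]]; rewrite inE => /andP[nVS VE] Vt.
    case/negP: nVS; rewrite inE VE /=; move: US; rewrite inE => /andP[UE TU].
    by apply: (connect_trans TU); apply: connect1; exact: share_simplex Ut Vt.
  - move=> t /seg/(cell_interior_cover Kk)[U UE Ut].
    have [US|US] := boolP (U \in S); first by left; exists U.
    by right; exists U => //=; rewrite inE US.
  - by exists T => //=; rewrite inE TE connect0.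
apply: contraT => nTT'; exfalso; apply: nB; exists T' => //=.
by rewrite !inE negb_and nTT' orbT; rewrite inE in TE'; rewrite TE'.
Qed.

Definition cell_osc (k : cell) : R := \sum_(T in elems_in k) osc T.

Lemma cell_osc_ge0 k : 0 <= cell_osc k.
Proof. by apply: sumr_ge0 => T _; exact: osc_ge0. Qed.

Lemma path_oscillation k T (p : seq vset) (s : R) (i j : nodes) :
  (forall U u v, U \in elems_in k -> u \in U -> v \in U -> `|x u - x v| <= s) ->
  T \in elems_in k -> path (share k) T p -> i \in T -> j \in last T p ->
  `|x i - x j| <= (size p).+1%:R * s.
Proof.
move=> Hs; elim: p T i => [|U p IH] T i TE /=; first by move=> _ iT jT; rewrite mul1r; exact: (Hs T).
move=> /andP[/and3P[_ UE /set0Pn[u]]]; rewrite inE => /andP[uT uU] pU iT jl.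
have := IH U u UE pU uU jl; have := Hs T i u TE iT uT.
rewrite -[(size p).+2]addn1 natrD mulrDl mul1r => h1 h2.
rewrite (_ : x i - x j = (x i - x u) + (x u - x j)); last by ring.
by rewrite (le_trans (ler_normD _ _))// addrC lerD.
Qed.

(** A path without repetition runs through at most [N] elements. *)
Lemma cell_oscillation k T T' (i j : nodes) : K k -> T \in elems_in k -> T' \in elems_in k ->
  i \in T -> j \in T' -> `|x i - x j| <= N%:R * Num.sqrt (cell_osc k).
Proof.
move=> Kk TE TE' iT jT'.
have /connectP[p pT E] := cell_connected Kk TE TE'.
move: E; case/shortenP: pT => q pq uq _ E.
have Hs U (u v : nodes) : U \in elems_in k -> u \in U -> v \in U -> `|x u - x v| <= Num.sqrt (cell_osc k).
  move=> UE uU vU; rewrite -sqrtr_sqr ler_wsqrtr// (le_trans (osc_ge uU vU))//.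
  by rewrite /cell_osc (bigD1 U)//= lerDl sumr_ge0// => V _; exact: osc_ge0.
have := path_oscillation Hs TE pq iT; rewrite -E => /(_ _ jT') /le_trans; apply.
rewrite ler_wpM2r ?sqrtr_ge0// ler_nat (leq_trans _ (card_elems_in k))//.
have -> : (size q).+1 = #|T :: q| by rewrite (card_uniqP uq).
apply: subset_leq_card; apply/fintype.subsetP => U; rewrite inE => /predU1P[->//|].
elim: q T TE {uq E TE' Hs iT} pq => // V q IH T TE /= /andP[/and3P[_ VE _] pV].
by rewrite inE => /predU1P[->//|]; exact: IH VE pV.
Qed.

(** Rows of cells run in the first coordinate direction. *)
Definition shift (k : cell) (l : nat) : cell :=
  fun i => if i == 0 then k i + l%:Z else k i.

Lemma shift0 k : shift k 0 = k.
Proof. by apply/funext => i; rewrite /shift; case: eqP => // _; rewrite addr0. Qed.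

Lemma shift_inj k k' l : shift k l = shift k' l -> k = k'.
Proof.
move=> E; apply/funext => i; have := congr1 (fun f => f i) E.
by rewrite /shift; case: eqP => // _ /addIr.
Qed.

Definition row_length : nat := (Num.truncn (2 * Bd / h)).+1.

Lemma row_leaves k : K k -> ~ K (shift k row_length).
Proof.
have hp := h0.
move=> Kk Kl; have := Om_bounded (center_Om Kk) 0; have := Om_bounded (center_Om Kl) 0.
rewrite !mxE /shift eqxx intrD !ler_norml => /andP[h1 h2] /andP[h3 h4].
have : 2 * Bd / h < (row_length%:Z)%:~R by exact: truncnS_gt.
by rewrite ltr_pdivrMr// => h5; nra.
Qed.

Definition lower_corner (k : cell) : pt := \row_i (a 0 i + h * (k i)%:~R).

Lemma lower_corner_node k : K k ->
  exists T j, [/\ T \in elems_in k, j \in T & node j = lower_corner k].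
Proof.
have hp := h0.
move=> Kk; apply: corner_node => // [i|i].
  by rewrite mxE step_right; apply/andP; split; lra.
by left=> y /(_ i) /andP[h1 _]; rewrite mxE.
Qed.

Lemma next_corner_node k l : K (shift k l) ->
  exists T j, [/\ T \in elems_in (shift k l), j \in T & node j = lower_corner (shift k l.+1)].
Proof.
have hp := h0.
move=> Kk.
have E i : lower_corner (shift k l.+1) 0 i =
    if i == 0 then a 0 i + h * (shift k l i + 1)%:~R else a 0 i + h * (shift k l i)%:~R.
  by rewrite mxE /shift; case: eqP => // _; rewrite -addrA -PoszD addn1.
apply: corner_node => // i; rewrite E.
  by case: ifP => _; rewrite step_right; apply/andP; split; lra.
case: ifP => _; first by right=> y /(_ i) /andP[].
by left=> y /(_ i) /andP[].
Qed.

Lemma corner_outside k : ~ K k -> ~ Om (lower_corner k).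
Proof.
have hp := h0.
move=> nK; case: conf => _ _ _ _ ->.
move=> /nbhs_ballP[e /= e0 eM].
pose d := Num.min e h / 2; have d0 : 0 < d by rewrite divr_gt0// lt_min e0.
have [de dh] : d < e /\ d < h.
  have m1 : Num.min e h <= e by rewrite ge_min lexx.
  have m2 : Num.min e h <= h by rewrite ge_min lexx orbT.
  by rewrite /d; split; lra.
have : mesh_region M (lower_corner k + const_mx d).
  apply: eM; apply/ballP; split=> // i; rewrite !mxE.
  by rewrite addrAC subrr add0r gtr0_norm.
rewrite region => -[k' Kk' k'p].
have kp : cell_interior k (lower_corner k + const_mx d).
  by move=> i; rewrite !mxE step_right; apply/andP; split; lra.
by apply: nK; rewrite (cell_interior_unique kp k'p).
Qed.

(** From a node one follows the row of its cell up to the boundary, where the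
    values vanish; consecutive cells of the row share a corner. *)
Lemma row_bound k T (i : nodes) : K k -> T \in elems_in k -> i \in T ->
  x i ^+ 2 <= N%:R ^+ 2 * row_length%:R * \sum_(l < row_length) cell_osc (shift k l).
Proof.
move=> Kk TE iT.
have exm : exists m, `[< ~ K (shift k m) >].
  by exists row_length; apply/asboolP/row_leaves.
case: (ex_minnP exm) => m /asboolP nKm minm.
have mL : (m <= row_length)%N by apply: minm; apply/asboolP/row_leaves.
have Kl l : (l < m)%N -> K (shift k l).
  move=> lm; apply: contrapT => nK; have := minm l; move/(_ (introT (asboolP _) nK)).
  by rewrite leqNgt lm.
have m0 : (0 < m)%N by rewrite lt0n; apply/eqP => E; apply: nKm; rewrite E shift0.
have [inj _ _ _ _] := conf.
have chain l : (l < m)%N -> exists T' j, [/\ T' \in elems_in (shift k l), j \in T',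
    node j = lower_corner (shift k l.+1) &
    `|x i - x j| <= \sum_(v < l.+1) N%:R * Num.sqrt (cell_osc (shift k v))].
  elim: l => [|l IH] lm.
    have [T' [j [TE' jT' nj]]] := next_corner_node (Kl 0%N lm).
    exists T', j; split=> //; rewrite big_ord1 shift0 in TE' *.
    exact: cell_oscillation TE TE' iT jT'.
  have [T' [j [TE' jT' nj xj]]] := IH (ltnW lm).
  have [U [u [UE uU nu]]] := lower_corner_node (Kl l.+1 lm).
  have ju : j = u by apply: inj; rewrite nj nu.
  have [V [v [VE vV nv]]] := next_corner_node (Kl l.+1 lm).
  exists V, v; split=> //; rewrite big_ord_recr/=.
  rewrite (_ : x i - x v = (x i - x j) + (x u - x v)); last by rewrite ju; ring.
  rewrite (le_trans (ler_normD _ _))// lerD//.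
  exact: cell_oscillation (Kl l.+1 lm) UE VE uU vV.
have [|T' [j [_ _ nj xj]]] := chain m.-1; first by rewrite prednK.
rewrite prednK// in nj xj.
have xj0 : x j = 0 by apply: x0; rewrite nj; exact: corner_outside.
rewrite xj0 subr0 in xj.
have : `|x i| <= \sum_(v < row_length) N%:R * Num.sqrt (cell_osc (shift k v)).
  apply: (le_trans xj).
  rewrite -!(big_mkord xpredT (fun v => N%:R * Num.sqrt (cell_osc (shift k v)))).
  rewrite [leRHS](@big_cat_nat _ _ _ m)//= lerDl.
  by apply: sumr_ge0 => v _; rewrite mulr_ge0 ?sqrtr_ge0.
move=> xi; rewrite -real_normK ?num_real//.
apply: (@le_trans _ _ ((\sum_(v < row_length) N%:R * Num.sqrt (cell_osc (shift k v))) ^+ 2)).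
  by rewrite ler_pXn2r ?nnegrE ?normr_ge0// (le_trans _ xi).
apply: (le_trans (sqr_sum_le _)).
rewrite -mulrA [leRHS]mulrCA ler_wpM2l// mulr_sumr; apply: ler_sum => v _.
by rewrite exprMn sqr_sqrtr// cell_osc_ge0.
Qed.

(** Summed over the nodes, [row_bound] charges an element at each of the
    [row_length] positions in a row for the nodes of a single cell. *)
Lemma poincare_rows : \sum_i x i ^+ 2 <=
  (4 * N ^ 3)%:R * row_length%:R ^+ 2 * \sum_(T in elems M) osc T.
Proof.
have [_ hasT c4 _ _] := conf.
have /choice[kap Hkap] : forall i : nodes, exists k, K k /\ exists2 T, T \in elems_in k & i \in T.
  move=> i; have [T TM iT] := hasT i; have [k Kk sT] := in_cell TM.
  by exists k; split=> //; exists T => //; apply/elems_inP.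
have bnd i : x i ^+ 2 <= N%:R ^+ 2 * row_length%:R * \sum_(l < row_length) cell_osc (shift (kap i) l).
  by have [Kk [T TE iT]] := Hkap i; exact: row_bound TE iT.
apply: (le_trans (ler_sum _ (fun i _ => bnd i))).
rewrite -mulr_sumr exchange_big/=.
pose I T l := [set i : nodes | T \in elems_in (shift (kap i) l)]%SET.
have cardI T l : T \in elems M -> (#|I T l| <= 4 * N)%N.
  move=> TM; have [I0|/set0Pn[i0]] := boolP (I T l == finset.set0)%SET.
    by rewrite (eqP I0) cards0.
  rewrite inE => T0.
  have same i : i \in I T l -> kap i = kap i0.
    rewrite inE => /elems_inP[_ sT]; move: T0 => /elems_inP[_ sT0].
    apply: (@shift_inj _ _ l).
    have [c cT] := (fat TM).1; have r0 : 0 < rho * h by exact: mulr_gt0.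
    have pm (e : R) w : `|e| = rho * h -> simplex T (c + e *: delta_mx 0 w).
      move=> er; apply: cT; rewrite /= addrAC subrr add0r enormZ er.
      rewrite (_ : enorm _ = 1) ?mulr1// unit_enorm// /dot (bigD1 w)//= mxE !eqxx mulr1.
      by rewrite big1 ?addr0// => j /negbTE ji; rewrite mxE ji andbF mul0r.
    apply: (@cell_interior_unique _ _ c); last by apply: sT0; apply: cT; rewrite /= subrr enorm0 ltW.
    move=> w; have := sT _ (pm (rho * h) w (gtr0_norm r0)) w.
    have := pm (- (rho * h)) w; rewrite normrN gtr0_norm// => /(_ erefl)/sT/(_ w).
    rewrite !mxE !eqxx /= !mulr1 => /andP[h1 h2] /andP[h3 h4].
    by apply/andP; split; lra.
  have IC : I T l \subset finset.cover (elems_in (kap i0)).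
    apply/fintype.subsetP => i /same E; have [_ [U UE iU]] := Hkap i.
    by apply/bigcupP; exists U; rewrite // -E.
  rewrite (leq_trans (subset_leq_card IC))// (leq_trans (leq_card_cover _))//.
  rewrite (eq_bigr (fun=> 4%N)); last by move=> U /elems_inP[UM _]; exact: c4.
  by rewrite sum_nat_const mulnC leq_mul2l card_elems_in.
have row l : \sum_i cell_osc (shift (kap i) l) <= (4 * N)%:R * \sum_(T in elems M) osc T.
  have -> : \sum_i cell_osc (shift (kap i) l) = \sum_(T in elems M) osc T * #|I T l|%:R.
    under eq_bigr => i _.
      rewrite /cell_osc (_ : \sum_(T in _) osc T = \sum_(T in elems M)
        if T \in elems_in (shift (kap i) l) then osc T else 0); last first.
        rewrite -big_mkcondr/=; apply: eq_bigl => T; rewrite [in LHS]inE.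
        by case: (boolP (T \in elems M)) => //= TM; rewrite inE TM.
      over.
    rewrite exchange_big/=; apply: eq_bigr => T _.
    rewrite -big_mkcond/= sumr_const -[LHS]mulr_natr; congr (_ * _%:R).
    by apply: eq_card => i; rewrite [in RHS]inE.
  rewrite mulr_sumr; apply: ler_sum => T TM; rewrite mulrC ler_wpM2r ?osc_ge0// ler_nat.
  exact: cardI.
apply: (@le_trans _ _ (N%:R ^+ 2 * row_length%:R *
    \sum_(l < row_length) (4 * N)%:R * \sum_(T in elems M) osc T)).
  by rewrite ler_wpM2l ?mulr_ge0 ?sqr_ge0//; apply: ler_sum => l _; exact: row.
rewrite sumr_const card_ord -[_ *+ _]mulr_natl !natrM.
by rewrite le_eqVlt; apply/orP; left; apply/eqP; ring.
Qed.

End Poincare.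

(** * Stability of the local immersed functions *)

Section LocalStability.
Variables (R : realType) (M : mesh R) (Om : set 'rV[R]_3) (rho h : R).
Local Notation pt := 'rV[R]_3.
Local Notation vset := {set 'I_(nnodes M)}.
Local Notation nodes := 'I_(nnodes M).
Hypothesis conf : conforming_mesh M Om.
Hypothesis cubic : subdivides_cubic_mesh M h.
Hypothesis fat : regular_elements M rho h.
Hypothesis rho0 : 0 < rho.
Hypothesis h0 : 0 < h.

Variables (T : vset) (k : nodes -> R) (G : nodes -> pt).
Hypotheses (TM : T \in elems M) (bT : bary T k G).

(* The two affine pieces, their values at the nodes, and the coefficient [c]
   of the jump of the gradient along the normal [n] of the plane through [q];
   [sg i] tells which piece takes the nodal value at [i]. *)
Variables (al : bool -> R) (be : bool -> pt) (x : nodes -> R) (sg : nodes -> bool).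
Variables (n q : pt) (c : R).
Hypothesis n1 : dot n n = 1.
Hypothesis jump_c : forall y, al true + dot (be true) y =
  al false + dot (be false) y + c * dot n (y - q).
Hypothesis nodal : forall i, i \in T -> al (sg i) + dot (be (sg i)) (node i) = x i.
Let d (i : nodes) := dot n (node i - q).
Hypothesis d_le : forall i, i \in T -> `|d i| <= 2 * h.
Let g : pt := \sum_(i in T) x i *: G i.
Let p : pt := \sum_(i in T | sg i) d i *: G i.
Let m : pt := \sum_(i in T | ~~ sg i) d i *: G i.

Lemma sum_elem (F : nodes -> R) (C : R) (Q : pred nodes) : 0 <= C ->
  (forall i, i \in T -> F i <= C) -> \sum_(i in T | Q i) F i <= 4 * C.
Proof.
move=> C0 FC; apply: (@le_trans _ _ (\sum_(i in T | Q i) C)).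
  by apply: ler_sum => i /andP[iT _]; exact: FC.
apply: (@le_trans _ _ (\sum_(i in T) C)).
  by rewrite [leRHS](bigID Q)/= lerDl sumr_ge0.
by rewrite sumr_const (card_elem conf TM) -[C *+ 4]mulr_natl.
Qed.

Lemma be_jump : be true = be false + c *: n.
Proof.
have E y : dot (be true) y = dot (be false + c *: n) y.
  have := jump_c y; have := jump_c 0.
  by rewrite !dotBr !dot0r dotDl dotZl; lra.
by apply/eqP; rewrite -subr_eq0; apply/eqP/dot_eq0; rewrite dotBl E subrr.
Qed.

Lemma affine_grad (a : R) (b : pt) : \sum_(i in T) (a + dot b (node i)) *: G i = b.
Proof.
under eq_bigr do rewrite scalerDl.
by rewrite big_split/= -scaler_sumr (sum_bary_grad bT) scaler0 add0r (bary_grad_expansion bT).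
Qed.

Lemma minus_grad : be false = g - c *: p.
Proof.
rewrite -[LHS](affine_grad (al false)) /g /p big_mkcondr/= scaler_sumr -sumrB.
apply: eq_bigr => i iT; rewrite -(nodal iT); case: (sg i).
  by rewrite jump_c -/(d i) scalerA -scalerBl addrK.
by rewrite scaler0 subr0.
Qed.

Lemma distance_grads : p + m = n.
Proof.
rewrite /p /m -bigID/=; under eq_bigr => i _ do rewrite /d dotBr scalerBl.
by rewrite sumrB -scaler_sumr (sum_bary_grad bT) scaler0 subr0 (bary_grad_expansion bT).
Qed.

(** Both parts [p], [m] of the normal, obtained from the nodes on either side
    of the plane, make an almost acute angle with it: the mixed products have
    the right sign because the elements have no obtuse dihedral angle. *)
Lemma distance_grads_obtuse (eta : R) : 0 <= eta ->
  (forall i, i \in T -> sg i -> - (eta * h) <= d i) ->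
  (forall i, i \in T -> ~~ sg i -> d i <= eta * h) ->
  - (8 * eta / rho ^+ 2) <= dot p m.
Proof.
move=> eta0 dp dm; have hp := h0; have rp := rho0.
have g0 : 0 < (2 * rho * h)^-1 by rewrite invr_gt0 !mulr_gt0.
have C0 : 0 <= 2 * eta * h ^+ 2 * (2 * rho * h)^-1 ^+ 2.
  by rewrite mulr_ge0 ?sqr_ge0// mulr_ge0 ?sqr_ge0// mulr_ge0.
have term i j : i \in T -> sg i -> j \in T -> ~~ sg j ->
    - dot (d i *: G i) (d j *: G j) <= 2 * eta * h ^+ 2 * (2 * rho * h)^-1 ^+ 2.
  move=> iT si jT sj; rewrite dotZl dotZr mulrA.
  have ij : i != j by apply: contraNneq sj => <-.
  have ob := bary_grad_obtuse conf fat TM bT iT jT ij.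
  have gi := bary_grad_le conf fat rho0 h0 TM bT iT.
  have gj := bary_grad_le conf fat rho0 h0 TM bT jT.
  have : `|dot (G i) (G j)| <= (2 * rho * h)^-1 ^+ 2.
    by rewrite (le_trans (dot_le_enorm _ _))// expr2 ler_pM// enorm_ge0.
  rewrite ler_norml => /andP[ob' _].
  have hdd : d i * d j <= 2 * eta * h ^+ 2.
    have := (d_le iT, d_le jT, dp i iT si, dm j jT sj) => -[[[]]].
    rewrite !ler_norml => /andP[a1 a2] /andP[a3 a4] a5 a6.
    have eh : 0 <= eta * h by rewrite mulr_ge0// ltW.
    have [di|di] := leP 0 (d i); have [dj|dj] := leP 0 (d j); nra.
  have [dd|dd] := leP 0 (d i * d j); last by nra.
  have : (d i * d j) * - dot (G i) (G j) <= (2 * eta * h ^+ 2) * (2 * rho * h)^-1 ^+ 2.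
    by apply: ler_pM => //; lra.
  by rewrite mulrN.
rewrite lerNl /p dot_suml -sumrN.
apply: (@le_trans _ _ (4 * (4 * (2 * eta * h ^+ 2 * (2 * rho * h)^-1 ^+ 2)))); last first.
  by rewrite le_eqVlt; apply/orP; left; apply/eqP; field; rewrite !gt_eqF.
have -> : \sum_(i in T | sg i) - dot (d i *: G i) m =
    \sum_(i in T | sg i) (if sg i then - dot (d i *: G i) m else 0).
  by apply: eq_bigr => i /andP[_ ->].
apply: sum_elem => [|i iT]; first by rewrite mulr_ge0.
case: ifPn => si; last by rewrite mulr_ge0.
rewrite /m dot_sumr -sumrN.
have -> : \sum_(j in T | ~~ sg j) - dot (d i *: G i) (d j *: G j) =
    \sum_(j in T | ~~ sg j) (if ~~ sg j then - dot (d i *: G i) (d j *: G j) else 0).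
  by apply: eq_bigr => j /andP[_ ->].
by apply: sum_elem => // j jT; case: ifP => // sj; exact: term.
Qed.

(** The flux condition turns into a scalar equation for the normal derivative,
    whose coefficient is a nearly convex combination of the two [beta]'s. *)
Lemma jump_coefficient_bound (eta bp bm : R) : 0 <= eta -> 0 < bp -> 0 < bm ->
  (forall i, i \in T -> sg i -> - (eta * h) <= d i) ->
  (forall i, i \in T -> ~~ sg i -> d i <= eta * h) ->
  bp * dot (be true) n = bm * dot (be false) n ->
  8 * eta / rho ^+ 2 * Num.max bp bm <= Num.min bp bm / 2 ->
  `|c| <= 2 * (Num.max bp bm / Num.min bp bm) ^+ 2 * enorm g.
Proof.
move=> eta0 bp0 bm0 dp dm flux small.
have pm := distance_grads_obtuse eta0 dp dm.
have mn := distance_grads.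
pose S := dot p n; pose t := dot (be false) n; set mx := Num.max bp bm; set mi := Num.min bp bm.
have mi0 : 0 < mi by rewrite lt_min bp0.
have [mip mim] : mi <= bp /\ mi <= bm by rewrite /mi !ge_min !lexx orbT.
have [mxp mxm] : bp <= mx /\ bm <= mx by rewrite /mx !le_max !lexx orbT.
have mx0 : 0 < mx by lra.
set dl := 8 * eta / rho ^+ 2 in pm small; have dl0 : 0 <= dl.
  by rewrite divr_ge0 ?sqr_ge0// mulr_ge0.
have S0 : - dl <= S by rewrite /S -mn dotDr; have := dot_ge0 p; lra.
have S1 : - dl <= 1 - S.
  have -> : 1 - S = dot m n by rewrite /S -n1 -{1}mn dotDl addrC addKr.
  by rewrite -mn dotDr (dotC m p); have := dot_ge0 m; lra.
have flux' : bp * (t + c) = bm * t.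
  by rewrite /t -flux be_jump dotDl dotZl n1 mulr1.
have tE : t = dot g n - c * S.
  by rewrite /t minus_grad dotBl dotZl.
pose kappa := bp * (1 - S) + bm * S.
have kappa_ge : mi / 2 <= kappa.
  have dev (u : R) : 0 <= u -> u <= dl -> u * mx <= mi / 2.
    by move=> u0 ud; apply: le_trans small; rewrite ler_wpM2r// ltW.
  have [S2|S2] := leP S 0.
    have u0 : 0 <= - S by rewrite oppr_ge0.
    have := dev (- S) u0; rewrite lerNl S0 => /(_ isT) h1.
    have : - S * (bm - bp) <= - S * mx by rewrite ler_wpM2l//; lra.
    by rewrite /kappa; lra.
  have [S3|S3] := leP S 1.
    have : mi * (1 - S) <= bp * (1 - S) by rewrite ler_wpM2r// subr_ge0.
    have : mi * S <= bm * S by rewrite ler_wpM2r// ltW.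
    by rewrite /kappa; lra.
  have u0 : 0 <= S - 1 by rewrite subr_ge0 ltW.
  have := dev (S - 1) u0; rewrite (_ : S - 1 <= dl); last by lra.
  move=> /(_ isT) h1.
  have : (S - 1) * (bp - bm) <= (S - 1) * mx by rewrite ler_wpM2l//; lra.
  by rewrite /kappa; lra.
have tk : t * kappa = bp * dot g n.
  have -> : t * kappa = bp * t + (bm * t - bp * t) * S by rewrite /kappa; ring.
  by rewrite -flux' tE; ring.
have tb : `|t| <= 2 * (mx / mi) * enorm g.
  have : `|t| * kappa <= mx * enorm g.
    rewrite -[X in _ * X](gtr0_norm (_ : 0 < kappa)); last by lra.
    rewrite -normrM tk normrM gtr0_norm// ler_pM ?(ltW bp0)//.
    by have := dot_le_enorm g n; rewrite (unit_enorm n1) mulr1.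
  have t1 : `|t| * (mi / 2) <= `|t| * kappa by rewrite ler_wpM2l.
  move=> t2; have -> : 2 * (mx / mi) * enorm g = mx * enorm g / (mi / 2).
    by field; rewrite gt_eqF.
  by rewrite ler_pdivlMr ?divr_gt0//; exact: le_trans t2.
have cE : bp * c = (bm - bp) * t by have := flux'; lra.
have cb : `|c| * mi <= mx * `|t|.
  apply: (@le_trans _ _ (`|c| * bp)); first by rewrite ler_wpM2l.
  rewrite -[X in _ * X <= _](gtr0_norm bp0) -normrM mulrC cE normrM ler_wpM2r//.
  by rewrite ler_norml; apply/andP; split; lra.
have -> : 2 * (mx / mi) ^+ 2 * enorm g = mx * (2 * (mx / mi) * enorm g) / mi.
  by field; rewrite gt_eqF.
by rewrite ler_pdivlMr// (le_trans cb)// ler_wpM2l// ltW.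
Qed.

Variables (B X : R).
Hypotheses (B1 : 1 <= B) (X0 : 0 <= X).
Hypothesis xX : forall i, i \in T -> `|x i| <= X.
Hypothesis c_minus : `|c| <= B * enorm (be false).
Hypothesis c_plus : `|c| <= B ^+ 2 * enorm (be true).
Hypothesis c_g : `|c| <= 2 * B ^+ 2 * enorm g.

Lemma g_bound : enorm g <= 2 * X / (rho * h).
Proof.
have hp := h0; have rp := rho0; have xp := X0.
apply: (le_trans (enorm_sum _ _ _)).
have C0 : 0 <= X * (2 * rho * h)^-1 by rewrite mulr_ge0// invr_ge0 !mulr_ge0// ltW.
have -> : \sum_(i in T) enorm (x i *: G i) = \sum_(i in T | predT i) enorm (x i *: G i).
  by apply: eq_bigl => i; rewrite andbT.
apply: (@le_trans _ _ (4 * (X * (2 * rho * h)^-1))); last first.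
  by rewrite le_eqVlt; apply/orP; left; apply/eqP; field; rewrite !gt_eqF.
apply: sum_elem => // i iT; rewrite enormZ ler_pM ?enorm_ge0//; first exact: xX.
exact: (bary_grad_le conf fat rho0 h0 TM bT iT).
Qed.

Lemma p_bound : enorm p <= 4 / rho.
Proof.
have hp := h0; have rp := rho0.
apply: (le_trans (enorm_sum _ _ _)).
apply: (@le_trans _ _ (4 * (2 * h * (2 * rho * h)^-1))); last first.
  by rewrite le_eqVlt; apply/orP; left; apply/eqP; field; rewrite !gt_eqF.
apply: sum_elem => [|i iT]; first by rewrite mulr_ge0 ?invr_ge0 ?mulr_ge0// ltW.
rewrite enormZ ler_pM ?enorm_ge0//; first exact: d_le.
exact: (bary_grad_le conf fat rho0 h0 TM bT iT).
Qed.

Lemma jump_bound : `|c| <= 4 * B ^+ 2 * X / (rho * h).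
Proof.
apply: (le_trans c_g).
have -> : 4 * B ^+ 2 * X / (rho * h) = 2 * B ^+ 2 * (2 * X / (rho * h)) by ring.
by rewrite ler_wpM2l ?g_bound// pmulr_rge0// sqr_ge0.
Qed.

Lemma gradient_bound s : enorm (be s) <= (2 + 16 * B ^+ 2 / rho + 4 * B ^+ 2) / rho * X / h.
Proof.
have hp := h0; have rp := rho0; have xp := X0.
have r1 : 0 < rho * h by rewrite mulr_gt0.
have b1 : enorm (be false) <= 2 * X / (rho * h) + 4 * B ^+ 2 * X / (rho * h) * (4 / rho).
  rewrite minus_grad (le_trans (enormB _ _))// lerD ?g_bound// enormZ ler_pM ?enorm_ge0//.
    exact: jump_bound.
  exact: p_bound.
have b2 : enorm (be true) <= enorm (be false) + 4 * B ^+ 2 * X / (rho * h).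
  by rewrite be_jump (le_trans (enormD _ _))// lerD// enormZ (unit_enorm n1) mulr1 jump_bound.
have -> : (2 + 16 * B ^+ 2 / rho + 4 * B ^+ 2) / rho * X / h =
    2 * X / (rho * h) + 4 * B ^+ 2 * X / (rho * h) * (4 / rho) + 4 * B ^+ 2 * X / (rho * h).
  by field; rewrite !gt_eqF.
have : 0 <= 4 * B ^+ 2 * X / (rho * h).
  by rewrite divr_ge0 ?(ltW r1)// mulr_ge0// pmulr_rge0// sqr_ge0.
by case: s; lra.
Qed.

Lemma value_bound s y : simplex T y -> `|al s + dot (be s) y| <= (1 + 8 * B ^+ 2 / rho) * X.
Proof.
move=> Ty; have hp := h0; have rp := rho0; have xp := X0.
have nodeb i : i \in T -> `|al s + dot (be s) (node i)| <= (1 + 8 * B ^+ 2 / rho) * X.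
  move=> iT.
  have cd : `|c * d i| <= 8 * B ^+ 2 / rho * X.
    have -> : 8 * B ^+ 2 / rho * X = 4 * B ^+ 2 * X / (rho * h) * (2 * h).
      by field; rewrite !gt_eqF.
    by rewrite normrM ler_pM// ?jump_bound// d_le.
  have cd0 : 0 <= 8 * B ^+ 2 / rho * X by rewrite (le_trans _ cd).
  have xi := xX iT; rewrite mulrDl mul1r.
  have := nodal iT; have := jump_c (node i); rewrite -/(d i).
  move: cd xi; rewrite !ler_norml => /andP[a1 a2] /andP[a3 a4] e1.
  by case: (s); case: (sg i) => e2; apply/andP; split; lra.
have Ly := (simplex_bary bT y).1 Ty.
have -> : al s + dot (be s) y = \sum_(i in T) (k i + dot (G i) y) * (al s + dot (be s) (node i)).
  under eq_bigr do rewrite mulrDr.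
  rewrite big_split/= -mulr_suml (bary_sum1 bT) mul1r -[in LHS](bary_point bT y) dot_sumr.
  by congr (_ + _); apply: eq_bigr => i _; rewrite dotZr.
rewrite (le_trans (ler_norm_sum _ _ _))//.
have -> : (1 + 8 * B ^+ 2 / rho) * X =
    \sum_(i in T) (k i + dot (G i) y) * ((1 + 8 * B ^+ 2 / rho) * X).
  by rewrite -mulr_suml (bary_sum1 bT) mul1r.
apply: ler_sum => i iT.
rewrite normrM (ger0_norm (Ly i iT)); apply: ler_wpM2l; first exact: Ly.
exact: nodeb.
Qed.

Lemma gradients_equivalent s s' : enorm (be s) <= (1 + B ^+ 2) * enorm (be s').
Proof.
have b1 := B1; have n' := unit_enorm n1.
have [t0 f0] := (enorm_ge0 (be true), enorm_ge0 (be false)).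
have tf : enorm (be true) <= enorm (be false) + `|c|.
  by rewrite be_jump (le_trans (enormD _ _))// enormZ n' mulr1.
have ft : enorm (be false) <= enorm (be true) + `|c|.
  have -> : be false = be true - c *: n by rewrite be_jump addrK.
  by rewrite (le_trans (enormB _ _))// enormZ n' mulr1.
have cm := c_minus; have cp := c_plus.
have B2 : B <= B ^+ 2 by nra.
have BB : B * enorm (be false) <= B ^+ 2 * enorm (be false) by rewrite ler_wpM2r.
have s2 u : 0 <= B ^+ 2 * enorm (be u) by rewrite mulr_ge0 ?enorm_ge0// sqr_ge0.
have := (s2 true, s2 false) => -[].
by case: s; case: s'; lra.
Qed.

Lemma nodal_differences i j : i \in T -> j \in T ->
  (x i - x j) ^+ 2 <= ((2 + 4 * B) * h * enorm (be false)) ^+ 2.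
Proof.
move=> iT jT; have hp := h0; have b1 := B1; have f0 := enorm_ge0 (be false).
rewrite -real_normK ?num_real// ler_pXn2r ?nnegrE ?mulr_ge0//; [|lra..].
pose u v := if sg v then c * d v else 0.
have xE v : v \in T -> x v = al false + dot (be false) (node v) + u v.
  by move=> vT; rewrite -(nodal vT) /u; case: (sg v); rewrite ?jump_c ?addr0.
have ub v : v \in T -> `|u v| <= B * enorm (be false) * (2 * h).
  move=> vT; rewrite /u; case: ifP => _; last by rewrite normr0 !mulr_ge0//; lra.
  by rewrite normrM ler_pM// d_le.
rewrite (xE i iT) (xE j jT).
rewrite (_ : _ - _ = dot (be false) (node i - node j) + (u i - u j)); last by rewrite dotBr; ring.
apply: (le_trans (ler_normD _ _)).
have := ler_normB (u i) (u j); have := ub i iT; have := ub j jT.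
have : `|dot (be false) (node i - node j)| <= enorm (be false) * (2 * h).
  rewrite (le_trans (dot_le_enorm _ _))// ler_wpM2l//.
  by apply: (elem_diam cubic TM); exact: node_simplex.
by lra.
Qed.

End LocalStability.

(** * Piecewise affine data of immersed functions *)

Local Notation cut := (@Defs.cut _ _).

Section Data.
Variables (R : realType) (P : interface R).
Local Notation pt := 'rV[R]_3.
Hypothesis HP : interface_problem P.

Definition beta_side (s : bool) : R := if s then beta_p P else beta_m P.

Section OnMesh.
Variables (M : mesh R) (rho h : R).
Local Notation vset := {set 'I_(nnodes M)}.
Local Notation nodes := 'I_(nnodes M).
Hypothesis conf : conforming_mesh M (Omega P).
Hypothesis cubic : subdivides_cubic_mesh M h.
Hypothesis fat : regular_elements M rho h.
Hypothesis rho0 : 0 < rho.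
Hypothesis h0 : 0 < h.
Variable D : vset -> 'I_3 -> pt.

Definition piece (T : vset) (s : bool) : set pt := open_simplex T `&` side P s.

Definition represents (v : pt -> R) (al : bool -> vset -> R) (be : bool -> vset -> pt) :=
  forall T s y, T \in elems M -> piece T s y -> v y = al s T + dot (be s T) y.

(** The conditions that an immersed function with nodal values [x] imposes on
    its affine pieces; they are linear in [(x, al, be)]. *)
Record ife_data (x : nodes -> R) (al : bool -> vset -> R) (be : bool -> vset -> pt) :
    Prop := IfeData {
  ife_uncut : forall T, T \in elems M -> ~ cut (Gamma P) T ->
    al true T = al false T /\ be true T = be false T;
  ife_continuous : forall T, T \in elems M -> cut (Gamma P) T -> forall i,
    al true T + dot (be true T) (D T i) = al false T + dot (be false T) (D T i);
  ife_flux : forall T, T \in elems M -> cut (Gamma P) T ->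
    forall m, unit_normal m (range (D T)) ->
    beta_p P * dot (be true T) m = beta_m P * dot (be false T) m;
  ife_nodal : forall T, T \in elems M -> forall j s, j \in T ->
    closure (piece T s) (node j) -> al s T + dot (be s T) (node j) = x j }.

Lemma piece_smooth T s : T \in elems M -> piece T s `<=` smooth_region P M.
Proof.
move=> TM y [Ty sy]; exists T => //; split=> //.
by have [] := side_Omega HP sy.
Qed.

(** Continuity at a node passes to the limit in every piece that accumulates
    there. *)
Lemma limit_at_node (v : pt -> R) (a : R) (b : pt) T s (j : nodes) : T \in elems M ->
  v y @[y --> within (smooth_region P M) (nbhs (node j))] --> v (node j) ->
  (forall y, piece T s y -> v y = a + dot b y) ->
  closure (piece T s) (node j) -> a + dot b (node j) = v (node j).
Proof.
move=> TM vj vE cl; apply/eqP; apply: contraT => ne.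
set p := a + dot b (node j) in ne *.
pose e := `|p - v (node j)| / 2; have e0 : 0 < e by rewrite divr_gt0// normr_gt0 subr_eq0.
have n1 : \forall y \near (node j), smooth_region P M y -> `|v (node j) - v y| < e.
  exact: (vj _ (nbhsx_ballx (v (node j)) e e0)).
have n2 : \forall y \near (node j), `|p - (a + dot b y)| < e.
  exact: (@affine_continuous R a b (node j) _ (nbhsx_ballx p e e0)).
have [y [py [h1 h2]]] := cl _ (filterI n1 n2).
have := h1 (piece_smooth TM py); rewrite (vE y py) => h3.
have : `|p - v (node j)| < e + e.
  rewrite (_ : p - _ = (p - (a + dot b y)) - (v (node j) - (a + dot b y))); last by ring.
  by rewrite (le_lt_trans (ler_normB _ _))// ltrD.
by rewrite /e -splitr ltxx.
Qed.

Lemma IFE_space_data v : IFE_space P D v -> exists al be,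
  represents v al be /\ ife_data (fun j => v (node j)) al be.
Proof.
move=> [hu hc hn _].
have /choice[d Hd] : forall T : vset, exists d : (R * pt) * (R * pt), T \in elems M ->
    [/\ forall y, piece T false y -> v y = d.1.1 + dot d.1.2 y,
        forall y, piece T true y -> v y = d.2.1 + dot d.2.2 y,
        ~ cut (Gamma P) T -> d.1 = d.2,
        cut (Gamma P) T -> forall i, d.2.1 + dot d.2.2 (D T i) = d.1.1 + dot d.1.2 (D T i) &
        cut (Gamma P) T -> forall m, unit_normal m (range (D T)) ->
          beta_p P * dot d.2.2 m = beta_m P * dot d.1.2 m].
  move=> T; have [TM|_] := boolP (T \in elems M); last by exists ((0, 0), (0, 0)).
  have [cT|nT] := pselect (cut (Gamma P) T).
    have [am [ap [bm [bp [h1 h2 h3 h4]]]]] := hc T TM cT.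
    by exists ((am, bm), (ap, bp)) => _; split=> //= y [Ty sy]; [exact: h1|exact: h2].
  have [a [b hab]] := hu T TM nT.
  by exists ((a, b), (a, b)) => _; split=> //= y [Ty _]; exact: hab.
exists (fun s T => if s then (d T).2.1 else (d T).1.1),
  (fun s T => if s then (d T).2.2 else (d T).1.2).
have rep : represents v (fun s T => if s then (d T).2.1 else (d T).1.1)
    (fun s T => if s then (d T).2.2 else (d T).1.2).
  by move=> T s y TM; have [h1 h2 _ _ _] := Hd T TM; case: s; [exact: h2|exact: h1].
split=> //; split=> T TM.
- by have [_ _ h3 _ _] := Hd T TM; move=> /h3 ->.
- by have [_ _ _ h4 _] := Hd T TM; exact: h4.
- by have [_ _ _ _ h5] := Hd T TM; exact: h5.
- move=> j s jT; apply: (limit_at_node TM (hn j)) => y; exact: rep.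
Qed.

Lemma ife_data_sum (I : finType) (c : I -> R) (x : I -> nodes -> R) al be :
  (forall i, ife_data (x i) (al i) (be i)) ->
  ife_data (fun j => \sum_i c i * x i j) (fun s T => \sum_i c i * al i s T)
    (fun s T => \sum_i c i *: be i s T).
Proof.
move=> H.
have E a (b : I -> pt) y : \sum_i c i * a i + dot (\sum_i c i *: b i) y =
    \sum_i c i * (a i + dot (b i) y).
  rewrite dot_suml -big_split/=; apply: eq_bigr => i _.
  by rewrite dotZl mulrDr.
split=> T TM.
- move=> nT; split; apply: eq_bigr => i _;
  by have [e1 e2] := ife_uncut (H i) TM nT; rewrite ?e1 ?e2.
- by move=> cT u; rewrite !E; apply: eq_bigr => i _; rewrite (ife_continuous (H i)).
- move=> cT m hm; rewrite !dot_suml !mulr_sumr; apply: eq_bigr => i _.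
  by rewrite !dotZl !(mulrCA _ (c i)) (ife_flux (H i)).
- by move=> j s jT cl; rewrite E; apply: eq_bigr => i _; rewrite (ife_nodal (H i)).
Qed.

Lemma open_simplex_Omega T : T \in elems M -> open_simplex T `<=` Omega P.
Proof.
move=> TM y Ty; case: conf => _ _ _ _ ->.
have [k [G bT]] := elem_bary conf fat rho0 h0 TM.
have : nbhs y (open_simplex T) by apply: open_nbhs_nbhs; split => //; exact: (open_simplex_open bT).
by apply: filterS => z Tz; exists T => //; exact: (open_simplex_sub bT).
Qed.

(** The interface is in the closure of both sides, hence has no interior: some
    piece accumulates at each node and takes the nodal value. *)
Lemma node_in_piece_closure T j : T \in elems M -> j \in T ->
  exists s, closure (piece T s) (node j).
Proof.
move=> TM jT; apply: contrapT => nc.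
have [k [G bT]] := elem_bary conf fat rho0 h0 TM.
have avoid s : \forall y \near (node j), ~ piece T s y.
  have : ~ closure (piece T s) (node j) by move=> cl; apply: nc; exists s.
  move=> /existsNP[U /not_implyP[NU nU]]; apply: filterS NU => y Uy sy.
  by apply: nU; exists y.
have : \forall y \near (node j), ~ piece T true y /\ ~ piece T false y.
  by have := avoid true; have := avoid false; apply: filterS2 => y h1 h2; split.
move=> /nbhs_ballP[e /= e0 He].
have [c cT] := (fat TM).1.
have Tc : open_simplex T c.
  apply/(open_simplex_bary bT) => i iT; apply: (bary_interior_ball conf TM bT cT iT).
  by rewrite subrr enorm0 mulr_gt0.
pose t := Num.min 1 (e / (2 * (enorm (c - node j) + 1))).
have n0 := enorm_ge0 (c - node j).
have t0 : 0 < t by rewrite lt_min ltr01 divr_gt0// mulr_gt0// ltr_wpDl.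
pose z := node j + t *: (c - node j).
have Tz : open_simplex T z.
  by apply: (simplex_ray bT) => //; [exact: node_simplex|rewrite /t ge_min lexx].
have ez : ball (node j) e z.
  apply: ball_enorm => //; rewrite /z addrAC subrr add0r enormZ gtr0_norm//.
  apply: (@le_lt_trans _ _ (e / (2 * (enorm (c - node j) + 1)) * enorm (c - node j))).
    by rewrite ler_wpM2r// /t ge_min lexx orbT.
  have p0 : 0 < 2 * (enorm (c - node j) + 1) by lra.
  by rewrite mulrAC ltr_pdivrMr// ltr_pM2l//; lra.
have [nt nf] := He z ez.
have Oz := open_simplex_Omega TM Tz.
have [Gz|nGz] := pselect (Gamma P z); last first.
  by have [[] sz] := side_cover HP Oz nGz; [apply: nt|apply: nf].
have : (side P true `&` (open_simplex T `&` ball (node j) e)) !=set0.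
  apply: (Gamma_closure HP true Gz); apply: filterI.
    by apply: open_nbhs_nbhs; split => //; exact: (open_simplex_open bT).
  by apply: open_nbhs_nbhs; split => //; exact: ball_open.
by move=> [w [sw [Tw ew]]]; have [nw _] := He w ew; apply: nw.
Qed.

End OnMesh.
End Data.

(** * Estimates uniform in the position of the interface *)

Section Uniform.
Variables (R : realType) (P : interface R).
Local Notation pt := 'rV[R]_3.
Hypothesis HP : interface_problem P.

Section CutElement.
Variables (M : mesh R) (rho h : R).
Local Notation vset := {set 'I_(nnodes M)}.
Local Notation nodes := 'I_(nnodes M).
Hypothesis conf : conforming_mesh M (Omega P).
Hypothesis cubic : subdivides_cubic_mesh M h.
Hypothesis fat : regular_elements M rho h.
Hypothesis rho0 : 0 < rho.
Hypothesis h0 : 0 < h.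
Variable D : vset -> 'I_3 -> pt.

Lemma elem_in_ball (T : vset) q y : T \in elems M -> simplex T q -> simplex T y -> ball q (2 * h) y.
Proof.
move=> TM Tq Ty; have hp := h0; apply/ballP; split; first by rewrite mulr_gt0.
by move=> i; have := elem_coord_diam cubic i TM Ty Tq; lra.
Qed.

Lemma edge_point_simplex (T : vset) p : edge_points (Gamma P) T p -> Gamma P p /\ simplex T p.
Proof. by move=> [Gp [E [_ ET] Ep]]; split=> //; exact: simplex_subset ET _ Ep. Qed.

(** The plane through the three interface points has a normal close to the
    normal [n] of the interface, so the nodes of a piece lie on the right side of
    it, up to a small multiple of [h]. *)
Lemma cut_plane (e K : R) (T : vset) q : T \in elems M -> 0 <= e -> 0 <= K -> K * e <= 2^-1 ->
  flat_at P e (2 * h) q -> simplex T q ->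
  (forall i, edge_points (Gamma P) T (D T i)) ->
  (exists m, unit_normal m (range (D T))) ->
  (forall m n e z, unit_normal m (range (D T)) -> 0 <= e ->
    (forall i j, `|dot n (D T i - D T j)| <= e * enorm (D T i - D T j)) ->
    `|dot n z - dot n m * dot m z| <= K * e * enorm z) ->
  exists m, unit_normal m (range (D T)) /\ forall j s, j \in T ->
    closure (piece P T s) (node j) ->
    - (4 * (1 + K) * e * h) <= sign_of R s * dot m (node j - D T 0).
Proof.
move=> TM e0 K0 Ke [_ [n [n1 Hn]]] Tq DT [m0 m0D] stab; have hp := h0.
have DTs i := edge_point_simplex (DT i).
have inb y : simplex T y -> ball q (2 * h) y by exact: elem_in_ball.
have nD i j : `|dot n (D T i - D T j)| <= e * enorm (D T i - D T j).
  have [[Gi Ti] [Gj Tj]] := (DTs i, DTs j).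
  by have [H _] := Hn _ _ (inb _ Ti) (inb _ Tj) Gj; exact: H.
have m1 m : unit_normal m (range (D T)) -> dot m m = 1.
  by move=> [mm _]; rewrite -sqr_enorm mm expr1n.
have [m [mD gam]] : exists m, unit_normal m (range (D T)) /\ 2^-1 <= dot n m.
  have g2 : 2^-1 <= dot n m0 ^+ 2.
    have := stab m0 n e n m0D e0 nD.
    rewrite n1 (unit_enorm n1) mulr1 (dotC m0 n) ler_norml => /andP[_ h1].
    by rewrite expr2; lra.
  have [gp|gn] := leP 0 (dot n m0).
    by exists m0; split=> //; rewrite leNgt; apply/negP => h1; nra.
  exists (- m0); split; last by rewrite dotNr leNgt; apply/negP => h1; nra.
  by case: m0D => mm mo; split; [rewrite enormN|move=> u v Du Dv; rewrite dotNl mo ?oppr0].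
exists m; split=> // j s jT cl.
have [G0 T0] := DTs 0.
have Tj := node_simplex jT.
pose z := node j - D T 0.
have ez : enorm z <= 2 * h by exact: (elem_diam cubic TM).
have nz : - (e * (2 * h)) <= sign_of R s * dot n z.
  pose S := [set y : pt | - (e * (2 * h)) <= sign_of R s * dot n (- D T 0) + dot (sign_of R s *: n) y].
  have cS : closed S.
    apply: (@closed_comp _ _ (fun y : pt => sign_of R s * dot n (- D T 0) + dot (sign_of R s *: n) y)
      [set u | - (e * (2 * h)) <= u]); last exact: closed_ge.
    by move=> y _; exact: affine_continuous.
  have sub : piece P T s `<=` S.
    move=> y [Ty sy]; have [k [G bT]] := elem_bary conf fat rho0 h0 TM.
    have Ty' := open_simplex_sub bT Ty.
    have [_ /(_ s sy)] := Hn _ _ (inb _ Ty') (inb _ T0) G0.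
    rewrite /S/= dotZl -mulrDr -dotDr [- _ + y]addrC; apply: le_trans.
    by rewrite lerN2 ler_wpM2l// (elem_diam cubic TM).
  have : S (node j) by have := closure_subset sub cl; rewrite -((closure_id S).1 cS).
  by rewrite /S/= dotZl -mulrDr -dotDr [- _ + _]addrC.
have := stab m n e z mD e0 nD; rewrite ler_norml => /andP[h1 h2].
have Kz : K * e * enorm z <= K * e * (2 * h) by rewrite ler_wpM2l// mulr_ge0.
have main : - (2 * (1 + K) * e * h) <= dot n m * (sign_of R s * dot m z).
  by rewrite -/z mulrCA; move: nz; case: (s); rewrite /= ?mul1r ?mulN1r; nra.
rewrite leNgt; apply/negP => h3.
have E0 : 0 <= (1 + K) * e * h by rewrite !mulr_ge0 ?addr_ge0 ?ler01// ltW.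
have : dot n m * (sign_of R s * dot m z) <= 2^-1 * (sign_of R s * dot m z).
  by apply: ler_wnM2r => //; rewrite /z; lra.
by rewrite /z; lra.
Qed.

End CutElement.
End Uniform.

Section LocalEstimates.
Variables (R : realType) (P : interface R).
Local Notation pt := 'rV[R]_3.
Hypothesis HP : interface_problem P.

Lemma beta_gt0 s : 0 < beta_side P s.
Proof. by case: HP => _ _ _ [bm bp]; case: s. Qed.

(** Stability on one element, with a constant that does not see how the interface
    cuts it; [X] is meant to bound the nodal values. *)
Record local_estimate (M : mesh R) (h C : R) (T : {set 'I_(nnodes M)})
    (x : 'I_(nnodes M) -> R) (al : bool -> R) (be : bool -> pt) (X : R) : Prop :=
  LocalEstimate {
  le_gradient : forall s, enorm (be s) <= C * X / h;
  le_value : forall s y, simplex T y -> `|al s + dot (be s) y| <= C * X;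
  le_gradient_sides : forall s s', enorm (be s) <= C * enorm (be s');
  le_nodal_difference : forall i j, i \in T -> j \in T ->
    (x i - x j) ^+ 2 <= (C * h * enorm (be false)) ^+ 2 }.

Let mx := Num.max (beta_p P) (beta_m P).
Let mi := Num.min (beta_p P) (beta_m P).
Let B := mx / mi.

Definition stability_constant (rho : R) : R :=
  (2 + 16 * B ^+ 2 / rho + 4 * B ^+ 2) / rho + (1 + 8 * B ^+ 2 / rho) +
  (1 + B ^+ 2) + (2 + 4 * B).

Section OneElement.
Variables (M : mesh R) (rho theta h e K : R).
Local Notation vset := {set 'I_(nnodes M)}.
Local Notation nodes := 'I_(nnodes M).
Hypothesis conf : conforming_mesh M (Omega P).
Hypothesis cubic : subdivides_cubic_mesh M h.
Hypothesis fat : regular_elements M rho h.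
Hypothesis rho0 : 0 < rho.
Hypothesis h0 : 0 < h.
Variable D : vset -> 'I_3 -> pt.
Hypothesis points : interface_points (Gamma P) theta D.
Hypothesis plane : forall E : 'I_3 -> pt, injective E ->
  (forall i j k, uniq [:: i; j; k] -> angle (E j - E i) (E k - E i) <= theta) ->
  [/\ exists m, unit_normal m (range E),
      forall m w, unit_normal m (range E) ->
        (forall i j, dot w (E i - E j) = 0) -> w = dot w m *: m &
      forall m n e z, unit_normal m (range E) -> 0 <= e ->
        (forall i j, `|dot n (E i - E j)| <= e * enorm (E i - E j)) ->
        `|dot n z - dot n m * dot m z| <= K * e * enorm z].
Hypotheses (e0 : 0 <= e) (K0 : 0 <= K) (Ke : K * e <= 2^-1).
Hypothesis small : 8 * (4 * (1 + K) * e) / rho ^+ 2 * mx <= mi / 2.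
Hypothesis flat : forall q, Gamma P q -> flat_at P e (2 * h) q.

Lemma mi_gt0 : 0 < mi.
Proof. by rewrite lt_min (beta_gt0 true) (beta_gt0 false). Qed.

Lemma B_ge1 : 1 <= B.
Proof.
by rewrite /B ler_pdivlMr ?mi_gt0// mul1r /mi /mx ge_min !le_max !lexx /=.
Qed.

Lemma stability_constant_ge0 : [/\ 0 <= (2 + 16 * B ^+ 2 / rho + 4 * B ^+ 2) / rho,
  0 <= 1 + 8 * B ^+ 2 / rho, 0 <= 1 + B ^+ 2 & 0 <= 2 + 4 * B].
Proof.
have b := B_ge1; have rp := rho0.
have b2 : 0 <= B ^+ 2 by exact: sqr_ge0.
have b3 : 0 <= 16 * B ^+ 2 / rho by apply: divr_ge0; [lra|exact: ltW].
have b4 : 0 <= 8 * B ^+ 2 / rho by apply: divr_ge0; [lra|exact: ltW].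
by split; [apply: divr_ge0; [lra|exact: ltW]|lra..].
Qed.

(** The flux condition controls the jump by the normal derivative on either
    side. *)
Lemma jump_c_bounds (bt bf n : pt) (c : R) : dot n n = 1 -> bt = bf + c *: n ->
  beta_p P * dot bt n = beta_m P * dot bf n ->
  `|c| <= B * enorm bf /\ `|c| <= B ^+ 2 * enorm bt.
Proof.
move=> n1 E fl; have b1 := B_ge1; have m0 := mi_gt0.
have [bp bm] := (beta_gt0 true, beta_gt0 false); rewrite /= in bp bm.
have [ip im] : mi <= beta_p P /\ mi <= beta_m P by rewrite /mi !ge_min !lexx orbT.
have [xp xm] : beta_p P <= mx /\ beta_m P <= mx by rewrite /mx !le_max !lexx orbT.
have tt : dot bt n = dot bf n + c by rewrite E dotDl dotZl n1 mulr1.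
have key (u w t : R) : mi <= u -> w <= mx -> u <= mx -> 0 < w ->
    u * c = (w - u) * t -> `|c| <= B * `|t|.
  move=> h1 h2 h3 h4 h5; rewrite /B mulrAC ler_pdivlMr//.
  apply: (@le_trans _ _ (`|c| * u)); first by rewrite ler_wpM2l.
  have u0 : 0 < u by lra.
  rewrite -[X in _ * X <= _](gtr0_norm u0) -normrM mulrC h5 normrM ler_wpM2r//.
  by rewrite ler_norml; apply/andP; split; lra.
have n' := unit_enorm n1.
split.
  apply: (@le_trans _ _ (B * `|dot bf n|)).
    by apply: (key (beta_p P) (beta_m P)) => //; move: fl; rewrite tt; lra.
  by rewrite ler_wpM2l//; [lra|have := dot_le_enorm bf n; rewrite n' mulr1].
apply: (@le_trans _ _ (B * `|dot bt n|)).
  rewrite -normrN; have := key (beta_m P) (beta_p P) (- dot bt n) => /(_ im xp xm bp).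
  by rewrite !normrN; apply; move: fl; rewrite tt; lra.
apply: (@le_trans _ _ (B * enorm bt)).
  by rewrite ler_wpM2l//; [lra|have := dot_le_enorm bt n; rewrite n' mulr1].
by rewrite ler_wpM2r ?enorm_ge0//; nra.
Qed.

(** On an uncut element the two pieces agree, which is the case of jump
    coefficient [0] with an arbitrary normal. *)
Lemma element_estimate x al be T X : ife_data P D x al be -> T \in elems M ->
  (forall i, i \in T -> `|x i| <= X) ->
  local_estimate h (stability_constant rho) T x (al^~ T) (be^~ T) X.
Proof.
move=> data TM xX; have hp := h0; have b1 := B_ge1; have mi0 := mi_gt0.
have [k [G bT]] := elem_bary conf fat rho0 h0 TM.
have /choice[sg Hsg] : forall i : nodes, exists s, i \in T -> closure (piece P T s) (node i).
  move=> i; have [iT|_] := boolP (i \in T); last by exists true.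
  by have [s cs] := node_in_piece_closure HP conf fat rho0 h0 TM iT; exists s.
have nodal i : i \in T -> al (sg i) T + dot (be (sg i) T) (node i) = x i.
  by move=> iT; apply: (ife_nodal data) => //; exact: Hsg.
have [i0 i0T] : exists i0, i0 \in T by apply/card_gt0P; rewrite (card_elem conf TM).
have X0 : 0 <= X by rewrite (le_trans _ (xX i0 i0T)).
suff [n [q [c [n1 jump dle [cm cp cg]]]]] : exists (n q : pt) (c : R),
    [/\ dot n n = 1,
        forall y, al true T + dot (be true T) y =
          al false T + dot (be false T) y + c * dot n (y - q),
        forall i, i \in T -> `|dot n (node i - q)| <= 2 * h &
        [/\ `|c| <= B * enorm (be false T), `|c| <= B ^+ 2 * enorm (be true T) &
            `|c| <= 2 * B ^+ 2 * enorm (\sum_(i in T) x i *: G i)]].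
  have [s1 s2 s3 s4] := stability_constant_ge0.
  split.
  - move=> s; have := gradient_bound conf fat rho0 h0 TM bT (al := al^~ T) (be := be^~ T)
      n1 jump nodal dle X0 xX cg s.
    move/le_trans; apply; rewrite ler_wpM2r ?invr_ge0 ?(ltW h0)// ler_wpM2r//.
    by rewrite /stability_constant; lra.
  - move=> s y Ty; have := value_bound conf fat rho0 h0 TM bT (al := al^~ T) (be := be^~ T)
      jump nodal dle X0 xX cg s Ty.
    move/le_trans; apply; rewrite ler_wpM2r//.
    by rewrite /stability_constant; lra.
  - move=> s s'; have := gradients_equivalent (al := al^~ T) (be := be^~ T) n1 jump b1 cm cp s s'.
    move/le_trans; apply; rewrite ler_wpM2r ?enorm_ge0//.
    by rewrite /stability_constant; lra.
  - move=> i j iT jT; have := nodal_differences cubic h0 TM (al := al^~ T) (be := be^~ T)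
      jump nodal dle b1 cm iT jT.
    move/le_trans; apply.
    have le : (2 + 4 * B) * h * enorm (be false T) <=
        stability_constant rho * h * enorm (be false T).
      rewrite ler_wpM2r ?enorm_ge0// ler_wpM2r ?(ltW h0)//.
      by rewrite /stability_constant; lra.
    have nn : 0 <= (2 + 4 * B) * h * enorm (be false T).
      by apply: mulr_ge0; [apply: mulr_ge0 => //; exact: ltW|exact: enorm_ge0].
    by rewrite lerXn2r ?nnegrE// (le_trans nn).
have bB0 u : 0 <= B ^+ 2 * enorm u :> R by rewrite mulr_ge0 ?enorm_ge0// sqr_ge0.
have [cT|nT] := pselect (cut (Gamma P) T); last first.
  have [ea eb] := ife_uncut data TM nT.
  have n1 : dot (delta_mx 0 0 : pt) (delta_mx 0 0) = 1.
    by rewrite dotE !mxE /=; ring.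
  exists (delta_mx 0 0), (node i0), 0; split=> //.
  - by move=> y; rewrite ea eb mul0r addr0.
  - move=> i iT; rewrite (le_trans (dot_le_enorm _ _))// (unit_enorm n1) mul1r.
    by apply: (elem_diam cubic TM); exact: node_simplex.
  - rewrite normr0; split; [|exact: bB0|by rewrite -mulrA mulr_ge0].
    by rewrite mulr_ge0 ?enorm_ge0//; lra.
have [q [Tq Gq]] := cT.
have [_ injD DT ang] := points TM cT.
have [exm par stab] := plane injD ang.
have [m [mD Hm]] := cut_plane conf cubic fat rho0 h0 TM e0 K0 Ke (flat Gq)
  (open_simplex_sub bT Tq) DT exm stab.
have m1 : dot m m = 1 by case: mD => mm _; rewrite -sqr_enorm mm expr1n.
have fl := ife_flux data TM cT mD.
pose c := dot (be true T - be false T) m.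
have wE : be true T - be false T = c *: m.
  apply: par => // i j; have := ife_continuous data TM cT i; have := ife_continuous data TM cT j.
  by rewrite dotBl !dotBr; lra.
have bE : be true T = be false T + c *: m by rewrite -wE addrC subrK.
have jump y : al true T + dot (be true T) y =
    al false T + dot (be false T) y + c * dot m (y - D T 0).
  have := ife_continuous data TM cT 0; rewrite bE !dotDl !dotZl dotBr.
  by lra.
have [cm cp] := jump_c_bounds m1 bE fl.
have dle i : i \in T -> `|dot m (node i - D T 0)| <= 2 * h.
  move=> iT; rewrite (le_trans (dot_le_enorm _ _))// (unit_enorm m1) mul1r.
  apply: (elem_diam cubic TM); first exact: node_simplex.
  by have [] := edge_point_simplex (DT 0).
exists m, (D T 0), c; split=> //; split=> //.
have eta0 : 0 <= 4 * (1 + K) * e by rewrite !mulr_ge0 ?addr_ge0.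
apply: (jump_coefficient_bound conf fat rho0 h0 TM bT (al := al^~ T) (be := be^~ T) m1
  jump nodal dle eta0 (beta_gt0 true) (beta_gt0 false)) => //.
- by move=> i iT si; have := Hm i true iT; rewrite -[X in piece _ _ X]si mul1r; apply; exact: Hsg.
- move=> i iT /negbTE si; have := Hm i false iT; rewrite -[X in piece _ _ X]si.
  by move=> /(_ (Hsg i iT)); rewrite /= mulN1r lerN2.
Qed.

End OneElement.

Lemma local_estimates (rho theta : R) : 0 < rho -> theta < pi ->
  exists e h1, [/\ 0 < e, 16 * e <= rho, 0 < h1 &
  forall (h : R) (M : mesh R) D, 0 < h -> h <= h1 ->
    conforming_mesh M (Omega P) -> subdivides_cubic_mesh M h ->
    regular_elements M rho h -> interface_points (Gamma P) theta D ->
    (forall q, Gamma P q -> flat_at P e (2 * h) q) /\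
    forall x al be, @ife_data _ P M D x al be -> forall T X, T \in elems M ->
      (forall i, i \in T -> `|x i| <= X) ->
      local_estimate h (stability_constant rho) T x (al^~ T) (be^~ T) X].
Proof.
move=> rho0 tpi; have [K [K0 plane]] := triangle_plane tpi.
have mi0 := mi_gt0.
have mx0 : 0 < mx by rewrite /mx lt_max (beta_gt0 true).
(* [e1] keeps the plane near the interface, [e2] leaves room for a cube off the
   interface and [e3] makes the equation for the jump coefficient well posed. *)
pose e1 := (2 * K)^-1; pose e2 := rho / 16.
pose e3 := mi * rho ^+ 2 / (64 * (1 + K) * mx).
have [e10 e20 e30] : [/\ 0 < e1, 0 < e2 & 0 < e3].
  split; rewrite ?invr_gt0 ?divr_gt0 ?mulr_gt0 ?exprn_gt0 ?addr_gt0//.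
pose e := Num.min e1 (Num.min e2 e3).
have e0 : 0 < e by rewrite !lt_min e10 e20.
have [ee1 ee2 ee3] : [/\ e <= e1, e <= e2 & e <= e3].
  by rewrite /e !ge_min !lexx !orbT.
have [r0 [r00 flat]] := flat_uniform HP e0.
exists e, (r0 / 4); split=> //; [by rewrite /e2 in ee2; lra|by rewrite divr_gt0|].
move=> h M D h0 hh conf cubic fat points.
have flat' q : Gamma P q -> flat_at P e (2 * h) q by apply: flat => //; [rewrite mulr_gt0|lra].
split=> // x al be data T X TM xX.
apply: (element_estimate (e := e) (K := K) conf cubic fat rho0 h0 points plane) => //.
- exact: ltW.
- exact: ltW.
- have : K * e <= K * e1 by rewrite ler_pM2l.
  by rewrite /e1; have -> : K * (2 * K)^-1 = 2^-1 by field; rewrite gt_eqF.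
- have -> : 8 * (4 * (1 + K) * e) / rho ^+ 2 * mx = e * (32 * (1 + K) * mx / rho ^+ 2).
    by field; rewrite gt_eqF.
  have -> : mi / 2 = e3 * (32 * (1 + K) * mx / rho ^+ 2).
    by rewrite /e3; field; rewrite !gt_eqF// addr_gt0.
  by rewrite ler_wpM2r// divr_ge0 ?sqr_ge0// !mulr_ge0 ?addr_ge0// ltW.
Qed.

End LocalEstimates.

(** * Volumes and integrals over triangles *)

Section TwoPieces.
Context d (T : measurableType d) (R : realType) (mu : {measure set T -> \bar R}).

Lemma Rintegral_two_pieces (A B : set T) (f fA fB : T -> R) :
  measurable A -> measurable B -> (mu A < +oo)%E -> (mu B < +oo)%E ->
  A `&` B = set0 -> bounded_measurable A fA -> bounded_measurable B fB ->
  (forall x, A x -> f x = fA x) -> (forall x, B x -> f x = fB x) ->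
  \int[mu]_(x in A `|` B) f x = \int[mu]_(x in A) fA x + \int[mu]_(x in B) fB x.
Proof.
move=> mA mB fnA fnB AB bA bB eA eB.
have bf : bounded_measurable (A `|` B) f.
  have [[mfA [MA hA]] [mfB [MB hB]]] := (bA, bB).
  split.
    apply/measurable_funU => //; split.
      by apply: eq_measurable_fun mfA => x /set_mem Ax; rewrite eA.
    by apply: eq_measurable_fun mfB => x /set_mem Bx; rewrite eB.
  exists (Num.max MA MB) => x [Ax|Bx]; rewrite le_max.
    by rewrite eA// hA.
  by rewrite eB// hB// orbT.
rewrite Rintegral_setU//.
- by congr (_ + _); apply: eq_Rintegral => x /set_mem; [exact: eA|exact: eB].
- apply: bm_integrable => //; first exact: measurableU.
  rewrite (le_lt_trans (measureU2 _ mA mB))//; exact: lte_add_pinfty.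
- by apply/disj_setPS; rewrite AB.
Qed.

End TwoPieces.

Section Volumes.
Variable R : realType.
Local Notation pt := 'rV[R]_3.
Local Notation leb := (@lebesgue_measure R).
Local Notation mu2 := (leb \x leb)%E.
Local Notation mu3 := ((leb \x leb) \x leb)%E.

Lemma pt_ofE (p : R * R * R) :
  [/\ pt_of p 0 0 = p.1.1, pt_of p 0 1 = p.1.2 & pt_of p 0 2 = p.2].
Proof. by rewrite !mxE. Qed.

Lemma pt_of_open (A : set pt) : open A -> open (@pt_of R @^-1` A).
Proof.
move=> oA; rewrite openE => -[[x y] z] /= Ap.
have /nbhs_ballP[e /= e0 eA] : nbhs (pt_of (x, y, z)) A by exact: open_nbhs_nbhs.
have [p0 p1 p2] := pt_ofE (x, y, z).
apply/nbhs_ballP; exists e => //= -[[x' y'] z'] [[/= hx hy] hz].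
apply: eA; apply/ballP; split=> //.
have [q0 q1 q2] := pt_ofE (x', y', z').
by apply: ord3P; rewrite ?p0 ?p1 ?p2 ?q0 ?q1 ?q2 /= distrC.
Qed.

Definition volume (A : set pt) : R := fine (mu3 (@pt_of R @^-1` A)).

Lemma open_pt_measurable (A : set pt) : open A ->
  measurable (@pt_of R @^-1` A : set (measurableTypeR R * measurableTypeR R * measurableTypeR R)).
Proof. by move=> oA; apply: open_measurable3; exact: pt_of_open. Qed.

Definition box (lo : pt) (s : R) : set pt := [set x | forall i, lo 0 i < x 0 i < lo 0 i + s].

Lemma box_preimage lo s : @pt_of R @^-1` box lo s =
  (`]lo 0 0, lo 0 0 + s[%classic `*` `]lo 0 1, lo 0 1 + s[%classic) `*` `]lo 0 2, lo 0 2 + s[%classic.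
Proof.
apply/seteqP; split=> p; have [p0 p1 p2] := pt_ofE p.
  by move=> h; rewrite /= !in_itv/=; have := (h 0, h 1, h 2); rewrite p0 p1 p2 => -[[]].
rewrite /= !in_itv/= => -[[h0 h1] h2].
by apply: ord3P; rewrite ?p0 ?p1 ?p2.
Qed.

Lemma mu3_box lo s : 0 <= s -> mu3 (@pt_of R @^-1` box lo s) = (s ^+ 3)%:E.
Proof.
move=> s0; rewrite box_preimage.
pose I (u : R) : set R := `]u, u + s[%classic.
have L u : leb (I u) = s%:E.
  rewrite lebesgue_measure_itv/= lte_fin ltrDl.
  have [s1|s1] := ltP 0 s; first by rewrite -EFinB addrAC subrr add0r.
  by congr (_%:E); apply/eqP; rewrite eq_le s0 s1.
have mI u : measurable (I u : set (measurableTypeR R)) by exact: measurable_itv.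
have L2 u v : mu2 (I u `*` I v) = (s * s)%:E.
  transitivity (leb (I u) * leb (I v))%E; first exact: product_measure1E.
  by rewrite !L -EFinM.
transitivity (mu2 (I (lo 0%R 0%R) `*` I (lo 0%R 1%R)) * leb (I (lo 0%R 2%R)))%E.
  by apply: product_measure1E => //; exact: measurableX.
by rewrite L2 L -EFinM; congr (_%:E); ring.
Qed.

Lemma box_measurable lo s :
  measurable (@pt_of R @^-1` box lo s : set (measurableTypeR R * measurableTypeR R * measurableTypeR R)).
Proof. by rewrite box_preimage; apply: measurableX => //; exact: measurableX. Qed.

Lemma mu3_le_box (A : set pt) lo s : open A -> 0 <= s -> A `<=` box lo s ->
  (mu3 (@pt_of R @^-1` A) <= (s ^+ 3)%:E)%E.
Proof.
move=> oA s0 AB; rewrite -(mu3_box lo s0); apply: le_measure; rewrite ?inE.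
- exact: open_pt_measurable.
- exact: box_measurable.
- by move=> p /AB.
Qed.

Lemma volume_le_box (A : set pt) lo s : open A -> 0 <= s -> A `<=` box lo s ->
  volume A <= s ^+ 3.
Proof.
move=> oA s0 AB; have le := mu3_le_box oA s0 AB.
by rewrite -lee_fin fineK// ge0_fin_numE ?measure_ge0// (le_lt_trans le)// ltry.
Qed.

Lemma volume_ge_box (A B : set pt) lo s hi t : open A -> open B -> 0 <= s -> 0 <= t ->
  A `|` B `<=` box hi t -> A `&` B = set0 -> box lo s `<=` A `|` B ->
  s ^+ 3 <= volume A + volume B.
Proof.
move=> oA oB s0 t0 ABhi AB0 sAB.
have fin C : open C -> C `<=` A `|` B -> mu3 (@pt_of R @^-1` C) \is a fin_num.
  move=> oC CAB; rewrite ge0_fin_numE ?measure_ge0//.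
  by rewrite (le_lt_trans (mu3_le_box oC t0 (subset_trans CAB ABhi)))// ltry.
have fA := fin _ oA (@subsetUl _ A B); have fB := fin _ oB (@subsetUr _ A B).
rewrite -lee_fin EFinD !fineK// -(mu3_box lo s0) -measureU.
- apply: le_measure; rewrite ?inE.
  + exact: box_measurable.
  + by apply: measurableU; exact: open_pt_measurable.
  + by move=> p /sAB.
- exact: open_pt_measurable.
- exact: open_pt_measurable.
- by rewrite -preimage_setI AB0 preimage_set0.
Qed.

Lemma vol_int_two_values (A B : set pt) (f : pt -> R) (a b t : R) hi :
  open A -> open B -> A `&` B = set0 -> 0 <= t -> A `|` B `<=` box hi t ->
  (forall x, A x -> f x = a) -> (forall x, B x -> f x = b) ->
  vol_int (A `|` B) f = a * volume A + b * volume B.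
Proof.
move=> oA oB AB0 t0 ABhi fa fb.
have fin C : open C -> C `<=` A `|` B -> (mu3 (@pt_of R @^-1` C) < +oo)%E.
  move=> oC CAB.
  by rewrite (le_lt_trans (mu3_le_box oC t0 (subset_trans CAB ABhi)))// ltry.
have fA := fin _ oA (@subsetUl _ A B); have fB := fin _ oB (@subsetUr _ A B).
have mA := open_pt_measurable oA; have mB := open_pt_measurable oB.
rewrite /vol_int preimage_setU.
rewrite (@Rintegral_two_pieces _ _ _ _ _ _ _ (fun=> a) (fun=> b))//.
- by rewrite !Rintegral_cst.
- by rewrite -preimage_setI AB0 preimage_set0.
- exact: bm_cst.
- exact: bm_cst.
- by move=> p /fa.
- by move=> p /fb.
Qed.

End Volumes.

Section Triangles.
Variable R : realType.
Local Notation pt := 'rV[R]_3.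
Local Notation leb := (@lebesgue_measure R).
Local Notation mu2 := (leb \x leb)%E.
Variables a b c : pt.

Definition tri_domain (A : set pt) : set (R * R) :=
  [set st : R * R | [/\ 0 < st.1, 0 < st.2, st.1 + st.2 < 1 & A (tri_point a b c st)]].

Definition tri_area : R :=
  Num.sqrt (dot (b - a) (b - a) * dot (c - a) (c - a) - dot (b - a) (c - a) ^+ 2).

Lemma tri_domain_open A : open A -> open (tri_domain A).
Proof.
move=> oA.
have fc (u v w : R) : continuous (fun st : R * R => u + v * st.1 + w * st.2).
  move=> st; apply: cvgD; last by apply: cvgMr; exact: cvg_snd.
  by apply: cvgD; [exact: cvg_cst|apply: cvgMr; exact: cvg_fst].
have -> : tri_domain A = [set st | 0 < 0 + 1 * st.1 + 0 * st.2] `&`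
    [set st | 0 < 0 + 0 * st.1 + 1 * st.2] `&` [set st | 0 < 1 + - 1 * st.1 + - 1 * st.2] `&`
    ((fun st => tri_point a b c st) @^-1` A).
  apply/seteqP; split=> st /=.
    by move=> [h1 h2 h3 h4]; do !split => //; lra.
  by move=> [[[h1 h2] h3] h4]; split => //; lra.
have op u v w : open [set st : R * R | 0 < u + v * st.1 + w * st.2].
  apply: (@open_comp _ _ (fun st : R * R => u + v * st.1 + w * st.2) [set y | 0 < y]); last exact: open_gt.
  by move=> st _; exact: fc.
apply: openI; first by do 2?apply: openI.
apply: open_comp => // st _.
apply: cvgD; last by apply: cvgZl; exact: cvg_snd.
by apply: cvgD; [exact: cvg_cst|apply: cvgZl; exact: cvg_fst].
Qed.

Lemma tri_domain_measurable A : open A ->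
  measurable (tri_domain A : set (measurableTypeR R * measurableTypeR R)).
Proof. by move=> oA; apply: open_measurable2; exact: tri_domain_open. Qed.

Lemma tri_domain_le1 A : open A -> (mu2 (tri_domain A) <= 1)%E.
Proof.
move=> oA.
pose I : set R := `]0, 1[%classic.
have L : leb I = 1%E by rewrite lebesgue_measure_itv/= lte_fin ltr01 oppr0 adde0.
have mI : measurable (I : set (measurableTypeR R)) by exact: measurable_itv.
have <- : mu2 (I `*` I) = 1%E.
  transitivity (leb I * leb I)%E; last by rewrite L mule1.
  exact: product_measure1E.
apply: le_measure; rewrite ?inE.
- exact: tri_domain_measurable.
- exact: measurableX.
- move=> st [h1 h2 h3 _]; rewrite /I /=.
  by split; rewrite in_itv/=; apply/andP; split; lra.
Qed.

Lemma affine_tri_bm A (al : R) (be : pt) : open A ->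
  bounded_measurable (tri_domain A : set (measurableTypeR R * measurableTypeR R))
    (fun st => al + dot be (tri_point a b c st)).
Proof.
move=> oA.
have E st : al + dot be (tri_point a b c st) =
    (al + dot be a) + (st.1 * dot be (b - a) + st.2 * dot be (c - a)).
  by rewrite /tri_point !(dotDr, dotZr, dotNr); ring.
have mD := tri_domain_measurable oA.
rewrite (_ : (fun st => _) = fun st => (al + dot be a) + (st.1 * dot be (b - a) + st.2 * dot be (c - a))); last exact/funext.
apply: bmD; first exact: bm_cst.
apply: bmD; apply: bmM; do ?exact: bm_cst.
  split; first by apply: measurable_funTS; exact: measurable_fst.
  by exists 1 => st [h1 h2 h3 _]; rewrite ler_norml; apply/andP; split; lra.
split; first by apply: measurable_funTS; exact: measurable_snd.
by exists 1 => st [h1 h2 h3 _]; rewrite ler_norml; apply/andP; split; lra.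
Qed.

Definition tri_part (A : set pt) (q : pt -> R) : R :=
  tri_area * \int[mu2]_(st in tri_domain A) q (tri_point a b c st).

Definition tri_nice (A : set pt) (q : pt -> R) : Prop :=
  bounded_measurable (tri_domain A : set (measurableTypeR R * measurableTypeR R))
    (fun st => q (tri_point a b c st)).

Lemma tri_lt_pinfty A : open A -> (mu2 (tri_domain A) < +oo)%E.
Proof. by move=> oA; rewrite (le_lt_trans (tri_domain_le1 oA))// ltry. Qed.

Lemma tri_int_two_pieces (A B C : set pt) (f fA fB : pt -> R) :
  open A -> open B -> A `&` B = set0 ->
  tri_domain C = tri_domain A `|` tri_domain B ->
  tri_nice A fA -> tri_nice B fB ->
  (forall st, tri_domain A st -> f (tri_point a b c st) = fA (tri_point a b c st)) ->
  (forall st, tri_domain B st -> f (tri_point a b c st) = fB (tri_point a b c st)) ->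
  tri_int a b c C f = tri_part A fA + tri_part B fB.
Proof.
move=> oA oB AB0 E nA nB eA eB.
rewrite /tri_int -/(tri_domain C) E -/tri_area.
rewrite /tri_part -mulrDr; congr (_ * _); apply: Rintegral_two_pieces => //.
- exact: tri_domain_measurable.
- exact: tri_domain_measurable.
- exact: tri_lt_pinfty.
- exact: tri_lt_pinfty.
- rewrite -subset0 => st [[_ _ _ h1] [_ _ _ h2]].
  by have : (A `&` B) (tri_point a b c st) by []; rewrite AB0.
Qed.

Lemma tri_part_sum A (I : Type) (r : seq I) (k : I -> R) (q : I -> pt -> R) : open A ->
  (forall i, tri_nice A (q i)) ->
  tri_nice A (fun y => \sum_(i <- r) k i * q i y) /\
  tri_part A (fun y => \sum_(i <- r) k i * q i y) = \sum_(i <- r) k i * tri_part A (q i).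
Proof.
move=> oA nq.
have [n1 e1] := Rintegral_sum r k (tri_domain_measurable oA) (tri_lt_pinfty oA) nq.
split=> //; rewrite /tri_part e1 mulr_sumr; apply: eq_bigr => i _; ring.
Qed.

Lemma tri_part_bound A q Q : open A -> 0 <= Q -> tri_nice A q ->
  (forall st, tri_domain A st -> `|q (tri_point a b c st)| <= Q) ->
  `|tri_part A q| <= tri_area * Q.
Proof.
move=> oA Q0 nq qQ; rewrite normrM ger0_norm ?sqrtr_ge0// ler_wpM2l ?sqrtr_ge0//.
have := Rintegral_bound (tri_domain_measurable oA) (tri_lt_pinfty oA) nq qQ.
move/le_trans; apply; rewrite -[leRHS]mulr1 ler_wpM2l//.
rewrite -[1]/(fine 1%E) fine_le ?tri_domain_le1//.
by rewrite ge0_fin_numE ?measure_ge0// tri_lt_pinfty.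
Qed.

Lemma tri_part_ge0 A q : (forall st, tri_domain A st -> 0 <= q (tri_point a b c st)) ->
  0 <= tri_part A q.
Proof. by move=> q0; rewrite mulr_ge0 ?sqrtr_ge0// Rintegral_ge0. Qed.

Lemma tri_area_le s : enorm (b - a) <= s -> enorm (c - a) <= s -> tri_area <= s ^+ 2.
Proof.
move=> bs cs; have s0 : 0 <= s by rewrite (le_trans _ bs) ?enorm_ge0.
rewrite /tri_area -[s ^+ 2]ger0_norm ?sqr_ge0// -sqrtr_sqr ler_wsqrtr//.
rewrite -!sqr_enorm; have := sqr_ge0 (dot (b - a) (c - a)).
have hb : enorm (b - a) ^+ 2 <= s ^+ 2 by rewrite lerXn2r ?nnegrE ?enorm_ge0.
have hc : enorm (c - a) ^+ 2 <= s ^+ 2 by rewrite lerXn2r ?nnegrE ?enorm_ge0.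
have := ler_pM (sqr_ge0 _) (sqr_ge0 _) hb hc; rewrite -expr2; lra.
Qed.

End Triangles.

(** * The bilinear form in terms of the affine pieces *)

Section BilinearForm.
Variables (R : realType) (P : interface R).
Local Notation pt := 'rV[R]_3.
Hypothesis HP : interface_problem P.
Variables (M : mesh R) (rho h e : R).
Local Notation vset := {set 'I_(nnodes M)}.
Local Notation nodes := 'I_(nnodes M).
Hypothesis conf : conforming_mesh M (Omega P).
Hypothesis cubic : subdivides_cubic_mesh M h.
Hypothesis fat : regular_elements M rho h.
Hypothesis rho0 : 0 < rho.
Hypothesis h0 : 0 < h.
Hypothesis flat : forall q, Gamma P q -> flat_at P e (2 * h) q.
Variable nF : vset -> pt.
Hypothesis nF_normal : forall F, is_face F -> unit_normal (nF F) (simplex F).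

Definition cut_face (F : vset) : bool := `[< is_face F /\ cut (Gamma P) F >].

Lemma gradient_on_piece v al be T s y : represents P v al be -> T \in elems M ->
  piece P T s y -> grad v y = be s T.
Proof.
move=> rep TM Ty; have [k [G bT]] := elem_bary conf fat rho0 h0 TM.
have nE : \forall z \near y, v z = al s T + dot (be s T) z.
  have : nbhs y (piece P T s).
    apply: open_nbhs_nbhs; split=> //.
    by apply: openI; [exact: (open_simplex_open bT)|exact: side_open].
  by apply: filterS => z; exact: rep.
apply/rowP => i; rewrite mxE /partial (near_eq_derive _ nE) /derive.
apply: cvg_lim => //.
apply: (@cvg_trans _ ((fun=> be s T 0 i) @ 0^')); last exact: cvg_cst.
apply: near_eq_cvg; near=> t => /=.
have t0 : t != 0 by near: t; exact: nbhs_dnbhs_neq.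
rewrite dotDr dotZr (dotC _ (delta_mx _ _)) /dot (bigD1 i)//= mxE !eqxx /= mul1r.
rewrite big1 ?addr0; last by move=> j /negbTE ji; rewrite mxE ji andbF mul0r.
rewrite (_ : _ - _ = t * be s T 0 i); last by rewrite /dot; ring.
by rewrite /GRing.scale/= mulrA mulVf// mul1r.
Unshelve. all: by end_near. Qed.

Lemma face_Omega F y : cut_face F -> simplex F y -> Omega P y.
Proof.
move=> /asboolP[[cF [T TM FT]] [q [Fq Gq]]] Fy; have [subO _] := flat Gq.
have Fq' : simplex F q by have [l [l0 l1 ->]] := Fq; exists l; split=> // i /l0/ltW.
by apply: subO; apply: (elem_in_ball cubic h0 TM); exact: (simplex_subset FT).
Qed.

Definition side_dir (b : bool) (F : vset) : pt := if b then nF F else - nF F.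

(** [nb F b] is the element from which the trace in direction [side_dir b F] is
    taken. *)
Lemma face_neighbours : exists nb : vset -> bool -> vset, forall F b, cut_face F ->
  [/\ nb F b \in elems M, F \subset nb F b & forall y, open_simplex F y ->
    \forall t \near (0 : R)^'+, open_simplex (nb F b) (y + t *: side_dir b F)].
Proof.
have H (Fb : vset * bool) : exists T : vset, cut_face Fb.1 -> [/\ T \in elems M, Fb.1 \subset T &
    forall y, open_simplex Fb.1 y ->
      \forall t \near (0 : R)^'+, open_simplex T (y + t *: side_dir Fb.2 Fb.1)].
  have [cF|_] := boolP (cut_face Fb.1); last by exists finset.set0.
  have /asboolP[isF [q [Fq Gq]]] := cF.
  have nn : unit_normal (side_dir Fb.2 Fb.1) (simplex Fb.1).
    have [n1 nn] := nF_normal isF; rewrite /side_dir; case: Fb.2; split=> //.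
      by rewrite enormN.
    by move=> u w Fu Fw; rewrite dotNl nn ?oppr0.
  have [T HT] := face_element conf fat rho0 h0 isF nn Fq (Gamma_sub_Omega HP Gq).
  by exists T.
have /choice[nb Hnb] := H.
by exists (fun F b => nb (F, b)) => F b cF; exact: (Hnb (F, b) cF).
Qed.

Variable nb : vset -> bool -> vset.
Hypothesis nbP : forall F b, cut_face F ->
  [/\ nb F b \in elems M, F \subset nb F b & forall y, open_simplex F y ->
    \forall t \near (0 : R)^'+, open_simplex (nb F b) (y + t *: side_dir b F)].

Lemma near_face_piece F b s y : cut_face F -> open_simplex F y -> side P s y ->
  \forall t \near (0 : R)^'+, piece P (nb F b) s (y + t *: side_dir b F).
Proof.
move=> cF Fy sy; have [_ _ /(_ y Fy) nT] := nbP b cF.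
have : nbhs y (side P s) by apply: open_nbhs_nbhs; split=> //; exact: side_open.
move=> sn; have lc := @line_continuous R y (side_dir b F) 0.
rewrite /continuous_at scale0r addr0 in lc.
have n0 : \forall t \near (0 : R), side P s (y + t *: side_dir b F) by exact: lc.
have n1 : \forall t \near (0 : R)^'+, side P s (y + t *: side_dir b F).
  by rewrite near_withinE; apply: filterS n0.
by apply: filterS2 nT n1 => t h1 h2; split.
Qed.

Lemma trace_affine v al be F b s y : represents P v al be -> cut_face F ->
  open_simplex F y -> side P s y ->
  trace_from v (side_dir b F) y = al s (nb F b) + dot (be s (nb F b)) y.
Proof.
move=> rep cF Fy sy; rewrite /trace_from.
have [TM _ _] := nbP b cF.
pose f (t : R) := (al s (nb F b) + dot (be s (nb F b)) y) + t * dot (be s (nb F b)) (side_dir b F).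
apply: cvg_lim => //.
apply: (@cvg_trans _ (f @ 0^'+)).
  apply: near_eq_cvg; have := near_face_piece b cF Fy sy.
  by apply: filterS => t /(rep _ s _ TM) ->; rewrite /f dotDr dotZr addrA.
apply: cvg_at_right_filter.
set u := al s (nb F b) + _; set w := dot (be s (nb F b)) (side_dir b F).
have h1 : (fun _ : R => u) t @[t --> (0 : R)] --> u by exact: cvg_cst.
have h2 : (fun t : R => t * w) t @[t --> (0 : R)] --> 0 * w by apply: cvgMl; exact: cvg_id.
have := cvgD h1 h2; rewrite mul0r addr0 => h3; exact: h3.
Qed.

Lemma beta_sideE s y : side P s y -> beta P y = beta_side P s.
Proof.
rewrite /beta; case: s => sy /=; first by rewrite mem_set.
by case: ifPn => // /set_mem py; case: (@side_disjoint _ _ HP true y).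
Qed.

Lemma trace_flux v al be F b s y : represents P v al be -> cut_face F ->
  open_simplex F y -> side P s y ->
  trace_from (fun z => beta P z * dot (grad v z) (nF F)) (side_dir b F) y =
  beta_side P s * dot (be s (nb F b)) (nF F).
Proof.
move=> rep cF Fy sy; rewrite /trace_from; have [TM _ _] := nbP b cF.
apply: cvg_lim => //.
apply: (@cvg_trans _ ((fun=> beta_side P s * dot (be s (nb F b)) (nF F)) @ (0 : R)^'+)); last exact: cvg_cst.
apply: near_eq_cvg; have := near_face_piece b cF Fy sy.
apply: filterS => t ps; rewrite (gradient_on_piece rep TM ps).
by rewrite (beta_sideE ps.2).
Qed.

(** [nb F false] is the element that the normal leaves, whence the sign. *)
Definition face_jump (al : bool -> vset -> R) (be : bool -> vset -> pt) F s y : R :=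
  (al s (nb F false) + dot (be s (nb F false)) y) -
  (al s (nb F true) + dot (be s (nb F true)) y).

Definition face_flux (be : bool -> vset -> pt) F s : R :=
  (beta_side P s * dot (be s (nb F false)) (nF F) +
   beta_side P s * dot (be s (nb F true)) (nF F)) / 2.

Definition vertex (F : vset) k : pt := nth 0 [seq node i | i <- enum F] k.

Definition face_part F s (q : pt -> R) : R :=
  tri_part (vertex F 0) (vertex F 1) (vertex F 2) (side P s) q.

(** The form [a_h] on affine data instead of functions: with traces replaced by
    their values, bilinearity is a matter of finite sums. *)
Definition Bform (sigma : R) al be al' be' : R :=
  \sum_(T in elems M) \sum_s beta_side P s * dot (be s T) (be' s T) * volume (piece P T s)
  - \sum_(F | cut_face F) \sum_s face_part F s (fun y => face_flux be F s * face_jump al' be' F s y)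
  - \sum_(F | cut_face F) \sum_s face_part F s (fun y => face_flux be' F s * face_jump al be F s y)
  + \sum_(F | cut_face F) sigma / diameter (simplex F) *
      \sum_s face_part F s (fun y => face_jump al be F s y * face_jump al' be' F s y).

Lemma face_vertices F : is_face F -> exists i j l,
  [/\ [/\ i \in F, j \in F & l \in F],
      [/\ vertex F 0 = node i, vertex F 1 = node j & vertex F 2 = node l] &
      F = [set i; j; l]%SET /\ uniq [:: i; j; l]].
Proof.
move=> [cF _]; rewrite /vertex; have mF i : (i \in F) = (i \in enum F) by rewrite mem_enum.
have uF := enum_uniq F; have sF : size (enum F) = 3%N by rewrite -cardE.
case E : (enum F) mF uF sF => [|i [|j [|l [|//]]]]// mF uF _.
exists i, j, l; split=> //; first by rewrite !mF !inE !eqxx !orbT.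
by split=> //; apply/setP => u; rewrite mF !inE orbA.
Qed.

Lemma tri_domain_face F st A : is_face F ->
  tri_domain (vertex F 0) (vertex F 1) (vertex F 2) A st ->
  open_simplex F (tri_point (vertex F 0) (vertex F 1) (vertex F 2) st).
Proof.
move=> isF [h1 h2 h3 _]; have [i [j [l [_ [-> -> ->] [FE]]]]] := face_vertices isF.
rewrite /= !inE negb_or andbT => /andP[/andP[ij il] jl].
pose w u : R := if u == i then 1 - st.1 - st.2 else if u == j then st.1 else st.2.
have bigF (V : nmodType) (f : nodes -> V) : \sum_(u in F) f u = f i + (f j + f l).
  rewrite FE -finset.setUA big_setU1/=; last by rewrite !inE negb_or ij.
  by rewrite big_setU1 ?big_set1//= inE.
have [wi wj wl] : [/\ w i = 1 - st.1 - st.2, w j = st.1 & w l = st.2].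
  by rewrite /w eqxx eq_sym (negbTE ij) eqxx eq_sym (negbTE il) eq_sym (negbTE jl).
exists w; split.
- by move=> u _; rewrite /w; do 2?case: ifP => _ //; lra.
- by rewrite bigF wi wj wl; ring.
- by rewrite bigF wi wj wl /tri_point; apply: row3P; rewrite !mxE; ring.
Qed.

Lemma elem_box (T : vset) : T \in elems M -> exists lo, open_simplex T `<=` box lo (3 * h).
Proof.
move=> TM; have hp := h0.
have [i iT] : exists i, i \in T by apply/card_gt0P; rewrite (card_elem conf TM).
have [k [G bT]] := elem_bary conf fat rho0 h0 TM.
exists (node i - const_mx (3 / 2 * h)) => y /(open_simplex_sub bT) Ty l.
have := elem_coord_diam cubic l TM Ty (node_simplex iT).
by rewrite !mxE ler_norml => /andP[h1 h2]; apply/andP; split; lra.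
Qed.

Lemma piece_disjoint (T : vset) : piece P T true `&` piece P T false = set0.
Proof.
by rewrite -subset0 => y [[_ s1] [_ s2]]; exact: (@side_disjoint _ _ HP true y).
Qed.

Lemma piece_open (T : vset) s : T \in elems M -> open (piece P T s).
Proof.
move=> TM; have [k [G bT]] := elem_bary conf fat rho0 h0 TM.
by apply: openI; [exact: (open_simplex_open bT)|exact: side_open].
Qed.

Lemma off_interface (T : vset) : T \in elems M ->
  open_simplex T `\` Gamma P = piece P T true `|` piece P T false.
Proof.
move=> TM; apply/seteqP; split=> y.
  move=> [Ty nG]; have Oy := open_simplex_Omega conf fat rho0 h0 TM Ty.
  by have [[] sy] := side_cover HP Oy nG; [left|right].
by move=> [[Ty sy]|[Ty sy]]; split=> //; have [] := side_Omega HP sy.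
Qed.

Lemma elem_int_data w v al be al' be' (T : vset) : represents P w al be -> represents P v al' be' ->
  T \in elems M ->
  elem_int P T (fun y => beta P y * dot (grad w y) (grad v y)) =
  \sum_s beta_side P s * dot (be s T) (be' s T) * volume (piece P T s).
Proof.
move=> rw rv TM; have hp := h0; have [lo Tlo] := elem_box TM.
have val s y : piece P T s y -> beta P y * dot (grad w y) (grad v y) =
    beta_side P s * dot (be s T) (be' s T).
  move=> py; rewrite (gradient_on_piece rw TM py) (gradient_on_piece rv TM py).
  by rewrite (beta_sideE py.2).
rewrite /elem_int (off_interface TM) big_bool.
apply: (vol_int_two_values (t := 3 * h) (hi := lo)).
- exact: piece_open.
- exact: piece_open.
- exact: piece_disjoint.
- by lra.
- by move=> y [[Ty _]|[Ty _]]; exact: Tlo.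
- exact: val.
- exact: val.
Qed.

Lemma tri_domain_off F : cut_face F ->
  tri_domain (vertex F 0) (vertex F 1) (vertex F 2) (~` Gamma P) =
  tri_domain (vertex F 0) (vertex F 1) (vertex F 2) (side P true) `|`
  tri_domain (vertex F 0) (vertex F 1) (vertex F 2) (side P false).
Proof.
move=> cF; have /asboolP[isF _] := cF; apply/seteqP; split=> st.
  move=> st3; have Fy := tri_domain_face isF st3; move: st3 => [h1 h2 h3 nG].
  have Oy : Omega P (tri_point (vertex F 0) (vertex F 1) (vertex F 2) st).
    by apply: (face_Omega cF); have [l [l0 l1 E]] := Fy; exists l; split=> // i /l0/ltW.
  by have [[] sy] := side_cover HP Oy nG; [left|right].
by move=> [[h1 h2 h3 sy]|[h1 h2 h3 sy]]; split=> //=; have [] := side_Omega HP sy.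
Qed.

Definition face_nice F s (q : pt -> R) : Prop :=
  tri_nice (vertex F 0) (vertex F 1) (vertex F 2) (side P s) q.

Lemma face_int_data F (f : pt -> R) (q : bool -> pt -> R) : cut_face F ->
  (forall s, face_nice F s (q s)) ->
  (forall s y, open_simplex F y -> side P s y -> f y = q s y) ->
  face_int P F f = \sum_s face_part F s (q s).
Proof.
move=> cF nq fq; have /asboolP[isF _] := cF; rewrite big_bool.
apply: tri_int_two_pieces.
- exact: side_open.
- exact: side_open.
- by rewrite -subset0 => y [s1 s2]; exact: (@side_disjoint _ _ HP true y).
- exact: tri_domain_off.
- exact: nq.
- exact: nq.
- by move=> st hst; apply: fq; [exact: tri_domain_face hst|case: hst].
- by move=> st hst; apply: fq; [exact: tri_domain_face hst|case: hst].
Qed.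

Lemma face_jump_nice al be F s : face_nice F s (face_jump al be F s).
Proof.
rewrite /face_nice /tri_nice.
have E y : face_jump al be F s y = (al s (nb F false) - al s (nb F true)) +
    dot (be s (nb F false) - be s (nb F true)) y.
  by rewrite /face_jump dotBl; ring.
under [X in bounded_measurable _ X]funext do rewrite E.
by apply: affine_tri_bm; exact: side_open.
Qed.

Lemma face_nice_scale F s c q : face_nice F s q -> face_nice F s (fun y => c * q y).
Proof. by move=> nq; apply: bmZ => //; apply: tri_domain_measurable; exact: side_open. Qed.

Lemma face_nice_mul F s q q' : face_nice F s q -> face_nice F s q' ->
  face_nice F s (fun y => q y * q' y).
Proof. by move=> nq nq'; exact: bmM. Qed.

Lemma jump_data v al be F s y : represents P v al be -> cut_face F ->
  open_simplex F y -> side P s y -> jump (nF F) v y = face_jump al be F s y.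
Proof.
move=> rv cF Fy sy; rewrite /jump /face_jump.
by rewrite (trace_affine true rv cF Fy sy) (trace_affine false rv cF Fy sy).
Qed.

Lemma average_data v al be F s y : represents P v al be -> cut_face F ->
  open_simplex F y -> side P s y ->
  average (nF F) (fun z => beta P z * dot (grad v z) (nF F)) y = face_flux be F s.
Proof.
move=> rv cF Fy sy; rewrite /average /face_flux.
by rewrite (trace_flux true rv cF Fy sy) (trace_flux false rv cF Fy sy).
Qed.

Lemma a_h_data sigma w v al be al' be' : represents P w al be -> represents P v al' be' ->
  a_h P nF sigma w v = Bform sigma al be al' be'.
Proof.
move=> rw rv; rewrite /a_h /Bform.
have cross w1 v1 a1 b1 a2 b2 : represents P w1 a1 b1 -> represents P v1 a2 b2 ->
    \sum_(F : vset | `[< is_face F /\ cut (Gamma P) F >]) face_int P F (fun x =>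
      average (nF F) (fun z => beta P z * dot (grad w1 z) (nF F)) x * jump (nF F) v1 x) =
    \sum_(F | cut_face F) \sum_s face_part F s (fun y => face_flux b1 F s * face_jump a2 b2 F s y).
  move=> r1 r2; apply: eq_bigr => F cF; apply: face_int_data => //.
    by move=> s; apply: face_nice_scale; exact: face_jump_nice.
  by move=> s y Fy sy; rewrite (average_data r1 cF Fy sy) (jump_data r2 cF Fy sy).
rewrite (cross w v al be al' be')// (cross v w al' be' al be)//.
congr (_ - _ - _ + _); first by apply: eq_bigr => T TM; exact: elem_int_data rw rv TM.
apply: eq_bigr => F cF; congr (_ * _); apply: face_int_data => //.
  by move=> s; apply: face_nice_mul; exact: face_jump_nice.
by move=> s y Fy sy; rewrite (jump_data rw cF Fy sy) (jump_data rv cF Fy sy).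
Qed.

End BilinearForm.

(** * Coercivity and boundedness of the form *)

Section FormBounds.
Variables (R : realType) (P : interface R).
Local Notation pt := 'rV[R]_3.
Hypothesis HP : interface_problem P.
Variables (M : mesh R) (rho h e : R).
Local Notation vset := {set 'I_(nnodes M)}.
Local Notation nodes := 'I_(nnodes M).
Hypothesis conf : conforming_mesh M (Omega P).
Hypothesis cubic : subdivides_cubic_mesh M h.
Hypothesis fat : regular_elements M rho h.
Hypothesis rho0 : 0 < rho.
Hypothesis h0 : 0 < h.
Hypothesis e0 : 0 < e.
Hypothesis e_rho : 16 * e <= rho.
Hypothesis flat : forall q, Gamma P q -> flat_at P e (2 * h) q.
Variable nF : vset -> pt.
Hypothesis nF_normal : forall F, is_face F -> unit_normal (nF F) (simplex F).
Variable nb : vset -> bool -> vset.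
Hypothesis nbP : forall F b, cut_face P F ->
  [/\ nb F b \in elems M, F \subset nb F b & forall y, open_simplex F y ->
    \forall t \near (0 : R)^'+, open_simplex (nb F b) (y + t *: side_dir nF b F)].
Variable sigma : R.
Hypothesis sigma0 : 0 < sigma.

Local Notation Bf := (Bform P nF nb sigma).
Local Notation part := (face_part P).
Local Notation flux := (face_flux P nF nb).
Local Notation fjump := (face_jump nb).

Lemma face_part_sum (F : vset) s (I : Type) (r : seq I) (k : I -> R) (q : I -> pt -> R) :
  (forall i, face_nice P F s (q i)) ->
  part F s (fun y => \sum_(i <- r) k i * q i y) = \sum_(i <- r) k i * part F s (q i).
Proof. by move=> nq; have [] := tri_part_sum r k (side_open HP (s := s)) nq. Qed.

Lemma face_part_lin (F : vset) s (k1 k2 : R) (q1 q2 : pt -> R) :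
  face_nice P F s q1 -> face_nice P F s q2 ->
  face_nice P F s (fun y => k1 * q1 y + k2 * q2 y) /\
  part F s (fun y => k1 * q1 y + k2 * q2 y) = k1 * part F s q1 + k2 * part F s q2.
Proof.
move=> n1 n2; pose k (b : bool) := if b then k1 else k2.
pose q (b : bool) := if b then q1 else q2.
have nq b : face_nice P F s (q b) by case: b.
have [n e'] := tri_part_sum [:: true; false] k (side_open HP (s := s)) nq.
have E : (fun y => \sum_(i <- [:: true; false]) k i * q i y) =
    (fun y => k1 * q1 y + k2 * q2 y).
  by apply/funext => y; rewrite !big_cons big_nil addr0.
rewrite E in n e'; split=> //.
by rewrite /face_part e' !big_cons big_nil addr0.
Qed.

Section Bilinear.
Variables (I : finType) (c c' : I -> R).
Variables (al al' : I -> bool -> vset -> R) (be be' : I -> bool -> vset -> pt).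

Let k (p : I * I) := c' p.1 * c p.2.

Lemma prod_sums (u v : I -> R) :
  (\sum_j c j * u j) * (\sum_i c' i * v i) = \sum_(p : I * I) k p * (u p.2 * v p.1).
Proof.
rewrite mulr_sumr -(pair_bigA _ (fun i j => c' i * c j * (u j * v i)))/=.
apply: eq_bigr => i _; rewrite mulr_suml; apply: eq_bigr => j _; ring.
Qed.

Lemma dot_sums (u v : I -> pt) :
  dot (\sum_j c j *: u j) (\sum_i c' i *: v i) = \sum_(p : I * I) k p * dot (u p.2) (v p.1).
Proof.
rewrite dot_sumr -(pair_bigA _ (fun i j => c' i * c j * dot (u j) (v i)))/=.
apply: eq_bigr => i _; rewrite dotZr dot_suml mulr_sumr; apply: eq_bigr => j _.
by rewrite dotZl; ring.
Qed.

Lemma flux_sum (d : I -> R) (b : I -> bool -> vset -> pt) F s :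
  flux (fun s T => \sum_i d i *: b i s T) F s = \sum_i d i * flux (b i) F s.
Proof.
rewrite /face_flux !dot_suml !mulr_sumr -big_split/= mulr_suml.
by apply: eq_bigr => i _; rewrite !dotZl; ring.
Qed.

Lemma jump_sum (d : I -> R) (a : I -> bool -> vset -> R) (b : I -> bool -> vset -> pt) F s y :
  fjump (fun s T => \sum_i d i * a i s T) (fun s T => \sum_i d i *: b i s T) F s y =
  \sum_i d i * fjump (a i) (b i) F s y.
Proof.
rewrite /face_jump !dot_suml -!big_split/= -sumrB.
by apply: eq_bigr => i _; rewrite !dotZl; ring.
Qed.

Lemma Bform_bilinear :
  Bf (fun s T => \sum_j c j * al j s T) (fun s T => \sum_j c j *: be j s T)
     (fun s T => \sum_i c' i * al' i s T) (fun s T => \sum_i c' i *: be' i s T) =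
  \sum_(p : I * I) k p * Bf (al p.2) (be p.2) (al' p.1) (be' p.1).
Proof.
rewrite /Bform.
have nj a b F s : face_nice P F s (fjump a b F s) by exact: face_jump_nice.
under [RHS]eq_bigr do rewrite mulrDr !mulrBr.
rewrite big_split/= !sumrB; congr (_ - _ - _ + _).
- under [RHS]eq_bigr do rewrite mulr_sumr.
  rewrite [RHS]exchange_big/=; apply: eq_bigr => T _.
  under [RHS]eq_bigr do rewrite mulr_sumr.
  rewrite [RHS]exchange_big/=; apply: eq_bigr => s _.
  rewrite dot_sums mulr_sumr mulr_suml; apply: eq_bigr => p _; ring.
- under [RHS]eq_bigr do rewrite mulr_sumr.
  rewrite [RHS]exchange_big/=; apply: eq_bigr => F _.
  under [RHS]eq_bigr do rewrite mulr_sumr.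
  rewrite [RHS]exchange_big/=; apply: eq_bigr => s _.
  rewrite -face_part_sum; last by move=> p; apply: (face_nice_scale HP); exact: nj.
  by congr (part F s _); apply/funext => y; rewrite flux_sum jump_sum prod_sums.
- under [RHS]eq_bigr do rewrite mulr_sumr.
  rewrite [RHS]exchange_big/=; apply: eq_bigr => F _.
  under [RHS]eq_bigr do rewrite mulr_sumr.
  rewrite [RHS]exchange_big/=; apply: eq_bigr => s _.
  rewrite -face_part_sum; last by move=> p; apply: (face_nice_scale HP); exact: nj.
  congr (part F s _); apply/funext => y; rewrite flux_sum jump_sum mulrC prod_sums.
  by apply: eq_bigr => p _; rewrite [X in _ * X]mulrC.
- under [RHS]eq_bigr do rewrite mulr_sumr.
  rewrite [RHS]exchange_big/=; apply: eq_bigr => F _.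
  under [RHS]eq_bigr do rewrite mulrCA.
  rewrite -[RHS]mulr_sumr; congr (_ * _).
  under [RHS]eq_bigr do rewrite mulr_sumr.
  rewrite [RHS]exchange_big/=; apply: eq_bigr => s _.
  rewrite -face_part_sum; last by move=> p; apply: face_nice_mul; exact: nj.
  by congr (part F s _); apply/funext => y; rewrite !jump_sum prod_sums.
Qed.

End Bilinear.

(** A vertex set of size 4 has sixteen subsets, and a face has two neighbours. *)
Lemma sum_over_faces (X : vset -> R) : (forall T, 0 <= X T) ->
  \sum_(F | cut_face P F) \sum_b X (nb F b) <= 32 * \sum_(T in elems M) X T.
Proof.
move=> X0; have [_ _ c4 _ _] := conf.
apply: (@le_trans _ _ (\sum_(F | cut_face P F) \sum_(b : bool)
    \sum_(T in elems M) if F \subset T then X T else 0)).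
  apply: ler_sum => F cF; apply: ler_sum => b _; have [TM FT _] := nbP b cF.
  rewrite (bigD1 (nb F b))//= FT lerDl sumr_ge0// => T _; by case: ifP.
apply: (@le_trans _ _ (\sum_(F : vset) \sum_(T in elems M) 2 * (if F \subset T then X T else 0))).
  rewrite [leRHS](bigID (@cut_face _ P M))/= -[leLHS]addr0 lerD//.
    apply: ler_sum => F _; rewrite big_bool -big_split/=; apply: ler_sum => T _.
    by rewrite mulrDl mul1r.
  by apply: sumr_ge0 => F _; apply: sumr_ge0 => T _; case: ifP; rewrite ?mulr0// mulr_ge0.
rewrite exchange_big/= mulr_sumr; apply: ler_sum => T TM.
rewrite -mulr_sumr -big_mkcond/= sumr_const -[X T *+ _]mulr_natl.
have -> : #|[pred F : vset | F \subset T]| = 16%N.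
  have -> : 16%N = #|powerset T| by rewrite card_powerset c4.
  by apply: eq_card => F; rewrite !inE.
by rewrite mulrA; rewrite -natrM.
Qed.

(** Inside an element the interface stays in a thin slab; the cube is taken in the
    half of the inscribed ball pointing away from the slab. *)
Lemma subcube (T : vset) : T \in elems M ->
  exists lo, box lo (rho * h / 4) `<=` open_simplex T `\` Gamma P.
Proof.
move=> TM; have [k [G bT]] := elem_bary conf fat rho0 h0 TM.
have [c cT] := (fat TM).1; have r0 : 0 < rho * h by exact: mulr_gt0.
have er := e_rho; have hp := h0; have ep := e0.
have inT c' y : enorm (c' - c) <= rho * h / 2 -> enorm (y - c') <= rho * h / 4 -> open_simplex T y.
  move=> h1 h2; apply/(open_simplex_bary bT) => i iT.
  apply: (bary_interior_ball conf TM bT cT iT).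
  have -> : y - c = (y - c') + (c' - c) by rewrite addrA subrK.
  by rewrite (le_lt_trans (enormD _ _))//; lra.
have bx c' y : box (c' - const_mx (rho * h / 8)) (rho * h / 4) y -> enorm (y - c') <= rho * h / 4.
  move=> hy; have -> : rho * h / 4 = 2 * (rho * h / 8) by field.
  apply: enorm_le_coord => i; have := hy i; rewrite !mxE => /andP[h1 h2].
  by rewrite ler_norml; apply/andP; split; lra.
have [cutT|nT] := pselect (cut (Gamma P) T); last first.
  exists (c - const_mx (rho * h / 8)) => y /bx yc.
  have Ty : open_simplex T y by apply: (inT c) => //; rewrite subrr enorm0; lra.
  by split=> // Gy; apply: nT; exists y.
have [q [Tq Gq]] := cutT.
have [_ [n [n1 Hn]]] := flat Gq.
have [c' [cc' qc']] : exists c', enorm (c' - c) <= rho * h / 2 /\ rho * h / 2 <= `|dot n (c' - q)|.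
  have en := unit_enorm n1.
  have [g0|g0] := leP 0 (dot n (c - q)).
    exists (c + (rho * h / 2) *: n); split.
      by rewrite addrAC subrr add0r enormZ en mulr1 ger0_norm// divr_ge0// ltW.
    by rewrite addrAC dotDr dotZr n1 mulr1 ger0_norm; lra.
  exists (c - (rho * h / 2) *: n); split.
    by rewrite addrAC subrr add0r enormN enormZ en mulr1 ger0_norm// divr_ge0// ltW.
  by rewrite addrAC dotBr dotZr n1 mulr1 ler0_norm; lra.
exists (c' - const_mx (rho * h / 8)) => y /bx yc.
have Ty : open_simplex T y by exact: (inT c').
split=> // Gy.
have Tq' := open_simplex_sub bT Tq; have Ty' := open_simplex_sub bT Ty.
have bq z : simplex T z -> ball q (2 * h) z by exact: (elem_in_ball cubic h0 TM Tq').
have [/(_ Gy) Hyq _] := Hn y q (bq y Ty') (bq q Tq') Gq.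
have yq : enorm (y - q) <= 2 * h by exact: (elem_diam cubic TM).
have eyq : e * enorm (y - q) <= e * (2 * h) by rewrite ler_pM2l.
have hc : `|dot n (c' - q)| <= `|dot n (y - q)| + enorm (y - c').
  have -> : c' - q = (y - q) - (y - c').
    by apply: row3P; rewrite !mxE; ring.
  rewrite dotBr (le_trans (ler_normB _ _))// lerD2l (le_trans (dot_le_enorm _ _))//.
  by rewrite (unit_enorm n1) mul1r.
have : 16 * (e * h) <= rho * h by rewrite mulrA ler_pM2r.
have : 0 < e * h by rewrite mulr_gt0.
by lra.
Qed.

Lemma piece_volumes (T : vset) : T \in elems M ->
  [/\ forall s, volume (piece P T s) <= (3 * h) ^+ 3,
      forall s, 0 <= volume (piece P T s) &
      (rho * h / 4) ^+ 3 <= volume (piece P T true) + volume (piece P T false)].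
Proof.
move=> TM; have hp := h0; have rp := rho0; have [lo Tlo] := elem_box conf cubic fat rho0 h0 TM.
have h30 : 0 <= 3 * h by lra.
have op s : open (piece P T s) by exact: (piece_open HP conf fat rho0 h0).
split=> [s|s|].
- apply: (volume_le_box (lo := lo)) => // y [Ty _]; exact: Tlo.
- by rewrite fine_ge0.
- have [lo' lo'T] := subcube TM.
  apply: (volume_ge_box (lo := lo') (hi := lo) (t := 3 * h)) => //.
  + by rewrite divr_ge0// mulr_ge0// ltW.
  + by move=> y [[Ty _]|[Ty _]]; exact: Tlo.
  + exact: (piece_disjoint HP).
  + by rewrite -(off_interface HP conf fat rho0 h0 TM).
Qed.

Lemma face_facts (F : vset) : cut_face P F ->
  [/\ 2 * rho * h <= diameter (simplex F), diameter (simplex F) <= 2 * h &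
      tri_area (vertex F 0) (vertex F 1) (vertex F 2) <= (2 * h) ^+ 2].
Proof.
move=> cF; have /asboolP[isF _] := cF; have [_ [T TM FT]] := isF.
have [i [j [l [[iF jF lF] [-> -> ->] [_ uF]]]]] := face_vertices isF.
have ij : i != j by move: uF; rewrite /= !inE negb_or => /andP[/andP[]].
have dT u v : simplex F u -> simplex F v -> enorm (u - v) <= 2 * h.
  by move=> Fu Fv; apply: (elem_diam cubic TM); exact: (simplex_subset FT).
have ub : ubound [set d | exists p q, [/\ simplex F p, simplex F q & d = enorm (p - q)]] (2 * h).
  by move=> _ [p [q [Fp Fq ->]]]; exact: dT.
have [[Fi Fj] Fl] := (node_simplex iF, node_simplex jF, node_simplex lF).
split.
- have iT := fintype.subsetP FT i iF; have jT := fintype.subsetP FT j jF.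
  apply: (le_trans (edge_length conf fat rho0 h0 TM iT jT ij)).
  by apply: ub_le_sup; [exists (2 * h)|exists (node i), (node j)].
- by apply: ge_sup => //; exists (enorm (node i - node i)), (node i), (node i).
- by apply: tri_area_le; exact: dT.
Qed.

Let bmax := Num.max (beta_p P) (beta_m P).
Let bmin := Num.min (beta_p P) (beta_m P).

Lemma beta_itv s : bmin <= beta_side P s <= bmax.
Proof. by rewrite /bmin /bmax; case: s; rewrite /= ge_min le_max !lexx ?orbT. Qed.

Lemma bmin_gt0 : 0 < bmin.
Proof. by rewrite lt_min (beta_gt0 HP true) (beta_gt0 HP false). Qed.

Lemma face_flux_le be F s (X : bool -> R) : cut_face P F ->
  (forall b, enorm (be s (nb F b)) <= X b) ->
  `|flux be F s| <= bmax * ((X true + X false) / 2).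
Proof.
move=> /asboolP[isF _] bX; have [n1 _] := nF_normal isF.
have /andP[b1 b2] := beta_itv s; have bs := beta_gt0 HP s.
rewrite /face_flux -mulrDr -mulrA normrM gtr0_norm//.
have d b : `|dot (be s (nb F b)) (nF F)| <= X b.
  by rewrite (le_trans (dot_le_enorm _ _))// n1 mulr1.
apply: ler_pM => //; first exact: ltW.
rewrite normrM (@ger0_norm _ 2^-1)// ler_wpM2r//.
rewrite (le_trans (ler_normD _ _))//; have := (d true, d false) => -[]; lra.
Qed.

Section Coercivity.
Variables (C : R) (al : bool -> vset -> R) (be : bool -> vset -> pt).
Hypothesis C0 : 0 < C.
Hypothesis equiv : forall T s s', T \in elems M -> enorm (be s T) <= C * enorm (be s' T).

(** Young's inequality hides the flux terms in the penalty and, up to a factor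
    inversely proportional to [sigma], in the energy of the neighbours. *)
Lemma face_young F s : cut_face P F ->
  - (8 * bmax ^+ 2 * C ^+ 2 / sigma * h ^+ 3 *
     (enorm (be false (nb F true)) ^+ 2 + enorm (be false (nb F false)) ^+ 2)) <=
  sigma / diameter (simplex F) * part F s (fun y => fjump al be F s y * fjump al be F s y)
  - 2 * part F s (fun y => flux be F s * fjump al be F s y).
Proof.
move=> cF; have [d1 d2 ar] := face_facts cF; have hp := h0; have sp := sigma0.
set dm := diameter _ in d1 d2 *; set f := flux be F s; set j := fjump al be F s.
have dm0 : 0 < dm by apply: lt_le_trans d1; rewrite !mulr_gt0.
have nj : face_nice P F s j by exact: face_jump_nice.
have njj : face_nice P F s (fun y => j y * j y) by exact: face_nice_mul.
have nfj : face_nice P F s (fun y => f * j y) by exact: (face_nice_scale HP).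
have n1 : face_nice P F s (fun=> 1).
  by apply: bm_cst; apply: tri_domain_measurable; exact: side_open.
have [nA EA] := face_part_lin (sigma / dm) (- 2) njj nfj.
have [nB EB] := face_part_lin 1 (dm / sigma * f ^+ 2) nA n1.
have pos : 0 <= part F s (fun y => 1 * (sigma / dm * (j y * j y) + - 2 * (f * j y)) +
    dm / sigma * f ^+ 2 * 1).
  apply: tri_part_ge0 => st _; set jy := j _.
  have -> : 1 * (sigma / dm * (jy * jy) + - 2 * (f * jy)) + dm / sigma * f ^+ 2 * 1 =
      sigma / dm * (jy - dm / sigma * f) ^+ 2 by field; rewrite !gt_eqF.
  by rewrite mulr_ge0 ?sqr_ge0// divr_ge0// ltW.
rewrite EB EA mul1r in pos.
have p1 : `|part F s (fun=> 1)| <= (2 * h) ^+ 2.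
  apply: (le_trans _ ar); rewrite -[leRHS]mulr1; apply: tri_part_bound => //.
    exact: side_open.
  by move=> st _; rewrite normr1.
have f2 : f ^+ 2 <= bmax ^+ 2 * C ^+ 2 *
    (enorm (be false (nb F true)) ^+ 2 + enorm (be false (nb F false)) ^+ 2).
  have fb : `|f| <= bmax * ((C * enorm (be false (nb F true)) + C * enorm (be false (nb F false))) / 2).
    apply: (face_flux_le (X := fun b => C * enorm (be false (nb F b)))) => // b.
    by have [TM _ _] := nbP b cF; exact: equiv.
  set u := enorm _ in fb *; set v := enorm _ in fb *.
  have bm0 : 0 <= bmax by have /andP[_] := beta_itv true; have := beta_gt0 HP true; lra.
  rewrite -real_normK ?num_real//.
  apply: (@le_trans _ _ ((bmax * ((C * u + C * v) / 2)) ^+ 2)).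
    by rewrite lerXn2r ?nnegrE// (le_trans _ fb).
  have -> : (bmax * ((C * u + C * v) / 2)) ^+ 2 = (bmax ^+ 2 * C ^+ 2) * ((u + v) ^+ 2 / 4) by field.
  apply: ler_wpM2l; first by apply: mulr_ge0; exact: sqr_ge0.
  by have := (sqr_ge0 (u - v), sqr_ge0 u, sqr_ge0 v) => -[[]]; lra.
set S := _ + _ in f2 *.
have ds : dm / sigma * f ^+ 2 * part F s (fun=> 1) <=
    2 * h / sigma * (bmax ^+ 2 * C ^+ 2 * S) * (2 * h) ^+ 2.
  apply: ler_pM.
  - by rewrite mulr_ge0 ?sqr_ge0// divr_ge0// ltW.
  - by apply: tri_part_ge0.
  - apply: ler_pM => //; rewrite ?sqr_ge0//; first by rewrite divr_ge0// ltW.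
    by rewrite ler_pM2r// invr_gt0.
  - exact: le_trans (ler_norm _) p1.
have -> : 8 * bmax ^+ 2 * C ^+ 2 / sigma * h ^+ 3 * S =
    2 * h / sigma * (bmax ^+ 2 * C ^+ 2 * S) * (2 * h) ^+ 2 by ring.
by lra.
Qed.

(** The pieces have comparable gradients and their volumes add up to a fixed part
    of [h ^+ 3], however unevenly the interface cuts the element. *)
Lemma element_energy T : T \in elems M ->
  bmin * (rho / 4) ^+ 3 / C ^+ 2 * h ^+ 3 * enorm (be false T) ^+ 2 <=
  \sum_s beta_side P s * dot (be s T) (be s T) * volume (piece P T s).
Proof.
move=> TM; have [_ v0 vge] := piece_volumes TM; have b0 := bmin_gt0.
have cp := C0.
have key s : bmin * (enorm (be false T) / C) ^+ 2 <= beta_side P s * dot (be s T) (be s T).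
  have /andP[b1 _] := beta_itv s.
  apply: ler_pM => //; rewrite ?sqr_ge0//; first exact: ltW.
  rewrite -sqr_enorm lerXn2r ?nnegrE ?divr_ge0 ?enorm_ge0// ?(ltW cp)//.
  by rewrite ler_pdivrMr// mulrC; exact: equiv.
have kv s : bmin * (enorm (be false T) / C) ^+ 2 * volume (piece P T s) <=
    beta_side P s * dot (be s T) (be s T) * volume (piece P T s).
  by rewrite ler_wpM2r.
rewrite big_bool; apply: (le_trans _ (lerD (kv true) (kv false))).
rewrite -mulrDr; apply: (@le_trans _ _ (bmin * (enorm (be false T) / C) ^+ 2 * (rho * h / 4) ^+ 3)).
  by rewrite le_eqVlt; apply/orP; left; apply/eqP; field; rewrite gt_eqF.
by rewrite ler_wpM2l// mulr_ge0 ?sqr_ge0// ltW.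
Qed.

(** The losses of [face_young] are shared among the elements: two sides [s], the
    constant 8, and [sum_over_faces]. *)
Lemma Bform_coercive :
  (bmin * (rho / 4) ^+ 3 / C ^+ 2 - 512 * bmax ^+ 2 * C ^+ 2 / sigma) * h ^+ 3 *
    \sum_(T in elems M) enorm (be false T) ^+ 2 <= Bf al be al be.
Proof.
have sp := sigma0; have hp := h0.
set E := \sum_(T in elems M) _.
have el : bmin * (rho / 4) ^+ 3 / C ^+ 2 * h ^+ 3 * E <=
    \sum_(T in elems M) \sum_s beta_side P s * dot (be s T) (be s T) * volume (piece P T s).
  by rewrite mulr_sumr; apply: ler_sum => T TM; exact: element_energy.
pose q F := enorm (be false (nb F true)) ^+ 2 + enorm (be false (nb F false)) ^+ 2.
pose Y := 8 * bmax ^+ 2 * C ^+ 2 / sigma * h ^+ 3.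
have Y0 : 0 <= Y.
  by rewrite mulr_ge0 ?exprn_ge0 ?(ltW hp)// divr_ge0 ?(ltW sp)// mulr_ge0 ?sqr_ge0// mulr_ge0 ?sqr_ge0.
have fa F : cut_face P F -> - (2 * Y * q F) <=
    sigma / diameter (simplex F) * \sum_s part F s (fun y => fjump al be F s y * fjump al be F s y)
    - 2 * \sum_s part F s (fun y => flux be F s * fjump al be F s y).
  move=> cF; have := (face_young true cF, face_young false cF) => -[].
  by rewrite !big_bool -/(q F) -/Y !mulrDr; lra.
have sumq : \sum_(F | cut_face P F) q F <= 32 * E.
  have := sum_over_faces (X := fun T => enorm (be false T) ^+ 2) (fun T => sqr_ge0 _).
  apply: le_trans; rewrite le_eqVlt; apply/orP; left; apply/eqP.
  by apply: eq_bigr => F _; rewrite big_bool.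
rewrite /Bform.
set E1 := \sum_(T in elems M) _ in el *; set S1 := \sum_(F | _) _; set S2 := \sum_(F | _) _.
have : - (2 * Y * (32 * E)) <= S2 - 2 * S1.
  apply: (@le_trans _ _ (\sum_(F | cut_face P F) - (2 * Y * q F))).
    by rewrite sumrN lerN2 -mulr_sumr ler_wpM2l// mulr_ge0.
  rewrite /S1 /S2 mulr_sumr -sumrB; apply: ler_sum => F cF.
  exact: fa.
have -> : (bmin * (rho / 4) ^+ 3 / C ^+ 2 - 512 * bmax ^+ 2 * C ^+ 2 / sigma) * h ^+ 3 * E =
    bmin * (rho / 4) ^+ 3 / C ^+ 2 * h ^+ 3 * E - 2 * Y * (32 * E) by rewrite /Y; ring.
by lra.
Qed.

End Coercivity.

Section Boundedness.
Variables (C : R) (al al' : bool -> vset -> R) (be be' : bool -> vset -> pt) (X X' : vset -> R).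
Hypothesis C0 : 0 < C.
Hypotheses (X0 : forall T, 0 <= X T) (X0' : forall T, 0 <= X' T).
Hypothesis grad_le : forall T s, T \in elems M -> enorm (be s T) <= C * X T / h.
Hypothesis grad_le' : forall T s, T \in elems M -> enorm (be' s T) <= C * X' T / h.
Hypothesis val_le : forall T s y, T \in elems M -> simplex T y ->
  `|al s T + dot (be s T) y| <= C * X T.
Hypothesis val_le' : forall T s y, T \in elems M -> simplex T y ->
  `|al' s T + dot (be' s T) y| <= C * X' T.

Lemma bmax_ge0 : 0 <= bmax.
Proof. by have /andP[_] := beta_itv true; have := beta_gt0 HP true; lra. Qed.

Lemma element_bounded T : T \in elems M ->
  `|\sum_s beta_side P s * dot (be s T) (be' s T) * volume (piece P T s)| <=
  27 * bmax * C ^+ 2 * h * (X T ^+ 2 + X' T ^+ 2).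
Proof.
move=> TM; have [v1 v0 _] := piece_volumes TM; have hp := h0; have b0 := bmax_ge0.
have key s : `|beta_side P s * dot (be s T) (be' s T) * volume (piece P T s)| <=
    bmax * (C * X T / h * (C * X' T / h)) * (3 * h) ^+ 3.
  rewrite !normrM (ger0_norm (v0 s)) (gtr0_norm (beta_gt0 HP s)).
  have /andP[_ b2] := beta_itv s; have bs := beta_gt0 HP s.
  apply: ler_pM => //; first by rewrite mulr_ge0// ltW.
  apply: ler_pM => //; first exact: ltW.
  rewrite (le_trans (dot_le_enorm _ _))// ler_pM ?enorm_ge0//; [exact: grad_le|exact: grad_le'].
rewrite big_bool (le_trans (ler_normD _ _))// (le_trans (lerD (key true) (key false)))//.
have -> : bmax * (C * X T / h * (C * X' T / h)) * (3 * h) ^+ 3 +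
    bmax * (C * X T / h * (C * X' T / h)) * (3 * h) ^+ 3 =
    27 * bmax * C ^+ 2 * h * (2 * X T * X' T) by field; rewrite gt_eqF.
have c0 : 0 <= 27 * bmax * C ^+ 2 * h.
  by rewrite mulr_ge0 ?(ltW hp)// mulr_ge0 ?sqr_ge0// mulr_ge0.
by rewrite ler_wpM2l//; have := sqr_ge0 (X T - X' T); lra.
Qed.

Lemma face_jump_le (b : bool -> vset -> pt) (a : bool -> vset -> R) (Z : vset -> R) F s y :
  (forall T s y, T \in elems M -> simplex T y -> `|a s T + dot (b s T) y| <= C * Z T) ->
  cut_face P F -> open_simplex F y ->
  `|fjump a b F s y| <= C * (Z (nb F true) + Z (nb F false)).
Proof.
move=> vl cF Fy; rewrite /face_jump (le_trans (ler_normB _ _))// mulrDr addrC.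
have Fy' : simplex F y by have [l [l0 l1 E]] := Fy; exists l; split=> // i /l0/ltW.
by apply: lerD; [have [TM FT _] := nbP true cF|have [TM FT _] := nbP false cF];
  apply: vl => //; exact: (simplex_subset FT).
Qed.

End Boundedness.

Lemma flux_term_bounded (C : R) a b b' (Z Z' : vset -> R) F s : 0 < C ->
  (forall T, 0 <= Z T) -> (forall T, 0 <= Z' T) ->
  (forall T s, T \in elems M -> enorm (b' s T) <= C * Z' T / h) ->
  (forall T s y, T \in elems M -> simplex T y -> `|a s T + dot (b s T) y| <= C * Z T) ->
  cut_face P F ->
  `|part F s (fun y => flux b' F s * fjump a b F s y)| <=
  2 * bmax * C ^+ 2 * h * \sum_b0 (Z (nb F b0) ^+ 2 + Z' (nb F b0) ^+ 2).
Proof.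
move=> C0 Z0 Z0' gl vl cF; have hp := h0; have [_ _ ar] := face_facts cF; have b0 := bmax_ge0.
have /asboolP[isF _] := cF.
have fl : `|flux b' F s| <= bmax * ((C * Z' (nb F true) / h + C * Z' (nb F false) / h) / 2).
  apply: (face_flux_le (X := fun b => C * Z' (nb F b) / h)) => // u.
  by have [TM _ _] := nbP u cF; exact: gl.
have z i : 0 <= Z (nb F i) by []. have z' i : 0 <= Z' (nb F i) by [].
set Q := bmax * ((C * Z' (nb F true) / h + C * Z' (nb F false) / h) / 2) *
  (C * (Z (nb F true) + Z (nb F false))).
have Q0 : 0 <= Q by rewrite mulr_ge0 ?(le_trans _ fl)// mulr_ge0 ?addr_ge0// ltW.
have : `|part F s (fun y => flux b' F s * fjump a b F s y)| <= (2 * h) ^+ 2 * Q.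
  apply: (@le_trans _ _ (tri_area (vertex F 0) (vertex F 1) (vertex F 2) * Q)).
    apply: tri_part_bound => //; first exact: side_open.
      by apply: (face_nice_scale HP); exact: face_jump_nice.
    move=> st hst; rewrite normrM ler_pM//.
    by apply: face_jump_le => //; exact: tri_domain_face hst.
  by rewrite ler_wpM2r.
move=> /le_trans; apply.
have -> : (2 * h) ^+ 2 * Q = 2 * bmax * C ^+ 2 * h *
    ((Z' (nb F true) + Z' (nb F false)) * (Z (nb F true) + Z (nb F false))).
  by rewrite /Q; field; rewrite gt_eqF.
have c0 : 0 <= 2 * bmax * C ^+ 2 * h.
  by rewrite mulr_ge0 ?(ltW hp)// mulr_ge0 ?sqr_ge0// mulr_ge0.
rewrite ler_wpM2l// big_bool/=.
have := (sqr_ge0 (Z (nb F true) - Z' (nb F true)), sqr_ge0 (Z (nb F true) - Z' (nb F false)),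
  sqr_ge0 (Z (nb F false) - Z' (nb F true)), sqr_ge0 (Z (nb F false) - Z' (nb F false))) => -[[[]]].
by lra.
Qed.

Lemma penalty_term_bounded (C : R) a b a' b' (Z Z' : vset -> R) F s : 0 < C ->
  (forall T, 0 <= Z T) -> (forall T, 0 <= Z' T) ->
  (forall T s y, T \in elems M -> simplex T y -> `|a s T + dot (b s T) y| <= C * Z T) ->
  (forall T s y, T \in elems M -> simplex T y -> `|a' s T + dot (b' s T) y| <= C * Z' T) ->
  cut_face P F ->
  `|sigma / diameter (simplex F) * part F s (fun y => fjump a b F s y * fjump a' b' F s y)| <=
  2 * sigma / rho * C ^+ 2 * h * \sum_b0 (Z (nb F b0) ^+ 2 + Z' (nb F b0) ^+ 2).
Proof.
move=> C0 Z0 Z0' vl vl' cF; have hp := h0; have rp := rho0; have sp := sigma0.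
have [d1 _ ar] := face_facts cF; have /asboolP[isF _] := cF.
have z i : 0 <= Z (nb F i) by []. have z' i : 0 <= Z' (nb F i) by [].
set Q := C * (Z (nb F true) + Z (nb F false)) * (C * (Z' (nb F true) + Z' (nb F false))).
have Q0 : 0 <= Q by rewrite !mulr_ge0 ?addr_ge0// ltW.
have pb : `|part F s (fun y => fjump a b F s y * fjump a' b' F s y)| <= (2 * h) ^+ 2 * Q.
  apply: (@le_trans _ _ (tri_area (vertex F 0) (vertex F 1) (vertex F 2) * Q)).
    apply: tri_part_bound => //; first exact: side_open.
      by apply: face_nice_mul; exact: face_jump_nice.
    move=> st hst; rewrite normrM ler_pM//;
    by apply: face_jump_le => //; exact: tri_domain_face hst.
  by rewrite ler_wpM2r.
set dm := diameter _ in d1 *.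
have r0 : 0 < 2 * rho * h by rewrite !mulr_gt0.
have dm0 : 0 < dm by apply: lt_le_trans d1.
have sd : sigma / dm <= sigma / (2 * rho * h) by rewrite ler_pM2l// lef_pV2 ?posrE.
rewrite normrM (@gtr0_norm _ (sigma / dm)); last by rewrite divr_gt0.
apply: (@le_trans _ _ (sigma / (2 * rho * h) * ((2 * h) ^+ 2 * Q))).
  by rewrite ler_pM// divr_ge0// ltW.
have -> : sigma / (2 * rho * h) * ((2 * h) ^+ 2 * Q) = 2 * sigma / rho * C ^+ 2 * h *
    ((Z (nb F true) + Z (nb F false)) * (Z' (nb F true) + Z' (nb F false))).
  by rewrite /Q; field; rewrite !gt_eqF.
have c0 : 0 <= 2 * sigma / rho * C ^+ 2 * h.
  rewrite mulr_ge0 ?(ltW hp)//; apply: mulr_ge0; last exact: sqr_ge0.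
  by rewrite divr_ge0 ?(ltW rp)// mulr_ge0// ltW.
rewrite ler_wpM2l// big_bool/=.
have := (sqr_ge0 (Z (nb F true) - Z' (nb F true)), sqr_ge0 (Z (nb F true) - Z' (nb F false)),
  sqr_ge0 (Z (nb F false) - Z' (nb F true)), sqr_ge0 (Z (nb F false) - Z' (nb F false))) => -[[[]]].
by lra.
Qed.

Lemma Bform_bounded (C : R) al be al' be' (X X' : vset -> R) : 0 < C ->
  (forall T, 0 <= X T) -> (forall T, 0 <= X' T) ->
  (forall T s, T \in elems M -> enorm (be s T) <= C * X T / h) ->
  (forall T s, T \in elems M -> enorm (be' s T) <= C * X' T / h) ->
  (forall T s y, T \in elems M -> simplex T y -> `|al s T + dot (be s T) y| <= C * X T) ->
  (forall T s y, T \in elems M -> simplex T y -> `|al' s T + dot (be' s T) y| <= C * X' T) ->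
  `|Bf al be al' be'| <= (283 * bmax + 128 * sigma / rho) * C ^+ 2 * h *
    \sum_(T in elems M) (X T ^+ 2 + X' T ^+ 2).
Proof.
move=> C0 X0 X0' gl gl' vl vl'; have hp := h0; have rp := rho0; have sp := sigma0; have b0 := bmax_ge0.
set S := \sum_(T in elems M) _.
pose W F := \sum_b (X (nb F b) ^+ 2 + X' (nb F b) ^+ 2).
have sumW : \sum_(F | cut_face P F) W F <= 32 * S.
  by apply: (sum_over_faces (X := fun T => X T ^+ 2 + X' T ^+ 2)) => T; rewrite addr_ge0 ?sqr_ge0.
have face_sum (t : vset -> R) (c : R) : 0 <= c ->
    (forall F, cut_face P F -> `|t F| <= c * W F) -> `|\sum_(F | cut_face P F) t F| <= 32 * c * S.
  move=> c0 tW; rewrite (le_trans (ler_norm_sum _ _ _))//.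
  apply: (@le_trans _ _ (\sum_(F | cut_face P F) c * W F)); first exact: ler_sum.
  by rewrite -mulr_sumr [32 * c]mulrC -mulrA ler_wpM2l.
pose A1 := 4 * bmax * C ^+ 2 * h; pose A2 := 4 * sigma / rho * C ^+ 2 * h.
have C2 : 0 <= C ^+ 2 by exact: sqr_ge0.
have A10 : 0 <= A1 by rewrite !mulr_ge0// ltW.
have A20 : 0 <= A2 by rewrite mulr_ge0 ?(ltW hp)// mulr_ge0// divr_ge0 ?(ltW rp)// mulr_ge0// ltW.
have t1 : `|\sum_(T in elems M) \sum_s beta_side P s * dot (be s T) (be' s T) * volume (piece P T s)|
    <= 27 * bmax * C ^+ 2 * h * S.
  rewrite (le_trans (ler_norm_sum _ _ _))// mulr_sumr; apply: ler_sum => T TM.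
  exact: element_bounded.
have t2 : `|\sum_(F | cut_face P F) \sum_s part F s (fun y => flux be F s * fjump al' be' F s y)|
    <= 32 * A1 * S.
  apply: face_sum => // F cF; rewrite big_bool (le_trans (ler_normD _ _))//.
  have k s := flux_term_bounded s C0 X0' X0 gl vl' cF.
  apply: (le_trans (lerD (k true) (k false))); rewrite -mulrDl /A1 /W.
  rewrite le_eqVlt; apply/orP; left; apply/eqP; congr (_ * _); first ring.
  by apply: eq_bigr => b _; rewrite addrC.
have t3 : `|\sum_(F | cut_face P F) \sum_s part F s (fun y => flux be' F s * fjump al be F s y)|
    <= 32 * A1 * S.
  apply: face_sum => // F cF; rewrite big_bool (le_trans (ler_normD _ _))//.
  have k s := flux_term_bounded s C0 X0 X0' gl' vl cF.
  apply: (le_trans (lerD (k true) (k false))); rewrite -mulrDl /A1 /W.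
  by rewrite le_eqVlt; apply/orP; left; apply/eqP; congr (_ * _); ring.
have t4 : `|\sum_(F | cut_face P F) sigma / diameter (simplex F) *
    \sum_s part F s (fun y => fjump al be F s y * fjump al' be' F s y)| <= 32 * A2 * S.
  apply: face_sum => // F cF; rewrite big_bool mulrDr (le_trans (ler_normD _ _))//.
  have k s := penalty_term_bounded s C0 X0 X0' vl vl' cF.
  apply: (le_trans (lerD (k true) (k false))); rewrite -mulrDl /A2 /W.
  by rewrite le_eqVlt; apply/orP; left; apply/eqP; congr (_ * _); ring.
have -> : (283 * bmax + 128 * sigma / rho) * C ^+ 2 * h * S =
    27 * bmax * C ^+ 2 * h * S + 32 * A1 * S + 32 * A1 * S + 32 * A2 * S.
  by rewrite /A1 /A2; ring.
rewrite /Bform (le_trans (ler_normD _ _))// lerD// (le_trans (ler_normB _ _))// lerD//.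
by rewrite (le_trans (ler_normB _ _))// lerD.
Qed.

End FormBounds.

(** * Condition numbers from a coercive and bounded form *)

Section ConditionNumber.
Variables (R : realType) (n : nat) (A : 'M[R]_n).

Definition vdot (y x : 'cV[R]_n) : R := \sum_i y i 0 * x i 0.

Lemma sqr_enorm_col (x : 'cV[R]_n) : enorm x ^+ 2 = \sum_i x i 0 ^+ 2.
Proof.
rewrite sqr_sqrtr; last by apply: sumr_ge0 => i _; apply: sumr_ge0 => j _; exact: sqr_ge0.
by apply: eq_bigr => i _; rewrite big_ord1.
Qed.

Lemma vdotvv x : vdot x x = enorm x ^+ 2.
Proof. by rewrite sqr_enorm_col; apply: eq_bigr => i _; rewrite expr2. Qed.

Lemma vdot_amgm (k : R) y x : 0 < k ->
  vdot y x <= k / 2 * enorm y ^+ 2 + (2 * k)^-1 * enorm x ^+ 2.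
Proof.
move=> k0; rewrite !sqr_enorm_col !mulr_sumr -big_split/=; apply: ler_sum => i _.
rewrite -subr_ge0 (_ : _ - _ = k / 2 * (y i 0 - k^-1 * x i 0) ^+ 2).
  by rewrite mulr_ge0 ?sqr_ge0// divr_ge0// ltW.
by field; rewrite gt_eqF.
Qed.

Lemma enorm_col0 : enorm (0 : 'cV[R]_n) = 0.
Proof.
rewrite -[enorm _]ger0_norm ?enorm_ge0// -sqrtr_sqr sqr_enorm_col.
by rewrite big1 ?sqrtr0// => i _; rewrite mxE expr0n.
Qed.

Lemma vdotZl c y x : vdot (c *: y) x = c * vdot y x.
Proof. by rewrite /vdot mulr_sumr; apply: eq_bigr => i _; rewrite mxE mulrA. Qed.

Lemma enorm_colZ c (x : 'cV[R]_n) : enorm (c *: x) = `|c| * enorm x.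
Proof.
apply: (@pexpIrn _ 2); rewrite ?nnegrE ?mulr_ge0 ?enorm_ge0//.
rewrite exprMn !sqr_enorm_col real_normK ?num_real// mulr_sumr.
by apply: eq_bigr => i _; rewrite mxE exprMn.
Qed.

(** A coercivity constant [k] and a bound [K] of the quadratic form control the
    condition number; the bound on the image [A x] is obtained by testing the
    form with the normalized image. *)
Lemma kappa2_le (k K : R) : 0 < k -> 0 <= K ->
  (forall x : 'cV[R]_n, k * enorm x ^+ 2 <= vdot x (A *m x)) ->
  (forall x y : 'cV[R]_n, `|vdot y (A *m x)| <= K * (enorm x ^+ 2 + enorm y ^+ 2)) ->
  (kappa2 A <= (2 * K / k)%:E)%E.
Proof.
move=> k0 K0 coer bdd.
have uA : A \in unitmx.
  rewrite unitmxE unitfE -det_tr; apply/negP => /det0P[v v0 vA].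
  have Av : A *m v^T = 0 by rewrite -[A]trmxK -trmx_mul vA trmx0.
  have := coer v^T; rewrite Av (_ : vdot _ 0 = 0); last first.
    by rewrite /vdot big1// => i _; rewrite !mxE mulr0.
  rewrite pmulr_rle0// sqr_enorm_col => h.
  case/negP: v0; apply/eqP/rowP => i; rewrite mxE.
  have : v^T i 0 ^+ 2 <= 0.
    apply: le_trans h; rewrite (bigD1 i)//= lerDl.
    by apply: sumr_ge0 => j _; exact: sqr_ge0.
  by rewrite mxE exprn_even_le0//= => /eqP.
rewrite /kappa2 uA lee_fin.
have boundA : ubound [set enorm (A *m x) | x in [set x : 'cV[R]_n | enorm x <= 1]] (2 * K).
  move=> _ [x /= x1 <-]; set z := A *m x.
  have [z0|z0] := eqVneq (enorm z) 0; first by rewrite z0 mulr_ge0.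
  have zp : 0 < enorm z by rewrite lt_neqAle eq_sym z0 enorm_ge0.
  have := bdd x ((enorm z)^-1 *: z); rewrite vdotZl vdotvv enorm_colZ.
  rewrite (@ger0_norm _ (enorm z)^-1) ?invr_ge0 ?enorm_ge0// mulVf// expr1n.
  rewrite expr2 mulrA mulVf// mul1r ger0_norm ?enorm_ge0// => /le_trans; apply.
  have : enorm x ^+ 2 <= 1 by rewrite exprn_ile1// enorm_ge0.
  by move=> x2; rewrite mulrC ler_wpM2r//; lra.
have boundV : ubound [set enorm (invmx A *m x) | x in [set x : 'cV[R]_n | enorm x <= 1]] k^-1.
  move=> _ [x /= x1 <-]; set z := invmx A *m x.
  have Az : A *m z = x by rewrite /z mulmxA mulmxV// mul1mx.
  have := coer z; rewrite Az => /le_trans/(_ (vdot_amgm z x k0)) h.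
  have x2 : enorm x ^+ 2 <= 1 by rewrite exprn_ile1// enorm_ge0.
  rewrite -(@ler_pXn2r _ 2) ?nnegrE ?enorm_ge0 ?invr_ge0 ?(ltW k0)//.
  rewrite -(ler_pM2l (_ : 0 < k / 2)) ?divr_gt0//.
  have -> : k / 2 * k^-1 ^+ 2 = (2 * k)^-1 by field; rewrite gt_eqF.
  have : (2 * k)^-1 * enorm x ^+ 2 <= (2 * k)^-1 * 1.
    by rewrite ler_wpM2l// invr_ge0 mulr_ge0// ltW.
  by rewrite mulr1; lra.
have mem0 (B : 'M[R]_n) : [set enorm (B *m x) | x in [set x : 'cV[R]_n | enorm x <= 1]] 0.
  by exists 0 => /=; rewrite ?mulmx0 enorm_col0.
apply: ler_pM.
- by apply: ub_le_sup; [exists (2 * K)|exact: mem0].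
- by apply: ub_le_sup; [exists k^-1|exact: mem0].
- by apply: ge_sup; [exists 0; exact: mem0|].
- by apply: ge_sup; [exists 0; exact: mem0|].
Qed.

End ConditionNumber.

(** * The stiffness matrix *)

Section BoundedDomain.
Variables (R : realType) (P : interface R).
Local Notation pt := 'rV[R]_3.
Hypothesis HP : interface_problem P.

Lemma Omega_bound : exists Bd, 0 < Bd /\ forall y, Omega P y -> forall i, `|y 0 i| <= Bd.
Proof.
have [[_ [N [_ HN]] _ _] _ _ _] := HP.
exists (`|N| + 2); split; first by rewrite ltr_wpDl.
move=> y Oy i; have := HN (`|N| + 1); rewrite (le_lt_trans (ler_norm N)) ?ltrDl// => /(_ isT y Oy) yN.
have : ball (0 : pt) (`|N| + 2) y.
  rewrite mx_norm_ball /ball_/= sub0r normrN; apply: (le_lt_trans yN); lra.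
by move=> /ballP[_ /(_ i)]; rewrite mxE subr0 => /ltW.
Qed.

Section OnMesh.
Variables (M : mesh R) (rho h Bd : R).
Local Notation vset := {set 'I_(nnodes M)}.
Local Notation nodes := 'I_(nnodes M).
Hypothesis conf : conforming_mesh M (Omega P).
Hypothesis cubic : subdivides_cubic_mesh M h.
Hypothesis fat : regular_elements M rho h.
Hypothesis rho0 : 0 < rho.
Hypothesis h0 : 0 < h.
Hypothesis h1 : h <= 1.
Hypothesis Bd0 : 0 < Bd.
Hypothesis Om_bounded : forall x, Omega P x -> forall i, `|x 0 i| <= Bd.

Let N := packing_number rho.

Lemma poincare (x : nodes -> R) : (forall i, ~ Omega P (node i) -> x i = 0) ->
  \sum_i x i ^+ 2 <= 4 * N%:R ^+ 3 * (2 * Bd + 1) ^+ 2 / h ^+ 2 * \sum_(T in elems M) osc x T.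
Proof.
move=> x0; have [a [K [region in_cell]]] := cubic; have hp := h0; have bp := Bd0; have hh := h1.
have := poincare_rows conf fat rho0 h0 Om_bounded region in_cell x0.
move/le_trans; apply; rewrite ler_wpM2r//.
  by apply: sumr_ge0 => T _; exact: osc_ge0.
have L : (row_length h Bd)%:R <= (2 * Bd + 1) / h :> R.
  have -> : (row_length h Bd)%:R = (Num.truncn (2 * Bd / h))%:R + 1 :> R by rewrite natr1.
  have b0 : 0 <= 2 * Bd / h by rewrite divr_ge0// ?mulr_ge0// ltW.
  have := truncn_le (2 * Bd / h); rewrite b0 => t1.
  have -> : (2 * Bd + 1) / h = 2 * Bd / h + h^-1 by field; rewrite gt_eqF.
  have : 1 <= h^-1 by rewrite invr_ge1// unitfE gt_eqF.
  by lra.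
have -> : 4 * N%:R ^+ 3 * (2 * Bd + 1) ^+ 2 / h ^+ 2 =
    (4 * N ^ 3)%:R * ((2 * Bd + 1) / h) ^+ 2 :> R.
  by rewrite natrM natrX; field; rewrite gt_eqF.
rewrite ler_wpM2l// lerXn2r ?nnegrE// divr_ge0 ?(ltW hp)//; lra.
Qed.

Lemma node_degree (i : nodes) : (#|[set T in elems M | i \in T]%SET| <= N)%N.
Proof.
apply: (packing conf fat rho0 h0 (y := node i)).
  by apply/fintype.subsetP => T; rewrite inE => /andP[].
move=> T; rewrite inE => /andP[TM iT] y Ty l; have hp := h0.
by have := elem_coord_diam cubic l TM Ty (node_simplex iT); lra.
Qed.

Lemma sum_over_elements (x : nodes -> R) :
  \sum_(T in elems M) \sum_(i in T) x i ^+ 2 <= N%:R * \sum_i x i ^+ 2.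
Proof.
under eq_bigr do rewrite big_mkcond/=.
rewrite exchange_big/= mulr_sumr; apply: ler_sum => i _.
rewrite -big_mkcondr/= sumr_const -[_ *+ _]mulr_natl ler_wpM2r ?sqr_ge0// ler_nat.
apply: leq_trans (node_degree i).
by rewrite leq_eqVlt; apply/orP; left; apply/eqP/eq_card => T; rewrite !inE.
Qed.

End OnMesh.
End BoundedDomain.

Section Stiffness.
Variables (R : realType) (P : interface R).
Local Notation pt := 'rV[R]_3.
Hypothesis HP : interface_problem P.
Variables (M : mesh R) (rho h e Bd C : R).
Local Notation vset := {set 'I_(nnodes M)}.
Local Notation nodes := 'I_(nnodes M).
Hypothesis conf : conforming_mesh M (Omega P).
Hypothesis cubic : subdivides_cubic_mesh M h.
Hypothesis fat : regular_elements M rho h.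
Hypothesis rho0 : 0 < rho.
Hypothesis h0 : 0 < h.
Hypothesis h1 : h <= 1.
Hypothesis Bd0 : 0 < Bd.
Hypothesis Om_bounded : forall x, Omega P x -> forall i, `|x 0 i| <= Bd.
Hypothesis e0 : 0 < e.
Hypothesis e_rho : 16 * e <= rho.
Hypothesis flat : forall q, Gamma P q -> flat_at P e (2 * h) q.
Variable D : vset -> 'I_3 -> pt.
Hypothesis C0 : 0 < C.
Hypothesis local : forall x al be, ife_data P D x al be -> forall T X, T \in elems M ->
  (forall i, i \in T -> `|x i| <= X) -> local_estimate h C T x (al^~ T) (be^~ T) X.
Variable nF : vset -> pt.
Hypothesis nF_normal : forall F, is_face F -> unit_normal (nF F) (simplex F).
Variable phi : nodes -> pt -> R.
Hypothesis phi_basis : nodal_basis P D phi.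
Variable sigma : R.

Let N := packing_number rho.
Let bmax := Num.max (beta_p P) (beta_m P).
Let bmin := Num.min (beta_p P) (beta_m P).
Let c1 := bmin * (rho / 4) ^+ 3 / C ^+ 2.
(* Half of the energy constant [c1] then survives the loss in [Bform_coercive]. *)
Hypothesis sigma_large : 1024 * bmax ^+ 2 * C ^+ 2 / c1 <= sigma.

Local Notation Nodes := (interior_nodes P M).
Local Notation A := (stiffness P nF sigma phi).

Definition nodal_values (x : 'cV[R]_#|Nodes|) (j : nodes) : R :=
  \sum_i x i 0 * (j == enum_val i)%:R.

Lemma nodal_values_boundary x j : ~ Omega P (node j) -> nodal_values x j = 0.
Proof.
move=> nO; rewrite /nodal_values big1// => i _.
have := enum_valP i; rewrite inE => /set_mem Oi.
by case: eqP => [E|_]; [rewrite E in nO|rewrite mulr0].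
Qed.

Lemma sum_nodal_values x : \sum_j nodal_values x j ^+ 2 = enorm x ^+ 2.
Proof.
rewrite sqr_enorm_col (bigID (mem Nodes))/= [X in _ + X]big1 ?addr0; last first.
  move=> j; rewrite inE => jN; rewrite nodal_values_boundary ?expr0n// => Oj.
  by move: jN; rewrite mem_set.
rewrite big_enum_val/=; apply: eq_bigr => i _; congr (_ ^+ 2).
rewrite /nodal_values (bigD1 i)//= eqxx mulr1 big1 ?addr0// => j ji.
by rewrite (inj_eq enum_val_inj) eq_sym (negbTE ji) mulr0.
Qed.

Lemma c1_gt0 : 0 < c1.
Proof.
by rewrite divr_gt0 ?exprn_gt0// mulr_gt0 ?exprn_gt0 ?divr_gt0//; exact: bmin_gt0.
Qed.

Lemma bmax_gt0 : 0 < bmax.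
Proof. by rewrite lt_max (beta_gt0 HP true). Qed.

Lemma sigma_gt0 : 0 < sigma.
Proof.
have b0 := bmax_gt0; have cc := c1_gt0; have cp := C0.
have : 0 < bmax ^+ 2 * C ^+ 2 / c1.
  by apply: divr_gt0 => //; apply: mulr_gt0; exact: exprn_gt0.
by have := sigma_large; lra.
Qed.

Definition coercivity_constant : R :=
  c1 / (128 * C ^+ 2 * N%:R ^+ 3 * (2 * Bd + 1) ^+ 2).

Definition boundedness_constant : R :=
  (283 * bmax + 128 * sigma / rho) * C ^+ 2 * N%:R.

Lemma bounded_factor_gt0 : 0 < 283 * bmax + 128 * sigma / rho.
Proof.
have b0 := bmax_gt0; have : 0 < sigma / rho by rewrite divr_gt0 ?sigma_gt0.
by lra.
Qed.

Lemma boundedness_constant_gt0 : 0 < boundedness_constant.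
Proof.
have N0 : 0 < N%:R :> R by rewrite ltr0n /N /packing_number expn_gt0.
have C2 : 0 < C ^+ 2 by exact: exprn_gt0.
exact: mulr_gt0 (mulr_gt0 bounded_factor_gt0 C2) N0.
Qed.

Lemma coercivity_constant_gt0 : 0 < coercivity_constant.
Proof.
have N0 : 0 < N%:R :> R by rewrite ltr0n /N /packing_number expn_gt0.
have bd := Bd0; have B1 : 0 < 2 * Bd + 1 by lra.
apply: divr_gt0; first exact: c1_gt0.
by do 3![apply: mulr_gt0; last exact: exprn_gt0].
Qed.

(** The data of a combination of basis functions are the combinations of their
    data, so the matrix entries add up to a single value of the form. *)
Lemma stiffness_form : exists al be nb,
  [/\ forall F b, cut_face P F -> [/\ nb F b \in elems M, F \subset nb F b &
        forall y, open_simplex F y ->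
          \forall t \near (0 : R)^'+, open_simplex (nb F b) (y + t *: side_dir nF b F)],
      forall x : 'cV_#|Nodes|, ife_data P D (nodal_values x)
        (fun s T => \sum_i x i 0 * al i s T) (fun s T => \sum_i x i 0 *: be i s T) &
      forall x y : 'cV_#|Nodes|, vdot y (A *m x) = Bform P nF nb sigma
        (fun s T => \sum_i x i 0 * al i s T) (fun s T => \sum_i x i 0 *: be i s T)
        (fun s T => \sum_i y i 0 * al i s T) (fun s T => \sum_i y i 0 *: be i s T)].
Proof.
have [nb nbP] := face_neighbours HP conf fat rho0 h0 nF_normal.
have /choice[d Hd] : forall i : 'I_#|Nodes|, exists d : (bool -> vset -> R) * (bool -> vset -> pt),
    represents P (phi (enum_val i)) d.1 d.2 /\
    ife_data P D (fun j => (j == enum_val i)%:R) d.1 d.2.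
  move=> i; have [sp pj] := phi_basis (enum_valP i).
  have [al [be [rep dat]]] := IFE_space_data HP sp.
  exists (al, be); split=> //=.
  by rewrite (_ : (fun j => _) = (fun j => phi (enum_val i) (node j))) //; apply/funext => j; rewrite pj.
exists (fun i => (d i).1), (fun i => (d i).2), nb; split=> //.
  move=> x; apply: (ife_data_sum (fun i => x i 0)
    (x := fun i j => (j == enum_val i)%:R)) => i.
  by have [] := Hd i.
move=> x y; rewrite (Bform_bilinear HP).
rewrite -(pair_bigA _ (fun i j => y i 0 * x j 0 *
  Bform P nF nb sigma (d j).1 (d j).2 (d i).1 (d i).2))/=.
apply: eq_bigr => i _; rewrite mxE mulr_sumr; apply: eq_bigr => j _; rewrite mxE.
have [ri _] := Hd i; have [rj _] := Hd j.
rewrite (a_h_data HP conf cubic fat rho0 h0 flat nbP sigma rj ri).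
by ring.
Qed.

(** Differences of nodal values are at most [h] times the gradients, and the
    Poincare inequality loses a factor [h ^- 2]: the energy, of the size of
    [h ^+ 3] times the squared gradients, is at least [h ^+ 3] times the squared
    nodal values. *)
Lemma stiffness_coercive (x : 'cV_#|Nodes|) :
  coercivity_constant * h ^+ 3 * enorm x ^+ 2 <= vdot x (A *m x).
Proof.
have [al [be [nb [nbP dat form]]]] := stiffness_form; rewrite form.
have hp := h0; have cp := C0; have sp := sigma_gt0; have cc := c1_gt0; have bp := Bd0.
have datx := dat x.
set a := (fun s T => \sum_i x i 0 * al i s T) in datx *.
set b := (fun s T => \sum_i x i 0 *: be i s T) in datx *.
pose X (T : vset) := \sum_(i in T) `|nodal_values x i|.
have xX (T : vset) i : i \in T -> `|nodal_values x i| <= X T.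
  by move=> iT; rewrite /X (bigD1 i)//= lerDl sumr_ge0.
have le (T : vset) : T \in elems M -> local_estimate h C T (nodal_values x) (a^~ T) (b^~ T) (X T).
  by move=> TM; apply: (local datx) => // i; exact: xX.
have eqv (T : vset) s s' : T \in elems M -> enorm (b s T) <= C * enorm (b s' T).
  by move=> TM; exact: (le_gradient_sides (le T TM)).
have := Bform_coercive HP conf cubic fat rho0 h0 e0 e_rho flat nF_normal nbP sp a C0 eqv.
rewrite -/bmin -/bmax -/c1; apply: le_trans.
set E := \sum_(T in elems M) _.
have oscE : \sum_(T in elems M) osc (nodal_values x) T <= 16 * (C * h) ^+ 2 * E.
  rewrite /E mulr_sumr; apply: ler_sum => T TM.
  have od i j : i \in T -> j \in T -> (nodal_values x i - nodal_values x j) ^+ 2 <=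
      (C * h) ^+ 2 * enorm (b false T) ^+ 2.
    by move=> iT jT; rewrite -exprMn; exact: (le_nodal_difference (le T TM)).
  set w := _ * enorm _ ^+ 2 in od.
  have sw (f : nodes -> R) (c : R) : (forall i, i \in T -> f i <= c) -> \sum_(i in T) f i <= 4 * c.
    move=> fc; apply: (@le_trans _ _ (\sum_(i in T) c)); first exact: ler_sum.
    by rewrite sumr_const (card_elem conf TM) -[c *+ 4]mulr_natl.
  apply: (@le_trans _ _ (4 * (4 * w))); last by rewrite /w; lra.
  by apply: (sw) => i iT; apply: (sw) => j jT; exact: od.
have E0 : 0 <= E by apply: sumr_ge0 => T _; exact: sqr_ge0.
have pc := poincare conf cubic fat rho0 h0 h1 Bd0 Om_bounded (@nodal_values_boundary x).
rewrite sum_nodal_values -/N in pc.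
have N0 : 0 < N%:R :> R by rewrite ltr0n /N /packing_number expn_gt0.
have B1 : 0 < 2 * Bd + 1 by lra.
have le1 : enorm x ^+ 2 <= 4 * N%:R ^+ 3 * (2 * Bd + 1) ^+ 2 / h ^+ 2 * (16 * (C * h) ^+ 2 * E).
  apply: (le_trans pc); rewrite ler_wpM2l//.
  by rewrite divr_ge0 ?sqr_ge0// mulr_ge0 ?sqr_ge0// mulr_ge0// exprn_ge0// ltW.
have half : c1 / 2 <= c1 - 512 * bmax ^+ 2 * C ^+ 2 / sigma.
  have : 512 * bmax ^+ 2 * C ^+ 2 / sigma <= c1 / 2.
    rewrite ler_pdivrMr//; move: sigma_large; rewrite ler_pdivrMr//; lra.
  by lra.
apply: (@le_trans _ _ (c1 / 2 * h ^+ 3 * E)); last first.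
  by rewrite ler_wpM2r// ler_wpM2r// exprn_ge0// ltW.
have k0 : 0 <= coercivity_constant * h ^+ 3.
  rewrite mulr_ge0 ?exprn_ge0 ?(ltW hp)// divr_ge0 ?(ltW cc)//.
  by rewrite !mulr_ge0 ?exprn_ge0// ltW.
apply: (le_trans (ler_wpM2l k0 le1)).
rewrite le_eqVlt; apply/orP; left; apply/eqP; rewrite /coercivity_constant.
by field; rewrite ?gt_eqF.
Qed.

(** Gradients are at most nodal values divided by [h], hence the factor [h] for
    an energy of the size of [h ^+ 3] times the squared gradients. *)
Lemma stiffness_bounded (x y : 'cV_#|Nodes|) :
  `|vdot y (A *m x)| <= boundedness_constant * h * (enorm x ^+ 2 + enorm y ^+ 2).
Proof.
have [al [be [nb [nbP dat form]]]] := stiffness_form; rewrite form.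
have hp := h0; have cp := C0; have sp := sigma_gt0; have rp := rho0; have bp := bmax_gt0.
pose X (z : 'cV_#|Nodes|) (T : vset) := Num.sqrt (\sum_(i in T) nodal_values z i ^+ 2).
have X2 z (T : vset) : X z T ^+ 2 = \sum_(i in T) nodal_values z i ^+ 2.
  by rewrite sqr_sqrtr// sumr_ge0// => i _; exact: sqr_ge0.
have xX z (T : vset) i : i \in T -> `|nodal_values z i| <= X z T.
  move=> iT; rewrite -sqrtr_sqr ler_wsqrtr// (bigD1 i)//= lerDl.
  by apply: sumr_ge0 => j _; exact: sqr_ge0.
have le z (T : vset) : T \in elems M -> local_estimate h C T (nodal_values z)
    (fun s => \sum_i z i 0 * al i s T) (fun s => \sum_i z i 0 *: be i s T) (X z T).
  by move=> TM; apply: (local (dat z)) => // i; exact: xX.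
have X0 z (T : vset) : 0 <= X z T by exact: sqrtr_ge0.
have gl (z : 'cV_#|Nodes|) (T : vset) s : T \in elems M -> enorm (\sum_i z i 0 *: be i s T) <= C * X z T / h.
  by move=> TM; exact: (le_gradient (le z T TM)).
have vl (z : 'cV_#|Nodes|) (T : vset) s v : T \in elems M -> simplex T v ->
    `|\sum_i z i 0 * al i s T + dot (\sum_i z i 0 *: be i s T) v| <= C * X z T.
  by move=> TM Tv; exact: (le_value (le z T TM)).
have := Bform_bounded HP conf cubic fat rho0 h0 e0 e_rho flat nF_normal nbP sp C0 (X0 x) (X0 y)
  (gl x) (gl y) (vl x) (vl y).
rewrite -/bmax => /le_trans; apply.
rewrite (eq_bigr _ (fun T _ => congr2 +%R (X2 x T) (X2 y T))) big_split/=.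
have sx z : \sum_(T in elems M) \sum_(i in T) nodal_values z i ^+ 2 <= N%:R * enorm z ^+ 2.
  by rewrite -sum_nodal_values; exact: (sum_over_elements conf cubic fat).
have c0 : 0 <= (283 * bmax + 128 * sigma / rho) * C ^+ 2 * h.
  have C2 : 0 < C ^+ 2 by exact: exprn_gt0.
  exact: ltW (mulr_gt0 (mulr_gt0 bounded_factor_gt0 C2) hp).
apply: (le_trans (ler_wpM2l c0 (lerD (sx x) (sx y)))).
by rewrite /boundedness_constant le_eqVlt; apply/orP; left; apply/eqP; ring.
Qed.

Lemma stiffness_kappa :
  (kappa2 A <= (2 * boundedness_constant / coercivity_constant * h ^- 2)%:E)%E.
Proof.
have hp := h0; have k0 := coercivity_constant_gt0; have K0 := ltW boundedness_constant_gt0.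
have -> : 2 * boundedness_constant / coercivity_constant * h ^- 2 =
    2 * (boundedness_constant * h) / (coercivity_constant * h ^+ 3).
  by field; rewrite !gt_eqF.
apply: kappa2_le.
- by rewrite mulr_gt0// exprn_gt0.
- by rewrite mulr_ge0// ltW.
- exact: stiffness_coercive.
- exact: stiffness_bounded.
Qed.

End Stiffness.

Unset Implicit Arguments.

Theorem lemma5p6 (R : realType) (P : interface R) (rho theta : R) :
  interface_problem P -> 0 < rho -> theta < pi ->
  exists sigma0 h0 : R, 0 < sigma0 /\ 0 < h0 /\
  forall sigma : R, sigma0 <= sigma ->
  exists C : R, 0 < C /\
  forall (h : R) (M : mesh R) (D : {set 'I_(nnodes M)} -> 'I_3 -> 'rV[R]_3)
    (nF : {set 'I_(nnodes M)} -> 'rV[R]_3)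
    (phi : 'I_(nnodes M) -> 'rV[R]_3 -> R),
  0 < h -> h <= h0 ->
  conforming_mesh M (Omega P) ->
  subdivides_cubic_mesh M h ->
  regular_elements M rho h ->
  interface_points (Gamma P) theta D ->
  (forall F, is_face F -> unit_normal (nF F) (simplex F)) ->
  nodal_basis P D phi ->
  (kappa2 (stiffness P nF sigma phi) <= (C * h ^- 2)%:E)%E.
Proof.
move=> HP rho0 tpi.
have [e [h1 [e0 e_rho h10 local]]] := local_estimates HP rho0 tpi.
have [Bd [Bd0 Om_bounded]] := Omega_bound HP.
pose C := stability_constant P rho.
have C0 : 0 < C.
  have [s1 s2 s3 s4] := stability_constant_ge0 HP rho0.
  by have := B_ge1 HP; rewrite /C /stability_constant; lra.
pose bmax := Num.max (beta_p P) (beta_m P); pose bmin := Num.min (beta_p P) (beta_m P).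
pose c1 := bmin * (rho / 4) ^+ 3 / C ^+ 2.
have bmin0 : 0 < bmin by exact: bmin_gt0.
have bmax0 : 0 < bmax by exact: bmax_gt0.
have c10 : 0 < c1 by rewrite divr_gt0 ?exprn_gt0// mulr_gt0 ?exprn_gt0 ?divr_gt0.
exists (1024 * bmax ^+ 2 * C ^+ 2 / c1), (Num.min h1 1); split.
  have : 0 < bmax ^+ 2 * C ^+ 2 / c1.
    by apply: divr_gt0 => //; apply: mulr_gt0; exact: exprn_gt0.
  by lra.
split; first by rewrite lt_min h10 ltr01.
move=> sigma sl.
exists (2 * boundedness_constant P rho C sigma / coercivity_constant P rho Bd C); split.
  rewrite divr_gt0 ?(coercivity_constant_gt0 HP)// mulr_gt0//.
  exact: boundedness_constant_gt0 sl.
move=> h M D nF phi h0; rewrite le_min => /andP[hh1 h1'] conf cubic fat points nFn basis.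
have [flat loc] := local h M D h0 hh1 conf cubic fat points.
exact: (stiffness_kappa HP conf cubic fat rho0 h0 h1' Bd0 Om_bounded e0 e_rho flat C0 loc nFn basis sl).
Qed.
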